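(* Suppose $n=2$ and the cost structure is separable. If marginal investment costs are sufficiently convex, there exists $\theta_0\in[0,1]$ such that the score floor auction (with threshold $\theta_0$) is an optimal mechanism, i.e. it achieves the bound $\overline U_{asy}$ and solves the full problem (P).
   Context: Setting. A buyer procures one contract from two firms $i=1,2$ (firm 1 is the ''favored'' one). Types $\theta_i\in[0,1]$ are private, independent with cdf $F$ and strictly positive density $f$. Separable cost structure: the buyer's value of quality is $V(q)=q$; the production (winner-pay) cost is $C^P(q,\theta)=\alpha\theta$ with $\alpha>0$; the investment (all-pay) cost is $C^I(q,\theta)=g(q)$ with $g'>0$, $g''>0$. Standing assumptions for this structure: $J(\theta)=\theta+F(\theta)/f(\theta)$ is strictly increasing; $g(0)=g'(0)=0$ (so $g'(q)>0$ is meant for $q>0$); $g'(q)>1$ at $q=\infty$ (for all large $q$). Firm $i$'s payoff is $t_i-\alpha\theta_iz_i-g(q_i)$; the buyer's payoff is $\sum_i(q_iz_i-t_i)$ ($z_i$ share of the contract, $t_i$ transfer to firm $i$). Sufficient convexity. Let $\xi(z)=1-J(F^{-1}(1-z))$. Marginal investment costs are sufficiently convex iff the function $q\mapsto\alpha\,\xi(g'(q))-q$ is strictly quasi-convex (where $\xi(g'(q))$ is defined). Mechanisms and problem (P). A mechanism $\mathcal M$ consists of message sets $M_i$ and functions $z_i(\mathbf m,\mathbf q)$, $t_i(\mathbf m,\mathbf q)$. After $\mathcal M$ is announced, each firm learns its type, then chooses quality $q_i\ge0$, then a message $m_i\in M_i$; a strategy is $\sigma_i(\theta_i)=(m_i(\theta_i),q_i(\theta_i))$.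 Problem (P): maximize the buyer's expected utility over pairs $(\mathcal M,\bm\sigma)$ such that $\bm\sigma$ is a (buyer-suggested) Bayes–Nash equilibrium of $\mathcal M$ (for every firm and every type $\theta_i$ in the support, $\sigma_i(\theta_i)$ maximizes interim expected payoff over all $(m_i',q_i'')\in M_i\times\mathbb R_+$), interim expected equilibrium payoffs are $\ge0$ for every type, and $z_i(\bm\sigma(\bm\theta))\ge0$, $z_1+z_2=1$ at $\bm\sigma(\bm\theta)$. Relaxed problem (P2): maximize $\mathbb E\sum_{i=1}^2\big((q_i(\theta_i)-\alpha J(\theta_i))z_i(\bm\theta)-g(q_i(\theta_i))\big)$ over $q_i(\theta_i)\ge0$ and $z_i(\bm\theta)\ge0$ with $z_1+z_2=1$. $\overline U_{asy}$ is its value (no symmetry restriction), an upper bound on the buyer's utility in (P). Score floor auction with threshold $\theta_0$. The message $m_i\in\mathbb R_+$ is the price offered by firm $i$; its score is $S_i=q_i-m_i$. With score floor $\underline S$ and bonus $B$: $z_1=\mathbb I(S_1\ge\max\{S_2,\underline S\})$, $t_1=m_1z_1+B\,\mathbb I(S_1\ge\underline S)$, $z_2=\mathbb I(S_2>\max\{S_1,\underline S\})$, $t_2=m_2z_2$. For $\theta_0\in[0,1)$, $$\underline S=S^*_{sym}(\theta_0)+\frac{IR(\theta_0,1)}{1-F(\theta_0)},\qquad B=\alpha(1-F(\theta_0))(1-\theta_0),$$ where $q^*_{sym}(\theta)=(g')^{-1}(1-F(\theta))$, $IR(\theta,\theta')=\alpha\int_\theta^{\theta'}(1-F(u))\,du$,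 and $S^*_{sym}(\theta)=q^*_{sym}(\theta)-\alpha\theta-\dfrac{g(q^*_{sym}(\theta))+IR(\theta,1)}{1-F(\theta)}$. The threshold $\theta_0=1$ stands for no censoring, i.e. the optimal symmetric mechanism (the first-score auction with score $q-p$). *)

(* Defs.v *)
From HB Require Import structures.
From mathcomp Require Import all_boot all_order all_algebra.
From mathcomp Require Import all_classical all_reals all_analysis.

Set Implicit Arguments.
Unset Strict Implicit.
Unset Printing Implicit Defensive.

Import Order.TTheory GRing.Theory Num.Theory.
Import numFieldNormedType.Exports.

Local Open Scope classical_set_scope.
Local Open Scope ring_scope.

(* The law of each firm's type, its density on [0, 1], the production cost
   coefficient alpha and the investment cost g.  Only the restrictions of the
   density to [0, 1] and of g to [0, +oo[ matter. *)
Record environment (R : realType) := Environment {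
  type_law : probability (measurableTypeR R) R ;
  density : R -> R ;
  alpha : R ;
  inv_cost : R -> R }.

Section primitives.
Context {R : realType} (E : environment R).

Definition types : set (measurableTypeR R) := `[0, 1]%classic.

Definition type_cdf (theta : R) : R := fine (type_law E `]-oo, theta]%classic).

Definition virtual_type (theta : R) : R :=
  theta + type_cdf theta / density E theta.

Definition quantile : R -> R := pinv types type_cdf.
Definition marginal_cost : R -> R := derive1 (inv_cost E).

Definition inv_marginal_cost : R -> R := pinv (`[0, +oo[%classic : set R) marginal_cost.

Definition xi (z : R) : R := 1 - virtual_type (quantile (1 - z)).

End primitives.

(* g is a cost on [0, +oo[, but its derivative at 0 is the two-sided one: any
   such cost with g(0) = g'(0) = 0 extends by 0 to a function on the line that
   is differentiable at 0, so the values at q < 0 carry no restriction. *)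
Record separable_structure (R : realType) (E : environment R) : Prop := {
  density_measurable : measurable_fun (@types R) (density E) ;
  density_gt0 : forall theta : R, theta \in `[0, 1] -> 0 < density E theta ;
  law_density : forall A : set (measurableTypeR R), measurable A ->
    type_law E A =
      (\int[lebesgue_measure]_(theta in A `&` types) (density E theta)%:E)%E ;
  virtual_type_increasing :
    {in `[0, 1] &, {homo virtual_type E : x y / x < y}} ;
  alpha_gt0 : 0 < alpha E ;
  cost0 : inv_cost E 0 = 0 ;
  cost_derivable : forall q : R, 0 <= q -> derivable (inv_cost E) q 1 ;
  marginal_cost0 : marginal_cost E 0 = 0 ;
  marginal_cost_gt0 : forall q : R, 0 < q -> 0 < marginal_cost E q ;
  marginal_cost_derivable :
    forall q : R, 0 < q -> derivable (marginal_cost E) q 1 ;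
  cost_convex : forall q : R, 0 < q -> 0 < derive1 (marginal_cost E) q ;
  marginal_cost_large : \forall q \near +oo, 1 < marginal_cost E q }.

Definition strictly_quasiconvex (R : realType) (D : set R) (k : R -> R) :=
  forall x y t : R, D x -> D y -> x != y -> 0 < t < 1 ->
    k (t * x + (1 - t) * y) < Num.max (k x) (k y).

(* xi is defined on [0, 1], whence the domain. *)
Definition sufficiently_convex (R : realType) (E : environment R) :=
  strictly_quasiconvex
    [set q : R | 0 <= q /\ marginal_cost E q \in `[0, 1]]
    (fun q => alpha E * xi E (marginal_cost E q) - q).

Definition favored : 'I_2 := ord0.
Definition rival : 'I_2 := ord_max.

Section mechanisms.
Context {R : realType}.

(* A firm's action is a message together with a quality. *)
Record mechanism := Mechanism {
  msg : 'I_2 -> Type ;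
  share : 'I_2 -> (forall i, msg i * {nonneg R}) -> R ;
  transfer : 'I_2 -> (forall i, msg i * {nonneg R}) -> R }.

Definition strategy (M : mechanism) : Type :=
  forall i, R -> msg M i * {nonneg R}.

(* Types are independent: a type profile is a point of R * R, drawn from the
   product of the law of types with itself; its first component is the type of
   the favored firm. *)
Definition type_profiles : set (measurableTypeR R * measurableTypeR R) :=
  types `*` types.

Definition type_of (theta : measurableTypeR R * measurableTypeR R)
    (i : 'I_2) : R :=
  if i == favored then theta.1 else theta.2.

Definition played (M : mechanism) (sigma : strategy M)
    (theta : measurableTypeR R * measurableTypeR R) :
    forall i, msg M i * {nonneg R} :=
  fun i => sigma i (type_of theta i).

(* Firm i takes action a while its opponent, of type x, follows sigma. *)
Definition deviation (M : mechanism) (sigma : strategy M) (i : 'I_2)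
    (a : msg M i * {nonneg R}) (x : R) : forall j, msg M j * {nonneg R} :=
  dfwith (fun j => sigma j x) i a.

Context (E : environment R).

Definition interim_payoff (M : mechanism) (sigma : strategy M) (i : 'I_2)
    (theta : R) (a : msg M i * {nonneg R}) : R :=
  (\int[type_law E]_(x in types)
     (transfer i (deviation sigma a x)
      - alpha E * theta * share i (deviation sigma a x)))
  - inv_cost E a.2%:num.

Definition buyer_utility (M : mechanism) (sigma : strategy M) : \bar R :=
  (\int[type_law E \x type_law E]_(theta in type_profiles)
    (\sum_(i < 2) ((played sigma theta i).2%:num * share i (played sigma theta)
                   - transfer i (played sigma theta)))%:E)%E.

(* The constraints of the buyer's problem; the first five fields say that all
   the expectations involved exist. *)
Record feasible (M : mechanism) (sigma : strategy M) : Prop := {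
  quality_measurable : forall i,
    measurable_fun (@types R)
      (fun x => (sigma i x).2%:num : measurableTypeR R) ;
  share_integrable : forall i,
    (type_law E \x type_law E)%E.-integrable type_profiles
      (fun theta => (share i (played sigma theta))%:E) ;
  transfer_integrable : forall i,
    (type_law E \x type_law E)%E.-integrable type_profiles
      (fun theta => (transfer i (played sigma theta))%:E) ;
  value_integrable : forall i,
    (type_law E \x type_law E)%E.-integrable type_profiles
      (fun theta => ((played sigma theta i).2%:num
                     * share i (played sigma theta))%:E) ;
  deviation_integrable : forall i (a : msg M i * {nonneg R}),
    (type_law E).-integrable types
      (fun x => (share i (deviation sigma a x))%:E) /\
    (type_law E).-integrable types
      (fun x => (transfer i (deviation sigma a x))%:E) ;
  equilibrium : forall i (theta : R) (a : msg M i * {nonneg R}),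
    theta \in `[0, 1] ->
    interim_payoff sigma theta a <= interim_payoff sigma theta (sigma i theta) ;
  participation : forall i (theta : R), theta \in `[0, 1] ->
    0 <= interim_payoff sigma theta (sigma i theta) ;
  share_ge0 : forall i theta, type_profiles theta ->
    0 <= share i (played sigma theta) ;
  share_sum1 : forall theta, type_profiles theta ->
    \sum_(i < 2) share i (played sigma theta) = 1 }.

Definition solves_buyer_problem (M : mechanism) (sigma : strategy M) : Prop :=
  feasible sigma /\
  forall (M' : mechanism) (sigma' : strategy M'), feasible sigma' ->
    (buyer_utility sigma' <= buyer_utility sigma)%E.

Record relaxed_feasible (q : 'I_2 -> R -> R)
    (z : 'I_2 -> measurableTypeR R * measurableTypeR R -> R) : Prop := {
  relaxed_quality_measurable : forall i,
    measurable_fun (@types R) (q i : _ -> measurableTypeR R) ;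
  relaxed_share_measurable : forall i,
    measurable_fun type_profiles (z i : _ -> measurableTypeR R) ;
  relaxed_quality_ge0 : forall i (theta : R), theta \in `[0, 1] -> 0 <= q i theta ;
  relaxed_share_ge0 : forall i theta, type_profiles theta -> 0 <= z i theta ;
  relaxed_share_sum1 : forall theta, type_profiles theta ->
    \sum_(i < 2) z i theta = 1 }.

(* The integrand is bounded above, so the integral makes sense in [-oo, +oo[. *)
Definition relaxed_objective (q : 'I_2 -> R -> R)
    (z : 'I_2 -> measurableTypeR R * measurableTypeR R -> R) : \bar R :=
  (\int[type_law E \x type_law E]_(theta in type_profiles)
    (\sum_(i < 2)
      ((q i (type_of theta i) - alpha E * virtual_type E (type_of theta i))
         * z i theta
       - inv_cost E (q i (type_of theta i))))%:E)%E.

Definition U_asy : \bar R :=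
  ereal_sup [set u | exists q z, relaxed_feasible q z /\
                                 u = relaxed_objective q z].

End mechanisms.

Section score_auctions.
Context {R : realType} (E : environment R).

(* The message is the price. *)
Definition score (a : 'I_2 -> {nonneg R} * {nonneg R}) (i : 'I_2) : R :=
  (a i).2%:num - (a i).1%:num.

Definition floor_share (floor : R) (i : 'I_2)
    (a : 'I_2 -> {nonneg R} * {nonneg R}) : R :=
  if i == favored
  then (Num.max (score a rival) floor <= score a favored)%R%:R
  else (Num.max (score a favored) floor < score a rival)%R%:R.

Definition floor_transfer (floor bonus : R) (i : 'I_2)
    (a : 'I_2 -> {nonneg R} * {nonneg R}) : R :=
  (a i).1%:num * floor_share floor i a
  + (if i == favored then bonus * (floor <= score a favored)%R%:R else 0).

(* Without floor; ties go to the favored firm, as above. *)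
Definition first_score_share (i : 'I_2)
    (a : 'I_2 -> {nonneg R} * {nonneg R}) : R :=
  if i == favored then (score a rival <= score a favored)%R%:R
  else (score a favored < score a rival)%R%:R.

Definition first_score_transfer (i : 'I_2)
    (a : 'I_2 -> {nonneg R} * {nonneg R}) : R :=
  (a i).1%:num * first_score_share i a.

Definition first_score_auction : @mechanism R :=
  @Mechanism R (fun=> {nonneg R}) first_score_share first_score_transfer.

Definition info_rent (theta theta' : R) : R :=
  alpha E * \int[lebesgue_measure]_(u in `[theta, theta'])
              (1 - type_cdf E u).

Definition quality_sym (theta : R) : R :=
  inv_marginal_cost E (1 - type_cdf E theta).

Definition score_sym (theta : R) : R :=
  quality_sym theta - alpha E * theta
  - (inv_cost E (quality_sym theta) + info_rent theta 1)
    / (1 - type_cdf E theta).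

Definition score_floor (theta0 : R) : R :=
  score_sym theta0 + info_rent theta0 1 / (1 - type_cdf E theta0).

Definition floor_bonus (theta0 : R) : R :=
  alpha E * (1 - type_cdf E theta0) * (1 - theta0).

(* The threshold 1 stands for no censoring. *)
Definition score_floor_auction (theta0 : R) : @mechanism R :=
  if theta0 < 1 then
    @Mechanism R (fun=> {nonneg R}) (floor_share (score_floor theta0))
      (floor_transfer (score_floor theta0) (floor_bonus theta0))
  else first_score_auction.

End score_auctions.

(* Main.v *)
(* Let Q be the inverse of g' and G = 1 - F.  In the relaxed problem the buyer
   gets E max (v_1, v_2) - E g(q_1) - E g(q_2) with v_i = q_i - alpha J.  Against
   a fixed schedule of the opponent the best q_i makes v_i nonincreasing in the
   type (strict supermodularity of the cost), so that firm 1 wins on a region r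
   of the type square that is monotone in both types.  By Fenchel-Young the
   optimal qualities given r are worth the integral of Q(G(y)) over the opponents
   y that are beaten, so the buyer gets at most
     V(r) = int_r (Q(G(y)) - alpha J(x)) + int_{not r} (Q(G(x)) - alpha J(y)).
   Exchanging x and y, V(r) depends only on the pairs x < y in which the lower
   type wins whichever firm has it, each weighted by k(y) - k(x), where
   k = Q o G + alpha J.  Sufficient convexity says that k is strictly
   quasiconcave: for every x the weight changes sign at most once in y, hence it
   is optimal to pool either no y > x or all of them, and the latter is better
   exactly from some threshold on.  This is the allocation of the score floor
   auction.  The envelope theorem turns the buyer's utility in any feasible
   mechanism into the relaxed objective minus the rents of the types 1, and these
   rents vanish in the score floor auction. *)

Require Import Defs.
From mathcomp Require Import all_boot all_order all_algebra.
From mathcomp Require Import all_classical all_reals all_analysis.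
From mathcomp Require Import measurable_realfun.
From mathcomp Require Import ring lra.

Set Implicit Arguments.
Unset Strict Implicit.
Unset Printing Implicit Defensive.

Import Order.TTheory GRing.Theory Num.Theory.
Import numFieldNormedType.Exports.

Local Open Scope classical_set_scope.
Local Open Scope ring_scope.

(** * Increments *)

(** Each identity that would come from differentiation (the conjugate cost along [G], the envelope
    formula) is obtained from two-sided bounds on increments with monotone factors: two functions
    obeying the same bounds differ by a constant. No pair of mutually optimal schedules has to
    exist: two successive best replies do not lower the value and leave both schedules monotone. A
    winning probability is at most 1, so qualities above [Q 1] can be cut, which makes the relaxed
    problem one about bounded functions. Thresholds and ties are settled up to one type, which the
    law does not charge. In the auction a deviation is a free pair of price and quality, not just
    the imitation of a type. Fixing the score separates the two choices: the score determines the
    winning probability, and the quality then solves a Fenchel problem. The threshold 1 needs no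
    second equilibrium analysis, because the first-score auction and the floor auction agree after
    unilateral deviations. *)

Section sandwich.
Context {R : realType}.

(* Cutting [a, b] at the points where psi takes n equidistant values, the
   increments of D telescope to at most (phi a - phi b) (psi b - psi a) / n. *)
Lemma increments_bound_eq (D phi psi : R -> R) (a b : R) : a <= b ->
  {within `[a, b], continuous psi} ->
  {in `[a, b] &, {homo psi : x y / x < y}} ->
  (forall x y, a <= x -> x <= y -> y <= b ->
    `|D y - D x| <= (phi x - phi y) * (psi y - psi x)) ->
  D a = D b.
Proof.
move=> ab cpsi ipsi hD.
have mpsi : {in `[a, b] &, {mono psi : x y / x <= y}} by apply: le_mono_in.
have psiab : psi a <= psi b by rewrite mpsi ?in_itv/= ?lexx ?ab.
have key n : `|D b - D a| <= (phi a - phi b) * (psi b - psi a) / n.+1%:R.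
  pose v k := psi a + k%:R / n.+1%:R * (psi b - psi a).
  have nR : (0 : R) < n.+1%:R by rewrite ltr0n.
  have hv k : (k <= n.+1)%N -> exists2 c, c \in `[a, b] & psi c = v k.
    move=> kn; apply: IVT => //.
    have k0 : 0 <= k%:R / n.+1%:R :> R by rewrite divr_ge0.
    have k1 : k%:R / n.+1%:R <= 1 :> R by rewrite ler_pdivrMr// mul1r ler_nat.
    have d0 : 0 <= psi b - psi a by rewrite subr_ge0.
    rewrite (min_l psiab) (max_r psiab) /v lerDl mulr_ge0//= -lerBrDl.
    by rewrite ler_piMl.
  pose x k := if pselect (k <= n.+1)%N is left h then projT1 (cid2 (hv k h)) else b.
  have xP k : (k <= n.+1)%N -> x k \in `[a, b] /\ psi (x k) = v k.
    by rewrite /x; case: pselect => // h _; case: (cid2 (hv k h)).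
  have inj : {in `[a, b] &, injective psi} by apply: inc_inj_in.
  have x0 : x 0%N = a.
    have [xi xe] := xP 0%N isT; apply: inj => //; first by rewrite in_itv/= lexx.
    by rewrite xe /v mul0r mul0r addr0.
  have xn : x n.+1 = b.
    have [xi xe] := xP n.+1 (leqnn _); apply: inj => //; first by rewrite in_itv/= lexx ab.
    by rewrite xe /v divff ?gt_eqF// mul1r addrC subrK.
  have H m : (m <= n.+1)%N -> `|D (x m) - D a| <=
      (phi a - phi (x m)) * ((psi b - psi a) / n.+1%:R).
    elim: m => [_|m IH mn]; first by rewrite x0 !subrr normr0 mul0r.
    have [xi xe] := xP m (ltnW mn).
    have [yi ye] := xP m.+1 mn.
    have vv : v m.+1 - v m = (psi b - psi a) / n.+1%:R.
      by rewrite /v -natr1; field; rewrite gt_eqF.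
    have xy : x m <= x m.+1.
      by rewrite -mpsi// xe ye -subr_ge0 vv divr_ge0// subr_ge0.
    have := IH (ltnW mn).
    have ax : a <= x m by rewrite (itvP xi).
    have := hD _ _ ax xy.
    rewrite (itvP yi) => /(_ isT); rewrite xe ye vv => h1 h2.
    have -> : D (x m.+1) - D a = (D (x m.+1) - D (x m)) + (D (x m) - D a) by ring.
    apply: le_trans (ler_normD _ _) _.
    apply: le_trans (lerD h1 h2) _.
    by rewrite -mulrDl addrC subrKA.
  by have := H n.+1 (leqnn _); rewrite xn mulrA.
apply/eqP; rewrite eq_sym -subr_eq0 -normr_le0 leNgt; apply/negP => D0.
set C := (phi a - phi b) * (psi b - psi a) in key.
have [n hn] : exists n, C / `|D b - D a| < n.+1%:R.
  exists (Num.truncn (`|C / `|D b - D a| |)).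
  by apply: le_lt_trans (ler_norm _) _; rewrite truncnS_gt.
have := key n; rewrite ler_pdivlMr ?ltr0n// leNgt => /negP; apply.
by rewrite mulrC -ltr_pdivrMr.
Qed.

End sandwich.

(** * The investment cost *)

Section costs.
Context {R : realType} (E : environment R) (hE : separable_structure E).
Local Notation g := (inv_cost E).
Local Notation g' := (marginal_cost E).
Local Notation Q := (inv_marginal_cost E).

Lemma cost_MVT (a b : R) : 0 <= a -> a < b ->
  exists c, [/\ a < c, c < b & g b - g a = g' c * (b - a)].
Proof.
move=> a0 ab.
have drv (x : R) : 0 <= x -> is_derive x 1 g (g' x).
  by move=> x0; split; [exact: cost_derivable|rewrite /marginal_cost derive1E].
have [||c] := @MVT R g g' a b ab.
- by move=> x; rewrite in_itv/= => /andP[ax _]; apply: drv; lra.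
- apply: derivable_within_continuous => x; rewrite in_itv/= => /andP[ax _].
  by apply: cost_derivable => //; lra.
by rewrite in_itv/= => /andP[ac cb] e; exists c.
Qed.

Lemma marginal_cost_lt (x y : R) : 0 <= x -> x < y -> g' x < g' y.
Proof.
rewrite le_eqVlt => /predU1P[<-|x0] xy.
  by rewrite marginal_cost0 ?marginal_cost_gt0.
have [||c] := @MVT R g' (derive1 g') x y xy.
- move=> z; rewrite in_itv/= => /andP[xz _].
  have z0 : 0 < z by lra.
  by split; [exact: marginal_cost_derivable|rewrite derive1E].
- apply: derivable_within_continuous => z; rewrite in_itv/= => /andP[xz _].
  by apply: marginal_cost_derivable => //; lra.
rewrite in_itv/= => /andP[xc _] e.
by rewrite -subr_gt0 e mulr_gt0 ?subr_gt0// cost_convex//; lra.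
Qed.

Lemma marginal_cost_le (x y : R) : 0 <= x -> x <= y -> g' x <= g' y.
Proof.
by move=> x0; rewrite le_eqVlt => /predU1P[->//|/(marginal_cost_lt x0)/ltW].
Qed.

Lemma marginal_cost_ge0 (x : R) : 0 <= x -> 0 <= g' x.
Proof. by move=> x0; rewrite -(marginal_cost0 hE) marginal_cost_le. Qed.

Lemma cost_tangent (p q : R) : 0 <= p -> 0 <= q -> g p + g' p * (q - p) <= g q.
Proof.
move=> p0 q0; have [pq|qp|->] := ltgtP p q; last by rewrite subrr mulr0 addr0.
- have [c [pc cq e]] := cost_MVT p0 pq.
  rewrite -lerBrDl e ler_wpM2r ?subr_ge0 ?(ltW pq)// marginal_cost_le// ltW//.
- have [c [qc cp e]] := cost_MVT q0 qp.
  have : g' c * (p - q) <= g' p * (p - q).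
    by rewrite ler_wpM2r ?subr_ge0 ?(ltW qp)// marginal_cost_le ?(ltW cp)//; lra.
  lra.
Qed.

Lemma cost_le (x y : R) : 0 <= x -> x <= y -> g x <= g y.
Proof.
move=> x0 xy; have y0 := le_trans x0 xy; apply: le_trans (cost_tangent x0 y0).
by rewrite lerDl mulr_ge0 ?subr_ge0// marginal_cost_ge0.
Qed.

Lemma cost_ge0 (x : R) : 0 <= x -> 0 <= g x.
Proof. by move=> x0; rewrite -(cost0 hE) cost_le. Qed.

Lemma cost_gt0 (x : R) : 0 < x -> 0 < g x.
Proof.
move=> x0; have [c [c0 _ e]] := cost_MVT (lexx 0) x0.
have : 0 < g x - g 0 by rewrite e mulr_gt0 ?marginal_cost_gt0// subr0.
by rewrite cost0// subr0.
Qed.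

(* A function of v + s is strictly supermodular in (v, s) when it is strictly
   convex. *)
Lemma cost_supermodular (v w s t : R) : 0 <= v + s -> v < w -> s < t ->
  g (w + s) + g (v + t) < g (v + s) + g (w + t).
Proof.
(* The inequality is symmetric under exchanging (v, w) with (s, t), so [w + s <= v + t] may be
   assumed; the mean value points of the two increments of length [w - v] are then ordered. *)
suff main (v' w' s' t' : R) : 0 <= v' + s' -> v' < w' -> s' < t' ->
    w' + s' <= v' + t' ->
    g (w' + s') + g (v' + t') < g (v' + s') + g (w' + t').
  move=> h0 vw st; have [|/ltW] := leP (w + s) (v + t); first exact: main.
  by have := main s t v w; rewrite !(addrC s) !(addrC t) => H h; have := H h0 st vw h; lra.
move=> h0 vw st h.
have [|c [c0 c1 e1]] := @cost_MVT (v' + s') (w' + s') h0; first lra.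
have [||d [d1 _ e2]] := @cost_MVT (v' + t') (w' + t'); [lra|lra|].
have : g' c * (w' - v') < g' d * (w' - v').
  by rewrite ltr_pM2r ?subr_gt0// marginal_cost_lt//; lra.
move: e1 e2; have -> : w' + s' - (v' + s') = w' - v' by ring.
have -> : w' + t' - (v' + t') = w' - v' by ring.
move=> <- <-; lra.
Qed.

(** Continuity of [g'] at 0 is not at hand. Differentiability of [g] at 0 with [g' 0 = 0] makes a
    difference quotient small, and the mean value theorem gives a point where [g'] equals it: the
    lower end for the intermediate value theorem in [marginal_cost_onto]. *)
Lemma cost_slope_small (z : R) : 0 < z -> exists2 q, 0 < q & g' q < z.
Proof.
move=> z0.
have d0 : derivable g 0 1 by exact: cost_derivable.
have dg : 'D_1 g 0 = 0 by rewrite -derive1E; exact: marginal_cost0.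
have : (fun h : R => h^-1 *: ((g \o shift 0) (h *: 1) - g 0)) @ 0^' --> 'D_1 g 0.
  exact: d0.
rewrite dg => /cvgr0Pnorm_lt /(_ z z0) /= [e /= e0 he].
have q0 : 0 < e / 2 by rewrite divr_gt0.
have := he (e / 2); rewrite /ball_/= sub0r normrN gtr0_norm// => /(_ _)/=.
rewrite gt_eqF// scaler1 addr0 cost0// subr0 => hz.
have {hz} hz : `|(e / 2)^-1 *: g (e / 2)| < z by apply: hz => //; lra.
have [c [c0 ce gc]] := cost_MVT (lexx 0) q0.
exists c => //; move: gc hz; rewrite cost0// !subr0 => ->.
rewrite scalerAl; apply: le_lt_trans; apply: le_trans (ler_norm _).
by rewrite /GRing.scale/= mulrAC mulVf ?mul1r// gt_eqF.
Qed.

Lemma marginal_cost_inj : {in (`[0, +oo[%classic : set R) &, injective g'}.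
Proof.
move=> x y; rewrite !inE/= !in_itv/= !andbT => x0 y0 e.
by have [/(marginal_cost_lt x0)|/(marginal_cost_lt y0)|//] := ltgtP x y;
  rewrite e ltxx.
Qed.

Lemma inv_marginal_costK (q : R) : 0 <= q -> Q (g' q) = q.
Proof.
move=> q0; rewrite /inv_marginal_cost pinvKV//; first exact: marginal_cost_inj.
by rewrite inE/= in_itv/= q0.
Qed.

Lemma marginal_cost_onto (z : R) : 0 <= z <= 1 -> exists2 q, 0 <= q & g' q = z.
Proof.
move=> /andP[]; rewrite le_eqVlt => /predU1P[<- _|z0 z1].
  by exists 0; rewrite ?marginal_cost0.
have [p p0 pz] := cost_slope_small z0.
have [M [Mr hM]] := marginal_cost_large hE.
pose q := Num.max p (M + 1).
have qM : 1 < g' q by apply: hM; rewrite lt_max ltrDl ltr01 orbT.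
have pq : p <= q by rewrite le_max lexx.
have [||c] := @IVT R g' p q z pq.
- apply: derivable_within_continuous => x; rewrite in_itv/= => /andP[xp _].
  by apply: marginal_cost_derivable => //; lra.
- by rewrite ge_min le_max (ltW pz)/= (le_trans z1 (ltW qM)) orbT.
by rewrite in_itv/= => /andP[pc _] <-; exists c => //; lra.
Qed.

Lemma inv_marginal_cost_ge0 (z : R) : 0 <= z <= 1 -> 0 <= Q z.
Proof. by move=> /marginal_cost_onto[q q0 <-]; rewrite inv_marginal_costK. Qed.

Lemma inv_marginal_costV (z : R) : 0 <= z <= 1 -> g' (Q z) = z.
Proof. by move=> /marginal_cost_onto[q q0 <-]; rewrite inv_marginal_costK. Qed.

Lemma inv_marginal_cost0 : Q 0 = 0.
Proof. by rewrite -[X in Q X](marginal_cost0 hE) inv_marginal_costK. Qed.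

Lemma inv_marginal_cost_lt (y z : R) : 0 <= y -> z <= 1 -> y < z -> Q y < Q z.
Proof.
move=> y0 z1 yz; rewrite ltNge; apply/negP => h.
have Qz : 0 <= Q z by rewrite inv_marginal_cost_ge0// z1 andbT; lra.
have := marginal_cost_le Qz h.
rewrite !inv_marginal_costV ?y0 ?z1 ?andbT/=; lra.
Qed.

Lemma inv_marginal_cost_le (y z : R) : 0 <= y -> z <= 1 -> y <= z -> Q y <= Q z.
Proof.
move=> y0 z1; rewrite le_eqVlt => /predU1P[->//|yz].
by rewrite ltW// inv_marginal_cost_lt.
Qed.

Lemma inv_marginal_cost_gt0 (z : R) : 0 < z <= 1 -> 0 < Q z.
Proof.
by move=> /andP[z0 z1]; rewrite -[X in X < _]inv_marginal_cost0 inv_marginal_cost_lt.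
Qed.

(** The Fenchel conjugate of [g] for [w] in [0, 1]: the supremum of [q * w - g q] over [q >= 0],
    attained at [Q w] because [g' (Q w) = w]. *)
Definition conjugate_cost (w : R) := Q w * w - g (Q w).

Lemma conjugate_cost_ub (q w : R) : 0 <= q -> 0 <= w <= 1 ->
  q * w - g q <= conjugate_cost w.
Proof.
move=> q0 w01; have := cost_tangent (inv_marginal_cost_ge0 w01) q0.
by rewrite inv_marginal_costV// /conjugate_cost; lra.
Qed.

(** [Q v] is a subgradient at [v], since the quality [Q v] remains available when the probability is
    [w]. *)
Lemma conjugate_cost_tangent (v w : R) : 0 <= v <= 1 -> 0 <= w <= 1 ->
  conjugate_cost v + Q v * (w - v) <= conjugate_cost w.
Proof.
move=> v01 w01; apply: le_trans (conjugate_cost_ub (inv_marginal_cost_ge0 v01) w01).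
by rewrite /conjugate_cost; lra.
Qed.

(** Beyond [Q 1] the marginal cost exceeds 1, hence any winning probability. *)
Lemma truncated_quality_better (q z : R) : 0 <= q -> 0 <= z <= 1 ->
  q * z - g q <= Num.min q (Q 1) * z - g (Num.min q (Q 1)).
Proof.
move=> q0 /andP[z0 z1]; have [//|Qq] := leP q (Q 1).
have Q0 : 0 <= Q 1 by rewrite inv_marginal_cost_ge0// lexx ler01.
have := cost_tangent Q0 q0; rewrite inv_marginal_costV ?lexx ?ler01//; nra.
Qed.

End costs.

(** * Expectations of bounded functions *)

Section bounded_measurable.
Context {R : realType}.

(** Measurability and the bound are required on the whole space rather than on [types], so that the
    closure properties settle integrability without tracking domains. *)
Definition bmeas d (T : measurableType d) (f : T -> R) :=
  measurable_fun [set: T] f /\ exists M : R, forall x, `|f x| <= M.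

Context d (T : measurableType d).
Implicit Types f h : T -> R.

Lemma bmeas_cst r : bmeas (fun _ : T => r).
Proof. by split; [exact: measurable_cst|exists `|r|]. Qed.

Lemma bmeasD f h : bmeas f -> bmeas h -> bmeas (fun x => f x + h x).
Proof.
move=> [mf [M fM]] [mh [N hN]]; split; first exact: measurable_funD.
by exists (M + N) => x; rewrite (le_trans (ler_normD _ _))// lerD.
Qed.

Lemma bmeasN f : bmeas f -> bmeas (fun x => - f x).
Proof.
move=> [mf [M fM]]; split; first exact/measurable_funN.
by exists M => x; rewrite normrN.
Qed.

Lemma bmeasB f h : bmeas f -> bmeas h -> bmeas (fun x => f x - h x).
Proof. by move=> bf bh; apply: bmeasD => //; exact: bmeasN. Qed.

Lemma bmeasM f h : bmeas f -> bmeas h -> bmeas (fun x => f x * h x).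
Proof.
move=> [mf [M fM]] [mh [N hN]]; split; first exact: measurable_funM.
by exists (M * N) => x; rewrite normrM ler_pM.
Qed.

Lemma bmeasZ r f : bmeas f -> bmeas (fun x => r * f x).
Proof. by apply: bmeasM; exact: bmeas_cst. Qed.

Lemma bmeas_max f h : bmeas f -> bmeas h -> bmeas (fun x => Num.max (f x) (h x)).
Proof.
move=> [mf [M fM]] [mh [N hN]]; split; first exact: measurable_maxr.
exists (M + N) => x; rewrite /Num.max; case: ifP => _;
  have := fM x; have := hN x; have := normr_ge0 (f x); have := normr_ge0 (h x); lra.
Qed.

Lemma bmeas_bool (b : T -> bool) : measurable_fun setT b ->
  bmeas (fun x => (b x)%:R).
Proof.
move=> mb; split; last by exists 1 => x; case: (b x); rewrite ?normr1 ?normr0.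
rewrite (_ : (fun x => _) = fun x => if b x then 1 else 0); last first.
  by apply/funext => x; case: (b x).
by apply: measurable_fun_ifT => //; exact: measurable_cst.
Qed.

Lemma bmeas_le f h : bmeas f -> bmeas h -> bmeas (fun x => (f x <= h x)%R%:R).
Proof. by move=> [mf _] [mh _]; apply: bmeas_bool; exact: measurable_fun_ler. Qed.

Lemma bmeas_lt f h : bmeas f -> bmeas h -> bmeas (fun x => (f x < h x)%R%:R).
Proof. by move=> [mf _] [mh _]; apply: bmeas_bool; exact: measurable_fun_ltr. Qed.

Lemma bmeas_comp d' (T' : measurableType d') (k : T' -> T) f :
  measurable_fun setT k -> bmeas f -> bmeas (fun x => f (k x)).
Proof.
move=> mk [mf [M fM]]; split; first exact: measurableT_comp.
by exists M => x; exact: fM.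
Qed.

Lemma bmeas_integrable (mu : {measure set T -> \bar R}) f :
  (mu setT < +oo)%E -> bmeas f -> mu.-integrable setT (EFin \o f).
Proof.
move=> muoo [mf [M fM]]; apply: measurable_bounded_integrable => //.
by exists M; split; [exact: num_real|move=> N MN x _; exact: le_trans (fM x) (ltW MN)].
Qed.

End bounded_measurable.

Section expectation.
Context {R : realType} d (T : measurableType d) (P : probability T R).
Implicit Types f h : T -> R.

Definition Ex f : R := (\int[P]_x f x)%R.

Lemma bmeas_integrableP f : bmeas f -> P.-integrable setT (EFin \o f).
Proof. by apply: bmeas_integrable; have /= -> := @probability_setT _ _ _ P; rewrite ltry. Qed.

Lemma Ex_cst r : Ex (fun=> r) = r.
Proof.
by rewrite /Ex Rintegral_cst//; have /= -> := @probability_setT _ _ _ P; rewrite mulr1.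
Qed.

Lemma ExD f h : bmeas f -> bmeas h -> Ex (fun x => f x + h x) = Ex f + Ex h.
Proof. by move=> bf bh; apply: RintegralD => //; exact: bmeas_integrableP. Qed.

Lemma ExB f h : bmeas f -> bmeas h -> Ex (fun x => f x - h x) = Ex f - Ex h.
Proof. by move=> bf bh; apply: RintegralB => //; exact: bmeas_integrableP. Qed.

Lemma ExZ r f : bmeas f -> Ex (fun x => r * f x) = r * Ex f.
Proof. by move=> bf; apply: RintegralZl => //; exact: bmeas_integrableP. Qed.

Lemma ExZr r f : bmeas f -> Ex (fun x => f x * r) = Ex f * r.
Proof. by move=> bf; apply: RintegralZr => //; exact: bmeas_integrableP. Qed.

Lemma le_Ex f h : bmeas f -> bmeas h -> (forall x, f x <= h x) -> Ex f <= Ex h.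
Proof.
by move=> bf bh fh; apply: le_Rintegral => //; exact: bmeas_integrableP.
Qed.

Lemma Ex_ge0 f : (forall x, 0 <= f x) -> 0 <= Ex f.
Proof. by move=> f0; apply: Rintegral_ge0. Qed.

Lemma eq_Ex f h : f =1 h -> Ex f = Ex h.
Proof. by move=> /funext ->. Qed.

Lemma EFin_Ex f : bmeas f -> (\int[P]_x (f x)%:E)%E = (Ex f)%:E.
Proof.
move=> bf; rewrite /Ex /Rintegral fineK//.
by apply: integrable_fin_num => //; exact: bmeas_integrableP.
Qed.

Lemma Ex_normB f h : bmeas f -> bmeas h -> forall e,
  (forall x, `|f x - h x| <= e) -> `|Ex f - Ex h| <= e.
Proof.
move=> bf bh e fh; rewrite -ExB// ler_norml -[e in X in X && _](Ex_cst e).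
rewrite -[- _ in X in X && _]mulN1r -ExZ; last exact: bmeas_cst.
have be : bmeas (fun _ : T => e) by exact: bmeas_cst.
rewrite -[X in _ && (_ <= X)](Ex_cst e) !le_Ex//; do ?[exact: bmeasB|exact: bmeasZ].
  by move=> x; have := fh x; rewrite ler_norml => /andP[].
by move=> x; have := fh x; rewrite ler_norml mulN1r => /andP[].
Qed.

(** Links the unrestricted [Ex] to the integrals over [types] in the statement: the complement of an
    event of probability one is negligible. *)
Lemma EFin_Ex_event (D : set T) f : measurable D -> P D = 1%E -> bmeas f ->
  (\int[P]_(x in D) (f x)%:E)%E = (Ex f)%:E.
Proof.
move=> mD PD bf; rewrite -EFin_Ex// [RHS](@negligible_integral _ _ _ _ _ (~` D))//.
- by rewrite setTD setCK.
- exact: measurableC.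
- exact: bmeas_integrableP.
- by have /= -> := @probability_setC _ _ _ P _ mD; rewrite PD subee.
Qed.

Lemma eq_Ex_event (D : set T) f h : measurable D -> P D = 1%E ->
  bmeas f -> bmeas h -> (forall x, D x -> f x = h x) -> Ex f = Ex h.
Proof.
move=> mD PD bf bh fh; apply/EFin_inj; rewrite -!(EFin_Ex_event mD PD)//.
by apply: eq_integral => x /set_mem /fh ->.
Qed.

Lemma le_Ex_event (D : set T) f h : measurable D -> P D = 1%E ->
  bmeas f -> bmeas h -> (forall x, D x -> f x <= h x) -> Ex f <= Ex h.
Proof.
move=> mD PD bf bh fh; rewrite -lee_fin -!(EFin_Ex_event mD PD)//.
apply: le_integral => //.
- by apply: (integrableS measurableT) => //; exact: bmeas_integrableP.
- by apply: (integrableS measurableT) => //; exact: bmeas_integrableP.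
by move=> x /set_mem /fh; rewrite lee_fin.
Qed.

End expectation.

Section iterated_expectation.
Context {R : realType} d1 d2 (T1 : measurableType d1) (T2 : measurableType d2).
Context (P1 : probability T1 R) (P2 : probability T2 R).
Implicit Types f : T1 * T2 -> R.

Lemma bmeas_integrable_prod f : bmeas f -> (P1 \x P2)%E.-integrable setT (EFin \o f).
Proof.
apply: bmeas_integrable.
have /= := @product_measure1E _ _ _ _ _ P1 P2 setT setT measurableT measurableT.
rewrite setXTT => ->.
have /= -> := @probability_setT _ _ _ P1.
by have /= -> := @probability_setT _ _ _ P2; rewrite mule1 ltry.
Qed.

Lemma bmeas_section1 f x : bmeas f -> bmeas (fun y => f (x, y)).
Proof. by apply: bmeas_comp; exact: pair1_measurable. Qed.

Lemma bmeas_section2 f y : bmeas f -> bmeas (fun x => f (x, y)).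
Proof. by apply: bmeas_comp; exact: pair2_measurable. Qed.

Lemma norm_Ex_le d (T : measurableType d) (P : probability T R) (f : T -> R) M :
  bmeas f -> (forall x, `|f x| <= M) -> `|Ex P f| <= M.
Proof.
move=> bf fM; rewrite -[Ex P f]subr0 -(Ex_cst P 0); apply: Ex_normB => //.
  exact: bmeas_cst.
by move=> x; rewrite subr0.
Qed.

Lemma bmeas_Ex1 f : bmeas f -> bmeas (fun x => Ex P2 (fun y => f (x, y))).
Proof.
move=> bf; split; last first.
  by case: (bf) => _ [M fM]; exists M => x; apply: norm_Ex_le => //; exact: bmeas_section1.
apply/measurable_EFinP.
rewrite (_ : _ \o _ = fubini_F P2 (EFin \o f)); last first.
  by apply/funext => x; rewrite /fubini_F/= EFin_Ex//; exact: bmeas_section1.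
apply: (@measurable_fubini_F _ _ _ _ _ P1).
exact: bmeas_integrable_prod.
Qed.

Lemma bmeas_Ex2 f : bmeas f -> bmeas (fun y => Ex P1 (fun x => f (x, y))).
Proof.
move=> bf; split; last first.
  by case: (bf) => _ [M fM]; exists M => x; apply: norm_Ex_le => //; exact: bmeas_section2.
apply/measurable_EFinP.
rewrite (_ : _ \o _ = fubini_G P1 (EFin \o f)); last first.
  by apply/funext => x; rewrite /fubini_G/= EFin_Ex//; exact: bmeas_section2.
apply: (@measurable_fubini_G _ _ _ _ _ P1 P2).
exact: bmeas_integrable_prod.
Qed.

Lemma EFin_Ex_prod f : bmeas f ->
  (\int[P1 \x P2]_p (f p)%:E)%E = (Ex P1 (fun x => Ex P2 (fun y => f (x, y))))%:E.
Proof.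
move=> bf; rewrite -integral12_prod_meas1; last exact: bmeas_integrable_prod.
rewrite -EFin_Ex; last exact: bmeas_Ex1.
by apply: eq_integral => x _; rewrite /fubini_F EFin_Ex//; exact: bmeas_section1.
Qed.

Lemma Ex_swap f : bmeas f ->
  Ex P1 (fun x => Ex P2 (fun y => f (x, y))) = Ex P2 (fun y => Ex P1 (fun x => f (x, y))).
Proof.
move=> bf; apply/EFin_inj; rewrite -EFin_Ex_prod//.
rewrite -integral21_prod_meas1; last exact: bmeas_integrable_prod.
rewrite -EFin_Ex; last exact: bmeas_Ex2.
by apply: eq_integral => x _; rewrite /fubini_G EFin_Ex//; exact: bmeas_section2.
Qed.

End iterated_expectation.

(** * The law of the types *)

Section type_distribution.
Context {R : realType} (E : environment R) (hE : separable_structure E).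
Local Notation P := (type_law E).
Local Notation F := (type_cdf E).
Local Notation f := (density E).
Local Notation mu := (@lebesgue_measure R).
Local Notation types := (@types R).

Lemma measurable_types : measurable types.
Proof. exact: measurable_itv. Qed.
#[local] Hint Resolve measurable_types : core.

Lemma law_types : P types = 1%E.
Proof.
have := @probability_setT _ _ _ P => /= <-.
by rewrite !(law_density hE)//= setTI setIid.
Qed.

Lemma density_ge0 (x : R) : types x -> (0 <= (f x)%:E)%E.
Proof. by move=> tx; rewrite lee_fin ltW// density_gt0. Qed.

Lemma measurable_EFin_density (D : set (measurableTypeR R)) : measurable D -> D `<=` types ->
  measurable_fun D (fun x => (f x)%:E).
Proof.
move=> mD Dt; apply/measurable_EFinP.
by apply: measurable_funS (density_measurable hE).
Qed.

Lemma density_integrable : mu.-integrable types (fun x => (f x)%:E).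
Proof.
apply/integrableP; split; first exact: measurable_EFin_density.
under eq_integral => x /set_mem tx do rewrite gee0_abs ?density_ge0//.
have := law_density hE measurable_types; rewrite setIid => <-.
by rewrite law_types ltry.
Qed.

Lemma law_dominated : P `<< mu.
Proof.
apply/null_content_dominatesP => A mA A0; rewrite (law_density hE)//.
apply: null_set_integral; first exact: measurableI.
- by apply: measurable_EFin_density; [exact: measurableI|exact: subIsetr].
- by apply: subset_measure0 A0 => //; exact: measurableI.
Qed.

Lemma law_set1 (x : R) : P [set x] = 0%E.
Proof.
have /null_content_dominatesP := law_dominated; apply => //.
exact: lebesgue_measure_set1.
Qed.

Lemma EFin_type_cdf (x : R) : (F x)%:E = P `]-oo, x]%classic.
Proof. by rewrite /type_cdf fineK// fin_num_measure. Qed.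

Lemma type_cdf_ge0 (x : R) : 0 <= F x.
Proof. by rewrite fine_ge0. Qed.

Lemma type_cdf_le1 (x : R) : F x <= 1.
Proof. by rewrite -lee_fin EFin_type_cdf probability_le1. Qed.

Lemma type_cdf_nondecreasing : {homo F : x y / x <= y}.
Proof.
move=> x y xy; rewrite -lee_fin !EFin_type_cdf le_measure ?inE//.
by apply: subset_itvl; rewrite bnd_simp.
Qed.

Lemma law_gt (x : R) : P `]x, +oo[%classic = (1 - F x)%:E.
Proof.
rewrite EFinB EFin_type_cdf -setCitvl.
by have /= -> := @probability_setC _ _ _ P _ (measurable_itv `]-oo, x]).
Qed.

Lemma Ex_indic (A : set (measurableTypeR R)) : measurable A ->
  Ex P (\1_A) = fine (P A).
Proof. by move=> mA; rewrite /Ex /Rintegral integral_indic// setIT. Qed.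

Lemma Ex_gt (x : R) : Ex P (fun y => (x < y)%R%:R) = 1 - F x.
Proof.
rewrite -[RHS]/(fine (1 - F x)%:E) -law_gt -Ex_indic//; apply: eq_Ex => y.
rewrite indicE (_ : (y \in `]x, +oo[%classic) = (x < y)%R)//.
by apply/idP/idP; rewrite inE/= in_itv/= andbT.
Qed.

Lemma Ex_le (x : R) : Ex P (fun y => (y <= x)%R%:R) = F x.
Proof.
rewrite /type_cdf -Ex_indic//; apply: eq_Ex => y.
rewrite indicE (_ : (y \in `]-oo, x]%classic) = (y <= x)%R)//.
by apply/idP/idP; rewrite inE/= in_itv/=.
Qed.

Lemma type_cdf1 : F 1 = 1.
Proof.
apply/EFin_inj; rewrite EFin_type_cdf -law_types !(law_density hE)// setIid.
congr (integral _ _ _); apply/seteqP; split => x /=; rewrite /Defs.types/= ?in_itv/=.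
  by case.
by move=> /andP[-> ->].
Qed.

Lemma type_cdf_continuous : {within `[0, 1], continuous F}.
Proof.
have := parameterized_integral_continuous (@ler01 R) density_integrable.
apply: subspace_eq_continuous => x; rewrite inE/= in_itv/= => /andP[x0 x1].
rewrite /from_subspace /parameterized_integral /type_cdf (law_density hE)//; congr fine.
congr (integral _ _ _); apply/seteqP; split => y /=; rewrite /Defs.types/= ?in_itv/=.
  by move=> /andP[y0 yx]; rewrite yx y0 (le_trans yx x1).
by move=> [-> /andP[-> _]].
Qed.

(** If [F x = F y], the density integrates to 0 over []x, y]] and so vanishes almost everywhere
    there; being positive, it forces an interval of positive length to be a null set. *)
Lemma type_cdf_lt : {in `[0, 1] &, {homo F : x y / x < y}}.
Proof.
move=> x y; rewrite !in_itv/= => /andP[x0 x1] /andP[y0 y1] xy.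
rewrite lt_neqAle type_cdf_nondecreasing ?(ltW xy)// andbT; apply/eqP => FF.
have P0 : P `]x, y]%classic = 0%E.
  have : P `]-oo, y]%classic = (P `]-oo, x]%classic + P `]x, y]%classic)%E.
    rewrite -measureU//.
      by congr (P _); rewrite -itv_bndbnd_setU// bnd_simp; apply: ltW.
    rewrite -subset0 => z []/=; rewrite !in_itv/= => zx /andP[xz _].
    by have := lt_le_trans xz zx; rewrite ltxx.
  rewrite -!EFin_type_cdf FF => h.
  have : P `]x, y]%classic \is a fin_num by rewrite fin_num_measure.
  move=> Pf; move: h; rewrite -[X in (_ = _ + X)%E](fineK Pf) -EFinD => -[/eqP].
  rewrite -subr_eq0 opprD addrA subrr sub0r oppr_eq0 => /eqP e.
  by rewrite -(fineK Pf) e.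
have sub : `]x, y]%classic `<=` types.
  by move=> z/=; rewrite /Defs.types/= !in_itv/= => /andP[xz zy];
    rewrite (le_trans zy y1) (le_trans x0 (ltW xz)).
move: P0; rewrite (law_density hE)// setIidl// => I0.
have mf : measurable_fun (`]x, y]%classic : set (measurableTypeR R)) (fun x => (f x)%:E).
  exact: measurable_EFin_density.
have [+ _] := @ae_eq_integral_abs _ _ _ mu _ (measurable_itv `]x, y]) _ mf.
case.
  by rewrite -[RHS]I0; apply: eq_integral => z; rewrite inE => zxy;
    rewrite gee0_abs// density_ge0//; exact: sub.
move=> N [mN N0 hN].
have : (mu `]x, y]%classic <= mu N)%E.
  apply: le_measure; rewrite ?inE// => z zxy; apply: hN => /= /(_ zxy) /eqP.
  by rewrite eqe gt_eqF// density_gt0//; exact: sub.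
by rewrite N0 lebesgue_measure_itv/= lte_fin xy -EFinB lee_fin leNgt subr_gt0 xy.
Qed.

Lemma type_cdf_inj : {in types &, injective F}.
Proof.
move=> x y; rewrite !inE => tx ty e.
by have [/(type_cdf_lt tx ty)|/(type_cdf_lt ty tx)|//] := ltgtP x y;
  rewrite e ltxx.
Qed.

Lemma quantileK (x : R) : types x -> quantile E (F x) = x.
Proof. by move=> tx; rewrite /quantile pinvKV// ?inE//; exact: type_cdf_inj. Qed.

(** The Radon-Nikodym derivative of the law agrees almost everywhere on [types] with [density E], as
    both have the same integral over every measurable subset. *)
Lemma ge0_integral_density (phi : R -> \bar R) : (forall x, (0 <= phi x)%E) ->
  measurable_fun [set: measurableTypeR R] phi ->
  (\int[P]_(x in types) phi x = \int[mu]_(x in types) (phi x * (f x)%:E))%E.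
Proof.
move=> phi0 mphi; have mphit := @measurable_funTS _ _ _ _ types _ mphi.
rewrite -(Radon_Nikodym_SigmaFinite.change_of_variables law_dominated)//.
have mrn : measurable_fun types (Radon_Nikodym_SigmaFinite.f P mu).
  apply: measurable_funTS; apply: (measurable_int mu).
  exact: Radon_Nikodym_SigmaFinite.f_integrable law_dominated.
apply: ge0_ae_eq_integral => //.
- exact: emeasurable_funM.
- by apply: emeasurable_funM => //; exact: measurable_EFin_density.
- by move=> x _; rewrite mule_ge0// Radon_Nikodym_SigmaFinite.f_ge0//; exact: law_dominated.
- by move=> x tx; rewrite mule_ge0// density_ge0.
apply: ae_eqe_mul2l; apply: integral_ae_eq => //.
- apply: (integrableS measurableT) => //.
  exact: Radon_Nikodym_SigmaFinite.f_integrable law_dominated.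
- exact: measurable_EFin_density.
move=> A At mA; rewrite -Radon_Nikodym_SigmaFinite.f_integral//; last exact: law_dominated.
by have /= -> := law_density hE mA; rewrite setIidl.
Qed.

(* Composing with clamp extends a function constantly outside [0, 1], a null set:
   monotone functions of the type become measurable and bounded on the line. *)
Definition clamp (x : R) : R := Num.max 0 (Num.min x 1).

Lemma clamp_types x : types (clamp x).
Proof.
rewrite /Defs.types/= in_itv/= /clamp le_max lexx/= ge_max ler01/=.
by rewrite ge_min lexx orbT.
Qed.

Lemma clamp_id x : types x -> clamp x = x.
Proof.
rewrite /Defs.types/= in_itv/= => /andP[x0 x1].
by rewrite /clamp (min_l x1) (max_r x0).
Qed.

Lemma clamp_le : {homo clamp : x y / x <= y}.
Proof.
move=> x y xy; rewrite /clamp ge_max !le_max lexx/=.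
by apply/orP; right; rewrite le_min !ge_min xy lexx orbT.
Qed.

Lemma measurable_clamp : measurable_fun [set: measurableTypeR R] clamp.
Proof. exact: nondecreasing_measurable clamp_le. Qed.

Lemma clamp_ge0 x : 0 <= clamp x.
Proof. by have := clamp_types x; rewrite /Defs.types/= in_itv/= => /andP[]. Qed.

Lemma clamp_le1 x : clamp x <= 1.
Proof. by have := clamp_types x; rewrite /Defs.types/= in_itv/= => /andP[]. Qed.

Lemma types0 : types 0.
Proof. by rewrite /Defs.types/= in_itv/= lexx ler01. Qed.

Lemma types1 : types 1.
Proof. by rewrite /Defs.types/= in_itv/= lexx ler01. Qed.

Lemma bmeas_monotone (h : R -> R) M : {homo h : x y / x <= y} ->
  (forall x, `|h x| <= M) -> bmeas (h : measurableTypeR R -> R).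
Proof. by move=> hh hM; split; [exact: nondecreasing_measurable|exists M]. Qed.

Lemma bmeas_nondecreasing_clamp (h : R -> R) :
  (forall x y, types x -> types y -> x <= y -> h x <= h y) ->
  bmeas (fun x : measurableTypeR R => h (clamp x)).
Proof.
move=> hh; apply: (@bmeas_monotone _ (`|h 0| + `|h 1|)) => [x y xy|x].
  by apply: hh; [exact: clamp_types|exact: clamp_types|exact: clamp_le].
have h0 := hh _ _ types0 (clamp_types x) (clamp_ge0 x).
have h1 := hh _ _ (clamp_types x) types1 (clamp_le1 x).
rewrite ler_norml; have := ler_norm (h 1); have := ler_norm (- h 0).
by rewrite normrN; have := normr_ge0 (h 0); have := normr_ge0 (h 1); lra.
Qed.

Lemma bmeas_nonincreasing_clamp (h : R -> R) :
  (forall x y, types x -> types y -> x <= y -> h y <= h x) ->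
  bmeas (fun x : measurableTypeR R => h (clamp x)).
Proof.
move=> hh; have := @bmeas_nondecreasing_clamp (fun x => - h x).
move=> /(_ _)/bmeasN; under eq_fun do rewrite opprK.
by apply => x y tx ty xy; rewrite lerN2 hh.
Qed.

Lemma bmeas_clamp : bmeas (clamp : measurableTypeR R -> R).
Proof. exact: (@bmeas_nondecreasing_clamp id). Qed.

Lemma bmeas_type_cdf : bmeas (F : measurableTypeR R -> R).
Proof.
apply: (@bmeas_monotone _ 1); first exact: type_cdf_nondecreasing.
by move=> x; rewrite ger0_norm ?type_cdf_ge0// type_cdf_le1.
Qed.

Lemma virtual_type_le x y : types x -> types y -> x <= y ->
  virtual_type E x <= virtual_type E y.
Proof.
move=> tx ty; rewrite le_eqVlt => /predU1P[->//|xy].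
by rewrite ltW// (virtual_type_increasing hE).
Qed.

Lemma virtual_type_ge x : types x -> x <= virtual_type E x.
Proof. by move=> tx; rewrite lerDl divr_ge0 ?type_cdf_ge0// ltW// density_gt0. Qed.

Lemma bmeas_virtual_type :
  bmeas (fun x : measurableTypeR R => virtual_type E (clamp x)).
Proof. exact: bmeas_nondecreasing_clamp virtual_type_le. Qed.

Definition tail_integral (Z : R -> R) (x : R) : R := (\int[mu]_(u in `[x, 1]) Z u)%R.

Lemma bmeas_integrable_itv (Z : R -> R) (x y : R) : bmeas (Z : measurableTypeR R -> R) ->
  mu.-integrable `[x, y] (EFin \o Z).
Proof.
move=> [mZ [M ZM]]; apply: measurable_bounded_integrable => //.
- have /= -> := lebesgue_measure_itv `[x, y]; by case: ifP => _; rewrite ?ltry// -EFinB ltry.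
- exact: measurable_funTS.
- by exists M; split; [exact: num_real|move=> N MN u _; exact: le_trans (ZM u) (ltW MN)].
Qed.

Lemma EFin_tail_integral (Z : R -> R) (x : R) : bmeas (Z : measurableTypeR R -> R) ->
  (tail_integral Z x)%:E = (\int[mu]_(u in `[x, 1%R]) (Z u)%:E)%E.
Proof.
move=> bZ; rewrite /tail_integral /Rintegral fineK//.
by apply: integrable_fin_num => //; exact: bmeas_integrable_itv.
Qed.

Lemma tail_integral_le (Z : R -> R) x y : bmeas (Z : measurableTypeR R -> R) ->
  (forall x, 0 <= Z x) -> x <= y -> tail_integral Z y <= tail_integral Z x.
Proof.
move=> bZ Z0 xy; rewrite -lee_fin !EFin_tail_integral//.
apply: ge0_subset_integral => //.
- by apply/measurable_EFinP/measurable_funTS; case: bZ.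
- by move=> u _; rewrite lee_fin.
- by apply: subset_itvr; rewrite bnd_simp.
Qed.

Lemma bmeas_tail_integral (Z : R -> R) : bmeas (Z : measurableTypeR R -> R) ->
  (forall x, 0 <= Z x) ->
  bmeas (fun x : measurableTypeR R => tail_integral Z (clamp x)).
Proof.
move=> bZ Z0; apply: bmeas_nonincreasing_clamp => x y _ _.
exact: tail_integral_le.
Qed.

(* Fubini: both sides are the integral over u of F(u) Z(u), the density
   cancelling against that of the inverse hazard rate F / f. *)
Lemma Ex_information_rent (Z : R -> R) : bmeas (Z : measurableTypeR R -> R) ->
  (forall x, 0 <= Z x) ->
  Ex P (fun x => (virtual_type E (clamp x) - clamp x) * Z x) =
  Ex P (fun x => tail_integral Z (clamp x)).
Proof.
move=> bZ Z0; apply/EFin_inj.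
have bh : bmeas (fun x : measurableTypeR R => (virtual_type E (clamp x) - clamp x) * Z x).
  by apply: bmeasM => //; apply: bmeasB; [exact: bmeas_virtual_type|exact: bmeas_clamp].
rewrite -(EFin_Ex_event measurable_types law_types)// ge0_integral_density; last 2 first.
- move=> x; rewrite lee_fin mulr_ge0// subr_ge0 virtual_type_ge//.
  exact: clamp_types.
- by apply/measurable_EFinP; case: bh.
(* Integrated over [x] this kernel gives [F u * Z u] for [u] in [0, 1] and 0 elsewhere; integrated
   over [u] it gives the tail integral at [clamp x]. *)
pose k (p : measurableTypeR R * measurableTypeR R) : R :=
  (clamp p.2 <= p.1)%R%:R * (p.1 <= 1)%R%:R * Z p.1.
have mk : measurable_fun setT k.
  suff : bmeas k by case.
  apply: bmeasM; last by apply: (bmeas_comp measurable_fst).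
  apply: bmeasM; apply: bmeas_bool; apply: measurable_fun_ler => //.
  exact: (measurableT_comp measurable_clamp measurable_snd).
have -> : (\int[mu]_(x in types) (((virtual_type E (clamp x) - clamp x) * Z x)%:E * (f x)%:E)
    = \int[mu]_u \int[P]_x (k (u, x))%:E)%E.
  rewrite integral_mkcond; apply: eq_integral => u _; rewrite patchE.
  case: ifPn => [/set_mem tu|].
    rewrite clamp_id// /k/=; have /andP[u0 u1] : 0 <= u <= 1 by move: tu; rewrite /Defs.types/= in_itv.
    under [RHS]eq_integral do rewrite u1 mulr1.
    rewrite EFin_Ex.
      rewrite ExZr.
        rewrite (eq_Ex_event measurable_types law_types (h := fun x : measurableTypeR R => ((x : R) <= u)%R%:R)).
        - rewrite Ex_le -EFinM; congr EFin; rewrite /virtual_type.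
          by have := density_gt0 hE tu => f0; field; rewrite gt_eqF.
        - by apply: bmeas_bool; apply: measurable_fun_ler => //; exact: measurable_clamp.
        - by apply: bmeas_bool; apply: measurable_fun_ler.
        - by move=> x tx; rewrite clamp_id.
      by apply: bmeas_bool; apply: measurable_fun_ler => //; exact: measurable_clamp.
    apply: bmeasM; last exact: bmeas_cst.
    by apply: bmeas_bool; apply: measurable_fun_ler => //; exact: measurable_clamp.
  move=> /negP tu; rewrite integral0_eq// => x _; rewrite /k/=.
  case: (leP (clamp x) u) => [xu|]; last by rewrite !mul0r.
  case: (leP u 1) => [u1|]; last by rewrite mulr0 mul0r.
  exfalso; apply: tu; rewrite inE/= /Defs.types/= in_itv/= u1 andbT.
  exact: le_trans (clamp_ge0 x) xu.
rewrite (@fubini_tonelli _ _ _ _ _ mu P (fun p => (k p)%:E)); last 2 first.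
- exact/measurable_EFinP.
- by move=> p; rewrite lee_fin /k !mulr_ge0.
rewrite -EFin_Ex; last exact: bmeas_tail_integral.
apply: eq_integral => x _; rewrite EFin_tail_integral// [RHS]integral_mkcond.
apply: eq_integral => u _; rewrite patchE /k/= -natrM mulnb.
rewrite (_ : (u \in _) = (clamp x <= u <= 1)%R); last first.
  by apply/idP/idP; rewrite inE/= in_itv/=.
by case: ifP => _; rewrite ?mul1r ?mul0r.
Qed.

End type_distribution.

(** * Monotone winning regions *)

Section winning_regions.
Context {R : realType} (E : environment R) (hE : separable_structure E).
Context (hconv : sufficiently_convex E).
Local Notation T := (measurableTypeR R).
Local Notation P := (type_law E).
Local Notation F := (type_cdf E).
Local Notation G x := (1 - type_cdf E x).
Local Notation g := (inv_cost E).
Local Notation Q := (inv_marginal_cost E).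
Local Notation J x := (virtual_type E (clamp x)).
Local Notation types := (@types R).
Local Notation a := (alpha E).

Lemma typesE (x : R) : types x = (0 <= x <= 1) :> Prop.
Proof. by rewrite /Defs.types/= in_itv. Qed.

Lemma survival01 (x : R) : 0 <= G x <= 1.
Proof. by rewrite subr_ge0 type_cdf_le1 lerBlDr lerDl type_cdf_ge0. Qed.

Definition sym_quality (x : R) : R := Q (G x).
Local Notation q := sym_quality.

Lemma sym_quality_le (x y : R) : x <= y -> q y <= q x.
Proof.
move=> xy; have /andP[h1 h2] := survival01 x; have /andP[h3 h4] := survival01 y.
by apply: inv_marginal_cost_le => //; rewrite lerB// type_cdf_nondecreasing.
Qed.

Lemma sym_quality_ge0 (x : R) : 0 <= q x.
Proof. exact: inv_marginal_cost_ge0 (survival01 x). Qed.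

Lemma bmeas_sym_quality : bmeas (q : T -> R).
Proof.
split; first exact: nonincreasing_measurable sym_quality_le.
exists (Q 1) => x; rewrite ger0_norm ?sym_quality_ge0//.
by have /andP[h1 h2] := survival01 x; apply: inv_marginal_cost_le.
Qed.

Lemma bmeas_gt (x : R) : bmeas (fun y : T => (x < y)%R%:R : R).
Proof. by apply: bmeas_bool; apply: measurable_fun_ltr. Qed.

Lemma eq_Ex_types (f h : T -> R) : bmeas f -> bmeas h ->
  (forall x, types x -> f x = h x) -> Ex P f = Ex P h.
Proof. exact: eq_Ex_event (measurable_types) (law_types hE). Qed.

Lemma le_Ex_types (f h : T -> R) : bmeas f -> bmeas h ->
  (forall x, types x -> f x <= h x) -> Ex P f <= Ex P h.
Proof. exact: le_Ex_event (measurable_types) (law_types hE). Qed.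

Lemma law_types_but (t : R) : P (types `\` [set t]) = 1%E.
Proof.
have Pt : P [set t] = 0%E by exact: law_set1.
apply/eqP; rewrite eq_le probability_le1/=; last exact: measurableD measurable_types _.
have : (P types <= P (types `\` [set t]) + P [set t])%E.
  apply: le_trans (measureU2 _ _ _) => //; last exact: measurableD measurable_types _.
  apply: le_measure; rewrite ?inE//; first exact: measurable_types.
    by apply: measurableU => //; exact: measurableD measurable_types _.
  by move=> x tx; have [->|/eqP] := eqVneq x t; [right|left].
by rewrite (law_types hE) Pt adde0.
Qed.

(** The law has no atoms. This is how ties, and the unknown behavior at a threshold itself, are
    disregarded. *)
Lemma le_Ex_types_but (t : R) (f h : T -> R) : bmeas f -> bmeas h ->
  (forall x, types x -> x != t -> f x <= h x) -> Ex P f <= Ex P h.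
Proof.
move=> bf bh fh; apply: le_Ex_event (law_types_but t) bf bh _.
  exact: measurableD measurable_types _.
by move=> x [tx /= /eqP xt]; exact: fh.
Qed.

Lemma eq_Ex_types_but (t : R) (f h : T -> R) : bmeas f -> bmeas h ->
  (forall x, types x -> x != t -> f x = h x) -> Ex P f = Ex P h.
Proof.
by move=> bf bh fh; apply/eqP; rewrite eq_le; apply/andP; split;
  apply: (@le_Ex_types_but t) => // x tx xt; rewrite fh.
Qed.

(** Formally the derivative of the conjugate is [Q]. Without differentiating, from [x] to [y] both
    sides drop by an amount between [q y * (F y - F x)] and [q x * (F y - F x)]: the left side by
    the subgradient inequality, the right side because [q] is nonincreasing. [increments_bound_eq]
    then makes the difference constant, and it vanishes at 1. *)
Lemma conjugate_cost_tail (t : R) : types t ->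
  conjugate_cost E (G t) = Ex P (fun y => (t < y)%R%:R * q y).
Proof.
move=> tt; have /andP[t0 t1] : 0 <= t <= 1 by rewrite -typesE.
pose I (x : R) := Ex P (fun y => (x < y)%R%:R * q y).
have bI x : bmeas (fun y : T => (x < y)%R%:R * q y).
  by apply: bmeasM; [exact: bmeas_gt|exact: bmeas_sym_quality].
have I1 : I 1 = 0.
  rewrite -(Ex_cst P 0); apply: eq_Ex_types => //; first exact: bmeas_cst.
  by move=> x; rewrite typesE => /andP[_ x1]; rewrite ltNge x1 mul0r.
suff : conjugate_cost E (G t) - I t = conjugate_cost E (G 1) - I 1.
  rewrite type_cdf1// subrr I1 /conjugate_cost inv_marginal_cost0// cost0// mulr0 !subrr.
  by move/eqP; rewrite subr_eq0 => /eqP.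
apply: (@increments_bound_eq R (fun x => conjugate_cost E (G x) - I x) q F) => //.
- apply: continuous_subspaceW (type_cdf_continuous hE).
  by move=> x /=; rewrite !in_itv/= => /andP[tx ->]; rewrite (le_trans t0 tx).
- move=> x y; rewrite !in_itv/= => /andP[x0 x1] /andP[y0 y1].
  by apply: (type_cdf_lt hE); rewrite in_itv/= ?x1 ?y1 (le_trans t0).
- move=> x y tx xy y1.
  have hx := survival01 x; have hy := survival01 y.
  have c1 := conjugate_cost_tangent hE hx hy.
  have c2 := conjugate_cost_tangent hE hy hx.
  have IE : I x - I y = Ex P (fun z => ((x < z)%R%:R - (y < z)%R%:R) * q z).
    by rewrite -ExB//; apply: eq_Ex => z; rewrite mulrBl.
  have bd : bmeas (fun z : T => (x < z)%R%:R - (y < z)%R%:R : R).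
    by apply: bmeasB; exact: bmeas_gt.
  have dE : Ex P (fun z : T => (x < z)%R%:R - (y < z)%R%:R) = F y - F x.
    by rewrite ExB ?Ex_gt//; [ring|exact: bmeas_gt|exact: bmeas_gt].
  have I1' : I x - I y <= q x * (F y - F x).
    rewrite IE -dE -ExZ//; apply: le_Ex; first by apply: bmeasM => //; exact: bmeas_sym_quality.
      exact: bmeasZ.
    move=> z; case: (ltP x z) => [xz|zx].
      case: ltP => yz; rewrite /= ?subrr ?mul0r ?mulr0// subr0 mul1r mulr1.
      by apply: sym_quality_le; exact: ltW.
    by rewrite ltNge (le_trans zx xy)/= subrr mul0r mulr0.
  have I2' : q y * (F y - F x) <= I x - I y.
    rewrite IE -dE -ExZ//; apply: le_Ex; [exact: bmeasZ| |].
      by apply: bmeasM => //; exact: bmeas_sym_quality.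
    move=> z; case: (ltP x z) => [xz|zx].
      case: ltP => yz; rewrite /= ?subrr ?mul0r ?mulr0// subr0 mul1r mulr1.
      exact: sym_quality_le.
    by rewrite ltNge (le_trans zx xy)/= subrr mul0r mulr0.
  by move: c1 c2; rewrite -/(q x) -/(q y) ler_norml => c1 c2; apply/andP; split; nra.
Qed.

Lemma upper_set_threshold (U : R -> bool) :
  (forall x y, types x -> types y -> U x -> x <= y -> U y) ->
  exists2 t, types t & forall y, types y -> y != t -> U y = (t < y).
Proof.
(* The point 1 is adjoined so that the infimum exists even if [U] holds at no type. *)
move=> hU; pose A := [set x | x = 1 \/ types x /\ U x].
have A1 : A 1 by left.
have Alb : lbound A 0 by move=> x [->//|[]]; rewrite typesE => /andP[].
have hA : has_inf A by split; [exists 1|exists 0].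
have i0 : 0 <= inf A by apply: lb_le_inf => //; exists 1.
have i1 : inf A <= 1 by apply: ge_inf => //; exists 0.
exists (inf A); first by rewrite typesE i0.
move=> y ty yA; apply/idP/idP => [Uy|iy].
  rewrite lt_neqAle eq_sym yA/=; apply: ge_inf; first by exists 0.
  by right.
have := inf_adherent (eps := y - inf A); rewrite subr_gt0 => /(_ A iy hA)[x [->|[tx Ux]]].
  by rewrite addrC subrK; move: ty; rewrite typesE => /andP[_ /le_lt_trans h] /h; rewrite ltxx.
by rewrite addrC subrK => /ltW; exact: hU.
Qed.

(** Up to one type an upper set is the set of types above some [t], so its probability is [G t]. The
    lemma turns the value of the best quality into an integral over the opponents beaten. *)
Lemma conjugate_cost_upper_set (U : R -> bool) :
  bmeas (fun y : T => (U y)%:R : R) ->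
  (forall x y, types x -> types y -> U x -> x <= y -> U y) ->
  0 <= Ex P (fun y => (U y)%:R) <= 1 /\
  conjugate_cost E (Ex P (fun y => (U y)%:R)) = Ex P (fun y => (U y)%:R * q y).
Proof.
move=> bU /upper_set_threshold[t tt Ut].
have -> : Ex P (fun y => (U y)%:R) = G t.
  rewrite -Ex_gt//; apply: (@eq_Ex_types_but t) => //; first exact: bmeas_gt.
  by move=> x tx xt; rewrite Ut.
split; first exact: survival01.
rewrite conjugate_cost_tail//; apply: (@eq_Ex_types_but t).
- by apply: bmeasM; [exact: bmeas_gt|exact: bmeas_sym_quality].
- by apply: bmeasM => //; exact: bmeas_sym_quality.
by move=> x tx xt; rewrite Ut.
Qed.

(* The function alpha xi(g'(.)) - id of the sufficient convexity condition is
   alpha - ranking at the quality Q(1 - F(theta)). *)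
Definition ranking (x : R) : R := q x + a * J x.
Local Notation k := ranking.

Lemma bmeas_ranking : bmeas (k : T -> R).
Proof.
apply: bmeasD; first exact: bmeas_sym_quality.
by apply: bmeasZ; exact: bmeas_virtual_type.
Qed.

(** The convexity condition lives on qualities. Since [q] is strictly decreasing on types, [q y] is
    a proper convex combination of [q x] and [q z], and the condition carries over with the sign
    reversed. *)
Lemma ranking_quasiconcave (x y z : R) : types x -> types z -> x < y -> y < z ->
  Num.min (k x) (k z) < k y.
Proof.
move=> tx tz xy yz.
have ty : types y by move: tx tz; rewrite !typesE => /andP[? ?] /andP[? ?]; lra.
have kE u : types u -> a * xi E (marginal_cost E (q u)) - q u = a - k u.
  move=> tu; rewrite inv_marginal_costV ?survival01// /xi subKr quantileK//.
  by rewrite /k clamp_id//; ring.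
have D u : [set q : R | 0 <= q /\ marginal_cost E q \in `[0, 1]] (q u).
  split; first exact: sym_quality_ge0.
  by rewrite inv_marginal_costV ?survival01// in_itv/= survival01.
have qlt u v : types u -> types v -> u < v -> q v < q u.
  move=> tu tv uv; have /andP[_ h1] := survival01 u; have /andP[h2 _] := survival01 v.
  by apply: inv_marginal_cost_lt => //; rewrite ltrD2l ltrN2 type_cdf_lt.
have xy' := qlt _ _ tx ty xy; have yz' := qlt _ _ ty tz yz.
have xz' := lt_trans yz' xy'.
have d0 : q x - q z != 0 by rewrite subr_eq0 gt_eqF.
pose t := (q y - q z) / (q x - q z).
have t01 : 0 < t < 1.
  rewrite /t divr_gt0 ?subr_gt0//= ltr_pdivrMr ?subr_gt0// mul1r.
  by rewrite ltrD2r.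
have := hconv (D x) (D z) (negbT (gt_eqF xz')) t01.
have -> : t * q x + (1 - t) * q z = q y by rewrite /t; field.
by rewrite !kE// lt_max gt_min; lra.
Qed.

(* Gain from pooling the pairs (x, y) for all y > x, that is, from no longer
   giving the contract to x in both orders of the types. *)
Definition pooling_gain (x : R) : R := Ex P (fun y => (x < y)%R%:R * (k x - k y)).
Local Notation M := pooling_gain.

Lemma bmeas_slice (x : R) : bmeas (fun y : T => (x < y)%R%:R * (k x - k y)).
Proof.
apply: bmeasM; first exact: bmeas_gt.
by apply: bmeasB; [exact: bmeas_cst|exact: bmeas_ranking].
Qed.

(** If [k y <= k x], quasiconcavity keeps [k] below [k y] after [y], so the integrand of [M y] is
    nonnegative. If [k x < k y], the integrand of [M y] dominates that of [M x]: after [y]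
    obviously, and between [x] and [y] because [k] exceeds [k x] there. *)
Lemma pooling_gain_crossing (x y : R) : types x -> types y -> x < y ->
  0 <= M x -> 0 <= M y.
Proof.
move=> tx ty xy Mx; have [kxy|kyx] := leP (k y) (k x).
  rewrite -(Ex_cst P 0); apply: le_Ex_types; [exact: bmeas_cst|exact: bmeas_slice|].
  move=> z tz; case: ltP => yz; rewrite ?mul0r// mul1r subr_ge0.
  have := ranking_quasiconcave tx tz xy yz; rewrite gt_min ltNge kxy/=.
  exact: ltW.
apply: (le_trans Mx); apply: le_Ex_types; [exact: bmeas_slice|exact: bmeas_slice|].
move=> z tz; case: (ltP y z) => yz.
  by rewrite (lt_trans xy yz) !mul1r lerB// ltW.
rewrite mul0r; case: ltP => xz; rewrite ?mul0r// mul1r subr_le0.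
move: yz; rewrite le_eqVlt => /predU1P[->|zy]; first exact: ltW.
have := ranking_quasiconcave tx ty xz zy; rewrite gt_min => /orP[/ltW//|].
by move=> /(lt_trans kyx)/ltW.
Qed.

Lemma optimal_threshold : exists2 t, 0 <= t <= 1 &
  (forall x, types x -> x < t -> M x <= 0) /\
  (forall x, types x -> t < x -> 0 <= M x).
Proof.
(* By the single crossing, the types with a negative gain come first and their supremum separates
   the signs; 0 is adjoined in case there are none. *)
pose A := [set x | x = 0 \/ types x /\ M x < 0].
have A0 : A 0 by left.
have Aub : ubound A 1 by move=> x [->//|[]]; rewrite typesE => /andP[].
have hA : has_sup A by split; [exists 0|exists 1].
exists (sup A).
  rewrite ub_le_sup//; last by exists 1.
  by rewrite ge_sup//; exists 0.
split=> x tx xt.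
  have := sup_adherent (eps := sup A - x); rewrite subr_gt0 => /(_ A xt hA)[y].
  rewrite subKr => -[->|[ty My]] xy.
    by move: tx; rewrite typesE => /andP[x0 _]; move: (lt_le_trans xy x0); rewrite ltxx.
  rewrite leNgt; apply/negP => /ltW /(pooling_gain_crossing tx ty xy).
  by rewrite leNgt My.
rewrite leNgt; apply/negP => Mx.
have : x <= sup A by apply: ub_le_sup; [exists 1|right].
by rewrite leNgt xt.
Qed.

(** * The value of a winning region and its maximization *)

Definition region_value (r : R -> R -> bool) : R :=
  Ex P (fun x => Ex P (fun y =>
    (q y - a * J x) * (r x y)%:R + (q x - a * J y) * (1 - (r x y)%:R))).

Definition bmeas_region (r : R -> R -> bool) :=
  bmeas (fun p : T * T => (r p.1 p.2)%:R : R).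

Definition monotone_region (r : R -> R -> bool) :=
  forall x y x' y', types x -> types y -> types x' -> types y' ->
    x' <= x -> y <= y' -> r x y -> r x' y'.

Lemma bmeas_fst (h : T -> R) : bmeas h -> bmeas (fun p : T * T => h p.1).
Proof. by apply: bmeas_comp; exact: measurable_fst. Qed.

Lemma bmeas_snd (h : T -> R) : bmeas h -> bmeas (fun p : T * T => h p.2).
Proof. by apply: bmeas_comp; exact: measurable_snd. Qed.

Lemma bmeas_region_swap r : bmeas_region r -> bmeas (fun p : T * T => (r p.2 p.1)%:R : R).
Proof.
move=> br; apply: (bmeas_comp (k := fun p : T * T => (p.2, p.1)) _ br).
exact: measurable_fun_pair measurable_snd measurable_fst.
Qed.

Lemma bmeas_lt_pair : bmeas (fun p : T * T => ((p.1 : R) < p.2)%R%:R : R).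
Proof.
by apply: bmeas_bool; apply: measurable_fun_ltr;
  [exact: measurable_fst|exact: measurable_snd].
Qed.

(** For a monotone region the difference of indicators is 1 when the lower type [x] wins in both
    orders of the types and 0 when the same firm wins in both; -1 cannot occur. *)
Definition slice (r : R -> R -> bool) (x : R) : R :=
  Ex P (fun y => (x < y)%R%:R * (k y - k x) * ((r x y)%:R - (r y x)%:R)).

Lemma bmeas_slice2 r : bmeas_region r ->
  bmeas (fun p : T * T => (p.1 < p.2)%R%:R * (k p.2 - k p.1) * ((r p.1 p.2)%:R - (r p.2 p.1)%:R)).
Proof.
move=> br; apply: bmeasM; last by apply: bmeasB => //; exact: bmeas_region_swap.
apply: bmeasM; first exact: bmeas_lt_pair.
by apply: bmeasB; [apply: (@bmeas_snd k)|apply: (@bmeas_fst k)]; exact: bmeas_ranking.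
Qed.

(* Exchanging the two types leaves only the pairs x < y, weighted by whether
   the lower type wins irrespective of the firm having it. *)
Lemma region_valueE r : bmeas_region r ->
  region_value r = Ex P (fun x => Ex P (fun y => q x - a * J y)) + Ex P (slice r).
Proof.
move=> br.
have bA : bmeas (fun p : T * T => q p.1 - a * J p.2).
  apply: bmeasB; first exact: (bmeas_fst bmeas_sym_quality).
  by apply: bmeasZ; apply: (@bmeas_snd (fun x => J x)); exact: bmeas_virtual_type.
have bk : bmeas (fun p : T * T => (k p.2 - k p.1) : R).
  by apply: bmeasB; [apply: (@bmeas_snd k)|apply: (@bmeas_fst k)]; exact: bmeas_ranking.
pose s (p : T * T) := (p.1 < p.2)%R%:R * (k p.2 - k p.1) * (r p.1 p.2)%:R.
pose s' (p : T * T) := (p.2 < p.1)%R%:R * (k p.2 - k p.1) * (r p.1 p.2)%:R.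
have bs : bmeas s by do 2 apply: bmeasM => //; exact: bmeas_lt_pair.
have bs' : bmeas s'.
  do 2 apply: bmeasM => //; apply: bmeas_bool; apply: measurable_fun_ltr.
    exact: measurable_snd.
  exact: measurable_fst.
have -> : region_value r = Ex P (fun x => Ex P (fun y =>
    (q (x, y).1 - a * J (x, y).2) + (s (x, y) + s' (x, y)))).
  apply: eq_Ex => x; apply: eq_Ex => y; rewrite /s /s'/= /k.
  by case: (ltgtP x y) => [_|_|->]; rewrite /=; ring.
transitivity (Ex P (fun x => Ex P (fun y => q x - a * J y) +
    (Ex P (fun y => s (x, y)) + Ex P (fun y => s' (x, y))))).
  apply: eq_Ex => x; have bx := bmeas_section1 x bA.
  have sx := bmeas_section1 x bs; have sx' := bmeas_section1 x bs'.
  by rewrite ExD//; [rewrite [X in _ + X = _]ExD|exact: bmeasD].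
have b1 := bmeas_Ex1 P P bs; have b1' := bmeas_Ex1 P P bs'.
have bA1 := bmeas_Ex1 P P bA.
rewrite ExD//; last exact: bmeasD.
have b2' := bmeas_Ex2 P P bs'.
congr (_ + _); rewrite ExD// (Ex_swap P P bs') -ExD//.
apply: eq_Ex => x; rewrite -ExD; [|exact: bmeas_section1|exact: bmeas_section2].
by apply: eq_Ex => y; rewrite /s /s'/=; ring.
Qed.

(** Favored types above [t] are treated as [t], so a rival of type at least [t] never wins. At
    [t = 1] the lower type wins, ties going to the favored firm. *)
Definition threshold_region (t x y : R) : bool := Num.min x t <= y.

Lemma bmeas_threshold_region t : bmeas_region (threshold_region t).
Proof.
apply: bmeas_bool; apply: measurable_fun_ler; last exact: measurable_snd.
by apply: measurable_minr => //; exact: measurable_fst.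
Qed.

(** The opponents [y > x] that lose to [x] in both orders form an upper set [B], while [k y - k x]
    passes at most once from positive to negative. Hence an upper set yields at most the better of
    taking nothing, worth 0, and taking everything, worth [- M x]; the sign of [M x] tells which. *)
Lemma slice_le r t x : bmeas_region r -> monotone_region r ->
  (forall x, types x -> x < t -> M x <= 0) ->
  (forall x, types x -> t < x -> 0 <= M x) ->
  types x -> x != t -> slice r x <= slice (threshold_region t) x.
Proof.
move=> br mr Mlo Mhi tx xt.
have bsl r' : bmeas_region r' -> bmeas (fun y : T =>
    (x < y)%R%:R * (k y - k x) * ((r' x y)%:R - (r' y x)%:R)).
  by move=> br'; apply: (bmeas_section1 x (bmeas_slice2 br')).
pose B y := r x y && ~~ r y x.
have BE y : types y -> x < y -> (r x y)%:R - (r y x)%:R = (B y)%:R :> R.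
  move=> ty xy; rewrite /B; case: (boolP (r y x)) => [ryx|_].
    by rewrite (mr y x x y ty tx tx ty (ltW xy) (ltW xy) ryx) subrr.
  by rewrite subr0 andbT.
have Bup y z : types y -> types z -> x < y -> y <= z -> B y -> B z.
  move=> ty tz xy yz /andP[rxy nryx]; apply/andP; split.
    exact: mr rxy.
  by apply: contra nryx; exact: mr.
have sE : slice (threshold_region t) x =
    Ex P (fun y => (x < y)%R%:R * (k y - k x) * (x < t)%R%:R).
  apply: eq_Ex => y; case: (ltP x y) => xy; last by rewrite !mul0r.
  rewrite /threshold_region; congr (_ * _).
  rewrite !ge_min (ltW xy) [y <= x]leNgt xy/= -[t <= x]negbK -ltNge.
  by case: (x < t); rewrite /= ?subr0 ?subrr.
have bR (b : bool) : bmeas (fun y : T => (x < y)%R%:R * (k y - k x) * b%:R).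
  apply: bmeasM; last exact: bmeas_cst.
  by apply: bmeasM; [exact: bmeas_gt|apply: bmeasB; [exact: bmeas_ranking|exact: bmeas_cst]].
have ME : Ex P (fun y => (x < y)%R%:R * (k y - k x) * true%:R) = - M x.
  rewrite /pooling_gain -[RHS]mulN1r -ExZ; last exact: bmeas_slice.
  by apply: eq_Ex => y; rewrite /=; ring.
rewrite sE; case: (ltgtP x t) xt => // [xlt|tlx] _ /=.
(* If an excluded [y0] already has negative weight, all of [B] lies beyond it and has negative
   weight too; otherwise every excluded weight is nonnegative and including it does no harm. *)
- have [[y0 [ty0 xy0 nB ky0]]|none] := pselect (exists y0, [/\ types y0, x < y0, ~~ B y0 & k y0 < k x]).
    rewrite ME; apply: (@le_trans _ _ 0); last by rewrite oppr_ge0 Mlo.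
    rewrite -(Ex_cst P 0); apply: le_Ex_types; [exact: bsl|exact: bmeas_cst|].
    move=> y ty; case: (ltP x y) => xy; rewrite ?mul0r// mul1r BE//.
    case: (boolP (B y)) => By; rewrite /= ?mulr0// mulr1 subr_le0.
    have y0y : y0 < y.
      by rewrite ltNge; apply: contra nB => yy0; exact: Bup By.
    have := ranking_quasiconcave tx ty xy0 y0y; rewrite gt_min => /orP[h|h].
      by move: (lt_trans h ky0); rewrite ltxx.
    exact: ltW (lt_trans h ky0).
  apply: le_Ex_types; [exact: bsl|exact: (bR true)|].
  move=> y ty; case: (ltP x y) => xy; rewrite ?mul0r// mul1r BE// mulr1.
  case: (boolP (B y)) => By; rewrite /= ?mulr1// mulr0 subr_ge0 leNgt.
  by apply/negP => ky; apply: none; exists y.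
- rewrite (_ : (fun y : T => _ * 0) = fun=> 0); last by apply/funext => y; rewrite mulr0.
  rewrite Ex_cst.
  (* If a member [y0] of [B] has positive weight, the excluded opponents lie before it and have
     positive weight, so including them all reaches [- M x <= 0]; otherwise no weight in [B] is
     positive. *)
  have [[y0 [ty0 xy0 By0 ky0]]|none] := pselect (exists y0, [/\ types y0, x < y0, B y0 & k x < k y0]).
    apply: (@le_trans _ _ (- M x)); last by rewrite oppr_le0 Mhi.
    rewrite -ME; apply: le_Ex_types; [exact: bsl|exact: (bR true)|].
    move=> y ty; case: (ltP x y) => xy; rewrite ?mul0r// mul1r BE// mulr1.
    case: (boolP (B y)) => By; rewrite /= ?mulr1// mulr0 subr_ge0.
    have yy0 : y < y0.
      by rewrite ltNge; apply: contra By => y0y; exact: Bup By0.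
    have := ranking_quasiconcave tx ty0 xy yy0; rewrite gt_min => /orP[/ltW//|h].
    exact: ltW (lt_trans ky0 h).
  rewrite -(Ex_cst P 0); apply: le_Ex_types; [exact: bsl|exact: bmeas_cst|].
  move=> y ty; case: (ltP x y) => xy; rewrite ?mul0r// mul1r BE//.
  case: (boolP (B y)) => By; rewrite /= ?mulr0// mulr1 subr_le0 leNgt.
  by apply/negP => ky; apply: none; exists y.
Qed.

Lemma threshold_region_optimal : exists2 t, 0 <= t <= 1 &
  forall r, bmeas_region r -> monotone_region r ->
    region_value r <= region_value (threshold_region t).
Proof.
have [t t01 [Mlo Mhi]] := optimal_threshold; exists t => // r br mr.
have bt := bmeas_threshold_region t.
rewrite !region_valueE// lerD2l; apply: (@le_Ex_types_but t).
- exact: (bmeas_Ex1 P P (bmeas_slice2 br)).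
- exact: (bmeas_Ex1 P P (bmeas_slice2 bt)).
by move=> x tx xt; exact: slice_le.
Qed.

End winning_regions.

(** * The relaxed problem *)

Section relaxed_problem.
Context {R : realType} (E : environment R) (hE : separable_structure E).
Local Notation T := (measurableTypeR R).
Local Notation P := (type_law E).
Local Notation G x := (1 - type_cdf E x).
Local Notation g := (inv_cost E).
Local Notation Q := (inv_marginal_cost E).
Local Notation J x := (virtual_type E (clamp x)).
Local Notation types := (@types R).
Local Notation profiles := (@type_profiles R).
Local Notation a := (alpha E).

Lemma sum_firms (V : nmodType) (h : 'I_2 -> V) : (\sum_(i < 2) h i = h favored + h rival)%R.
Proof.
rewrite !big_ord_recl big_ord0 addr0; congr (_ + h _); exact: val_inj.
Qed.

Lemma measurable_profiles : measurable profiles.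
Proof. by apply: measurableX; exact: measurable_types. Qed.

Lemma law_profiles : (P \x P)%E profiles = 1%E.
Proof.
have mt : measurable types by exact: measurable_types.
have /= -> := @product_measure1E _ _ _ _ _ P P types types mt mt.
by have /= -> := law_types hE; rewrite mule1.
Qed.

Lemma law_profilesC : (P \x P)%E (~` profiles) = 0%E.
Proof.
have muT : (P \x P)%E setT = 1%E.
  have /= := @product_measure1E _ _ _ _ _ P P setT setT measurableT measurableT.
  rewrite setXTT => ->.
  by have /= -> := @probability_setT _ _ _ P; rewrite mule1.
rewrite -setTD measureD//= ?muT ?ltry//; last exact: measurable_profiles.
by rewrite setTI law_profiles subee.
Qed.

(** Only the upper function is integrable: with unbounded qualities the relaxed objective may be
    [-oo]. Positive and negative parts are compared separately. *)
Lemma le_integral_integrable d (S : measurableType d) (mu : {measure set S -> \bar R})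
    (D : set S) (f h : S -> R) : measurable D -> measurable_fun D f ->
  mu.-integrable D (EFin \o h) -> (forall x, D x -> f x <= h x) ->
  (\int[mu]_(x in D) (f x)%:E <= \int[mu]_(x in D) (h x)%:E)%E.
Proof.
move=> mD mf ih fh; have mh : measurable_fun D h.
  by apply/measurable_EFinP; exact: (measurable_int mu).
rewrite [leLHS]integralE [leRHS]integralE; apply: leeB.
- apply: ge0_le_integral => //; do ?[exact: measurable_funepos].
  + by apply: measurable_funepos; exact/measurable_EFinP.
  + by apply: measurable_funepos; exact/measurable_EFinP.
  + by move=> x Dx; rewrite !funeposE -!EFin_max lee_fin ge_max !le_max fh// lexx orbT.
- apply: ge0_le_integral => //.
  + by apply: measurable_funeneg; exact/measurable_EFinP.
  + by apply: measurable_funeneg; exact/measurable_EFinP.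
  + move=> x Dx; rewrite !funenegE -!EFinN -!EFin_max lee_fin ge_max !le_max lerN2 fh//=.
    by rewrite lexx orbT.
Qed.

(** Nothing is known of [g] on negative numbers, so it is replaced by [g (max 0 y)], which is
    monotone and therefore measurable. *)
Lemma measurable_cost_comp d (S : measurableType d) (u : S -> R) :
  measurable_fun setT u -> (forall x, 0 <= u x) -> measurable_fun setT (fun x => g (u x)).
Proof.
move=> mu u0; rewrite (_ : (fun x => _) = (fun y => g (Num.max 0 y)) \o u); last first.
  by apply/funext => x /=; rewrite max_r.
apply: measurableT_comp mu; apply: nondecreasing_measurable => //= x y xy.
apply: cost_le => //; first by rewrite le_max lexx.
by rewrite ge_max !le_max lexx xy orbT.
Qed.

Lemma bmeas_cost d (S : measurableType d) (u : S -> R) : bmeas u ->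
  (forall x, 0 <= u x) -> bmeas (fun x => g (u x)).
Proof.
move=> [mu [M uM]] u0; split; first exact: measurable_cost_comp.
exists (g M) => x; rewrite ger0_norm ?cost_ge0//; apply: cost_le => //.
exact: le_trans (ler_norm _) (uM x).
Qed.

Lemma bmeas_bounded (u : T -> R) M : measurable_fun setT u ->
  (forall x, 0 <= u x <= M) -> bmeas u.
Proof.
by move=> mu uM; split => //; exists M => x; have /andP[u0 ?] := uM x; rewrite ger0_norm.
Qed.

Definition surplus (u1 u2 : R -> R) (w : T * T -> R) (p : T * T) : R :=
  (u1 p.1 - a * J p.1) * w p + (u2 p.2 - a * J p.2) * (1 - w p)
  - (g (u1 p.1) + g (u2 p.2)).

Definition welfare (u1 u2 : R -> R) (w : T * T -> R) : R :=
  Ex P (fun x => Ex P (fun y => surplus u1 u2 w (x, y))).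

Definition clamped (z : T * T -> R) (p : T * T) : R := z (clamp p.1, clamp p.2).

Lemma measurable_clamped (z : T * T -> R) :
  measurable_fun profiles z -> measurable_fun setT (clamped z).
Proof.
move=> mz; apply: (@measurable_comp _ _ _ _ _ _ profiles z) => //.
- exact: measurable_profiles.
- by move=> _ [p _ <-]; split => /=; exact: clamp_types.
by apply: measurable_fun_pair; apply: measurableT_comp => //;
  [exact: measurable_clamp|exact: measurable_clamp].
Qed.

Lemma measurable_clamped1 (u : R -> R) :
  measurable_fun types (u : T -> T) -> measurable_fun setT (fun x : T => u (clamp x) : R).
Proof.
move=> mu; apply: (@measurable_comp _ _ _ _ _ _ types u) => //.
- exact: measurable_types.
- by move=> _ [p _ <-]; exact: clamp_types.
exact: measurable_clamp.
Qed.

Section feasible_allocation.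
Variables (q : 'I_2 -> R -> R) (z : 'I_2 -> T * T -> R).
Hypothesis qz : relaxed_feasible q z.
Local Notation u i := (fun x => q i (clamp x)).
Local Notation w := (clamped (z favored)).

Lemma clamped_quality i x : 0 <= u i x.
Proof.
by apply: (relaxed_quality_ge0 qz); have := clamp_types x.
Qed.

Lemma clamped_share01 p : 0 <= w p <= 1.
Proof.
have pp : profiles (clamp p.1, clamp p.2) by split; exact: clamp_types.
rewrite (relaxed_share_ge0 qz)//=; have := relaxed_share_sum1 qz pp.
by rewrite sum_firms => <-; rewrite lerDl (relaxed_share_ge0 qz).
Qed.

Lemma relaxed_objectiveE : relaxed_objective E q z =
  (\int[P \x P]_(p in profiles) (surplus (u favored) (u rival) w p)%:E)%E.
Proof.
apply: eq_integral => -[x y] /set_mem pp; congr EFin; rewrite sum_firms/=.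
have := relaxed_share_sum1 qz pp; rewrite sum_firms => zz.
case: (pp) => /= tx ty; rewrite /surplus /clamped/= !clamp_id// -zz.
by rewrite /type_of/=; ring.
Qed.

Lemma measurable_surplus : measurable_fun setT (surplus (u favored) (u rival) w).
Proof.
have mw : measurable_fun setT w.
  by apply: measurable_clamped; exact: (relaxed_share_measurable qz).
have m1 i : measurable_fun setT (fun p : T * T => u i p.1 : R).
  apply: (measurableT_comp (f := fun x : T => u i x : R)); last exact: measurable_fst.
  by apply: measurable_clamped1; exact: (relaxed_quality_measurable qz).
have m2 i : measurable_fun setT (fun p : T * T => u i p.2 : R).
  apply: (measurableT_comp (f := fun x : T => u i x : R)); last exact: measurable_snd.
  by apply: measurable_clamped1; exact: (relaxed_quality_measurable qz).
have mJ : bmeas (fun x : T => a * J x) by apply: bmeasZ; exact: bmeas_virtual_type.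
have [mJ1 _] := bmeas_fst mJ; have [mJ2 _] := bmeas_snd mJ.
apply: measurable_funB; last first.
  by apply: measurable_funD; apply: measurable_cost_comp => // p; exact: clamped_quality.
apply: measurable_funD; apply: measurable_funM => //; do ?exact: measurable_funB.
Qed.

End feasible_allocation.

Lemma bmeas_surplus u1 u2 w : bmeas (u1 : T -> R) -> bmeas (u2 : T -> R) ->
  (forall x, 0 <= u1 x) -> (forall x, 0 <= u2 x) -> bmeas w ->
  bmeas (surplus u1 u2 w).
Proof.
move=> b1 b2 p1 p2 bw.
have mJ : bmeas (fun x : T => a * J x) by apply: bmeasZ; exact: bmeas_virtual_type.
apply: bmeasB; last first.
  by apply: bmeasD; [apply: (bmeas_fst (h := fun x => g (u1 x)))|
    apply: (bmeas_snd (h := fun x => g (u2 x)))]; exact: bmeas_cost.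
apply: bmeasD; apply: bmeasM => //.
- by apply: bmeasB; [apply: (bmeas_fst (h := u1))|apply: (bmeas_fst mJ)].
- by apply: bmeasB; [apply: (bmeas_snd (h := u2))|apply: (bmeas_snd mJ)].
- by apply: bmeasB => //; exact: bmeas_cst.
Qed.

Lemma surplus_integrable u1 u2 w : bmeas (surplus u1 u2 w) ->
  (\int[P \x P]_(p in profiles) (surplus u1 u2 w p)%:E = (welfare u1 u2 w)%:E)%E.
Proof.
move=> bs; rewrite -EFin_Ex_prod//.
rewrite [RHS](@negligible_integral _ _ _ _ _ (~` profiles))//.
- by rewrite setTD setCK.
- by apply: measurableC; exact: measurable_profiles.
- exact: bmeas_integrable_prod.
- exact: law_profilesC.
Qed.

Lemma relaxed_objective_truncate q z : relaxed_feasible q z ->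
  exists u1 u2 w, [/\ bmeas (u1 : T -> R) /\ bmeas (u2 : T -> R), bmeas w,
    (forall x, 0 <= u1 x <= Q 1) /\ (forall x, 0 <= u2 x <= Q 1),
    (forall p, 0 <= w p <= 1) &
    (relaxed_objective E q z <= (welfare u1 u2 w)%:E)%E].
Proof.
move=> qz; have Q0 : 0 <= Q 1 by rewrite inv_marginal_cost_ge0// lexx ler01.
pose u i x := Num.min (q i (clamp x)) (Q 1).
have mu i : measurable_fun setT (fun x : T => u i x : R).
  apply: measurable_minr => //.
  by apply: measurable_clamped1; exact: (relaxed_quality_measurable qz).
have u01 i x : 0 <= u i x <= Q 1.
  by rewrite /u le_min (clamped_quality qz) Q0 ge_min lexx orbT.
have w01 := clamped_share01 qz.
have bw : bmeas (clamped (z favored)).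
  split; first by apply: measurable_clamped; exact: (relaxed_share_measurable qz).
  by exists 1 => p; have /andP[w0 w1] := w01 p; rewrite ger0_norm.
have bu i : bmeas (u i : T -> R) by exact: bmeas_bounded (u01 i).
exists (u favored), (u rival), (clamped (z favored)); split => //.
have bs : bmeas (surplus (u favored) (u rival) (clamped (z favored))).
  by apply: bmeas_surplus => // x; [have /andP[] := u01 favored x|have /andP[] := u01 rival x].
rewrite relaxed_objectiveE// -surplus_integrable//.
apply: le_integral_integrable.
- exact: measurable_profiles.
- by apply: measurable_funTS; exact: measurable_surplus.
- apply: (integrableS measurableT) => //; first exact: measurable_profiles.
  exact: bmeas_integrable_prod.
move=> p _; rewrite /surplus.
have /andP[w0 w1] := w01 p.
have w1' : 0 <= 1 - clamped (z favored) p <= 1 by lra.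
have h1 := truncated_quality_better hE (clamped_quality qz favored p.1) (w01 p).
have h2 := truncated_quality_better hE (clamped_quality qz rival p.2) w1'.
rewrite -/(u _ _) in h1; rewrite -/(u _ _) in h2.
lra.
Qed.

Lemma relaxed_objective_bounded q z : relaxed_feasible q z ->
  (forall i x, types x -> q i x <= Q 1) ->
  relaxed_objective E q z =
  (welfare (fun x => q favored (clamp x)) (fun x => q rival (clamp x)) (clamped (z favored)))%:E.
Proof.
move=> qz q1; rewrite relaxed_objectiveE//; apply: surplus_integrable.
have w01 := clamped_share01 qz; have u0 := clamped_quality qz.
apply: bmeas_surplus => //.
- apply: (@bmeas_bounded _ (Q 1)) => [|x].
    by apply: measurable_clamped1; exact: (relaxed_quality_measurable qz).
  by rewrite u0 q1//; exact: clamp_types.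
- apply: (@bmeas_bounded _ (Q 1)) => [|x].
    by apply: measurable_clamped1; exact: (relaxed_quality_measurable qz).
  by rewrite u0 q1//; exact: clamp_types.
split; first by apply: measurable_clamped; exact: (relaxed_share_measurable qz).
by exists 1 => p; have /andP[w0 w1] := w01 p; rewrite ger0_norm.
Qed.

(** * Monotone best replies *)

Definition choose_max (u1 u2 : R -> R) : R :=
  Ex P (fun x => Ex P (fun y => Num.max (u1 x - a * J x) (u2 y - a * J y)))
  - Ex P (fun x => g (u1 x)) - Ex P (fun x => g (u2 x)).

Definition quality_schedule (u : R -> R) :=
  bmeas (u : T -> R) /\ (forall x, 0 <= u x <= Q 1).

Lemma bmeas_net u : quality_schedule u -> bmeas (fun x : T => u x - a * J x).
Proof.
by move=> [bu _]; apply: bmeasB => //; apply: bmeasZ; exact: bmeas_virtual_type.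
Qed.

Lemma bmeas_schedule_cost u : quality_schedule u -> bmeas (fun x : T => g (u x)).
Proof.
by move=> [bu u01]; apply: bmeas_cost => // x; have /andP[] := u01 x.
Qed.

Lemma bmeas_pair_max v1 v2 : bmeas (v1 : T -> R) -> bmeas (v2 : T -> R) ->
  bmeas (fun p : T * T => Num.max (v1 p.1) (v2 p.2)).
Proof.
by move=> b1 b2; apply: bmeas_max; [exact: (bmeas_fst b1)|exact: (bmeas_snd b2)].
Qed.

Lemma welfare_le_choose_max u1 u2 w : quality_schedule u1 -> quality_schedule u2 ->
  bmeas w -> (forall p, 0 <= w p <= 1) -> welfare u1 u2 w <= choose_max u1 u2.
Proof.
move=> s1 s2 bw w01.
have b1 := bmeas_net s1; have b2 := bmeas_net s2.
have c1 := bmeas_schedule_cost s1; have c2 := bmeas_schedule_cost s2.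
have bm := bmeas_pair_max b1 b2.
have bc : bmeas (fun p : T * T => g (u1 p.1) + g (u2 p.2)).
  by apply: bmeasD; [exact: (bmeas_fst c1)|exact: (bmeas_snd c2)].
have bs : bmeas (surplus u1 u2 w).
  case: s1 s2 => [bu1 u1_01] [bu2 u2_01].
  by apply: bmeas_surplus => // x; [have /andP[] := u1_01 x|have /andP[] := u2_01 x].
have -> : choose_max u1 u2 = Ex P (fun x => Ex P (fun y =>
    Num.max (u1 x - a * J x) (u2 y - a * J y) - (g (u1 x) + g (u2 y)))).
  rewrite /choose_max.
  transitivity (Ex P (fun x => Ex P (fun y => Num.max (u1 x - a * J x) (u2 y - a * J y))
      - (g (u1 x) + Ex P (fun y => g (u2 y))))).
    rewrite ExB; [|exact: (bmeas_Ex1 P P bm)|by apply: bmeasD => //; exact: bmeas_cst].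
    by rewrite ExD//; [rewrite Ex_cst; ring|exact: bmeas_cst].
  apply: eq_Ex => x; rewrite [in RHS]ExB.
  - by rewrite ExD ?Ex_cst//; exact: bmeas_cst.
  - exact: (bmeas_section1 x bm).
  - by apply: bmeasD => //; exact: bmeas_cst.
apply: le_Ex; [exact: (bmeas_Ex1 P P bs)|exact: (bmeas_Ex1 P P (bmeasB bm bc))|].
move=> x; apply: le_Ex; [exact: (bmeas_section1 x bs)|exact: (bmeas_section1 x (bmeasB bm bc))|].
move=> y; rewrite /surplus/= lerD2r.
have /andP[w0 w1] := w01 (x, y).
set A := _ - _; set B := u2 y - _.
have hA : A <= Num.max A B by rewrite le_max lexx.
have hB : B <= Num.max A B by rewrite le_max lexx orbT.
nra.
Qed.

Lemma choose_maxC u1 u2 : quality_schedule u1 -> quality_schedule u2 ->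
  choose_max u1 u2 = choose_max u2 u1.
Proof.
move=> s1 s2; have bm := bmeas_pair_max (bmeas_net s1) (bmeas_net s2).
rewrite /choose_max.
have -> : Ex P (fun x => Ex P (fun y => Num.max (u1 x - a * J x) (u2 y - a * J y))) =
    Ex P (fun x => Ex P (fun y => Num.max (u2 x - a * J x) (u1 y - a * J y))).
  transitivity (Ex P (fun y => Ex P (fun x => Num.max (u1 x - a * J x) (u2 y - a * J y)))).
    exact: (Ex_swap P P bm).
  by apply: eq_Ex => x; apply: eq_Ex => y; rewrite maxC.
by rewrite addrAC.
Qed.

(* Against any fixed schedule of the opponent the quality of type x solves a
   maximization in which v = q - alpha J(x) enters through a function of v and
   the cost g(v + alpha J(x)): since the latter is strictly supermodular in v
   and J(x), best responses are monotone. *)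
Lemma monotone_best_response u1 u2 : quality_schedule u1 -> quality_schedule u2 ->
  exists b, [/\ quality_schedule b,
    (forall x y, types x -> types y -> x <= y -> b y - a * J y <= b x - a * J x) &
    choose_max u1 u2 <= choose_max b u2].
Proof.
move=> s1 s2; have b2 := bmeas_net s2; have c2 := bmeas_schedule_cost s2.
have Q0 : 0 <= Q 1 by rewrite inv_marginal_cost_ge0// lexx ler01.
(* The interim value of offering [v] is 1-Lipschitz, which provides the continuity needed for a
   maximizer. *)
pose phi (v : R) := Ex P (fun y => Num.max v (u2 y - a * J y)).
have bphi v : bmeas (fun y : T => Num.max v (u2 y - a * J y)).
  by apply: bmeas_max => //; exact: bmeas_cst.
have lip v v' : `|phi v - phi v'| <= `|v - v'|.
  apply: Ex_normB => // y; rewrite /Num.max.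
  have := ler_norm (v - v'); have := ler_norm (- (v - v')); rewrite normrN.
  by case: ltP => h1; case: ltP => h2 h3 h4; rewrite ler_norml; apply/andP; split; lra.
have ex j : exists c, 0 <= c <= Q 1 /\ forall q, 0 <= q <= Q 1 ->
    phi (q - j) - g q <= phi (c - j) - g c.
  have [|c] := @EVT_max R (fun q => phi (q - j) - g q) 0 (Q 1) Q0.
    have cphi : continuous (fun q : R => phi (q - j)).
      move=> x; apply/cvgrPdist_lt => e e0; near=> y.
      apply: le_lt_trans (lip _ _) _.
      rewrite opprB addrA subrK distrC.
      by near: y; apply/nbhs_ballP; exists e => //= y; rewrite /ball/= distrC.
    have cg : {within `[0, Q 1], continuous g}.
      apply: derivable_within_continuous => x; rewrite in_itv/= => /andP[x0 _].
      exact: cost_derivable.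
    move=> x; apply: cvgB; last exact: cg.
    exact: (continuous_subspaceT cphi).
  by rewrite in_itv/= => c01 hc; exists c; split.
(* The maximizer is selected as a function of the cost level [a * J x]; thus [b] is unchanged by
   [clamp], as [J x] is. *)
pose b x := projT1 (cid (ex (a * J x))).
have bP x : 0 <= b x <= Q 1 /\ forall q, 0 <= q <= Q 1 ->
    phi (q - a * J x) - g q <= phi (b x - a * J x) - g (b x).
  by rewrite /b; case: cid.
have bmono x y : types x -> types y -> x <= y -> b y - a * J y <= b x - a * J x.
  move=> tx ty; rewrite le_eqVlt => /predU1P[->//|xy].
  rewrite leNgt; apply/negP => vw.
  have Jxy : a * J x < a * J y.
    rewrite ltr_pM2l ?alpha_gt0// !clamp_id//.
    by apply: (virtual_type_increasing hE).
  have [/andP[bx0 bx1] hx] := bP x; have [/andP[by0 by1] hy] := bP y.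
  have := @cost_supermodular _ _ hE _ _ _ _ _ vw Jxy.
  rewrite !subrK => /(_ bx0).
  (* Each type is offered the net value of the other. Both qualities lie between [b x] and [b y],
     hence are admissible, and the sum of the two optimality conditions contradicts
     supermodularity. *)
  have := hx (b y - a * J y + a * J x); have := hy (b x - a * J x + a * J y).
  rewrite !addrK => h1 h2.
  have {}h1 := h1 ltac:(apply/andP; split; lra).
  have {}h2 := h2 ltac:(apply/andP; split; lra).
  lra.
have bcl x : b (clamp x) = b x.
  by rewrite /b clamp_id//; exact: clamp_types.
have bb : bmeas (b : T -> R).
  have := @bmeasD _ _ _ _ _ (bmeas_nonincreasing_clamp (h := fun x => b x - a * J x) bmono)
    (bmeasZ a (bmeas_virtual_type hE)).
  rewrite (_ : (fun x : T => _) = b)//; apply/funext => x.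
  by rewrite bcl (clamp_id (clamp_types x)) subrK.
have sb : quality_schedule b by split => // x; case: (bP x).
exists b; split => //; rewrite /choose_max lerD2r.
have bm := bmeas_pair_max (bmeas_net s1) b2; have bm' := bmeas_pair_max (bmeas_net sb) b2.
have k1 := bmeas_schedule_cost s1; have k2 := bmeas_schedule_cost sb.
have e1 := bmeas_Ex1 P P bm; have e2 := bmeas_Ex1 P P bm'.
rewrite -!ExB//; apply: le_Ex; [exact: bmeasB|exact: bmeasB|].
by move=> x; have [_ /(_ (u1 x))] := bP x; apply; case: s1 => _; apply.
Unshelve. all: by end_near.
Qed.

(** * Optimal qualities for a given winning region *)

Section monotone_region_value.
Variable r : R -> R -> bool.
Hypotheses (br : bmeas_region r) (mr : monotone_region r).

Definition win1 (x : R) := Ex P (fun y => (r x y)%:R).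
Definition win2 (y : R) := Ex P (fun x => (~~ r x y)%:R).

Lemma bmeas_lose : bmeas (fun p : T * T => (~~ r p.1 p.2)%:R : R).
Proof.
rewrite (_ : (fun p => _) = fun p : T * T => 1 - (r p.1 p.2)%:R).
  by apply: bmeasB => //; exact: bmeas_cst.
by apply/funext => p; case: (r _ _); rewrite /= ?subrr ?subr0.
Qed.

Lemma win1P x : types x -> 0 <= win1 x <= 1 /\
  conjugate_cost E (win1 x) = Ex P (fun y => (r x y)%:R * sym_quality E y).
Proof.
move=> tx; apply: conjugate_cost_upper_set => //.
  exact: (bmeas_section1 x br).
by move=> y y' ty ty' rxy yy'; apply: mr rxy.
Qed.

Lemma win2P y : types y -> 0 <= win2 y <= 1 /\
  conjugate_cost E (win2 y) = Ex P (fun x => (~~ r x y)%:R * sym_quality E x).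
Proof.
move=> ty; apply: conjugate_cost_upper_set => //.
  exact: (bmeas_section2 y bmeas_lose).
by move=> x x' tx tx' nr xx'; apply: contra nr => ?; apply: mr (_ : r x' y).
Qed.

Lemma region_value_split : region_value E r =
  Ex P (fun x => Ex P (fun y => (r x y)%:R * sym_quality E y) - a * J x * win1 x) +
  Ex P (fun y => Ex P (fun x => (~~ r x y)%:R * sym_quality E x) - a * J y * win2 y).
Proof.
have bq := bmeas_sym_quality hE.
have bJ : bmeas (fun x : T => a * J x) by apply: bmeasZ; exact: bmeas_virtual_type.
have bl := bmeas_lose.
have bq1 := bmeas_fst bq; have bq2 := bmeas_snd bq.
have bJ1 := bmeas_fst bJ; have bJ2 := bmeas_snd bJ.
pose s (p : T * T) := (r p.1 p.2)%:R * (sym_quality E p.2 - a * J p.1).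
pose s' (p : T * T) := (~~ r p.1 p.2)%:R * (sym_quality E p.1 - a * J p.2).
have bs : bmeas s by apply: bmeasM => //; exact: bmeasB.
have bs' : bmeas s' by apply: bmeasM => //; exact: bmeasB.
transitivity (Ex P (fun x => Ex P (fun y => s (x, y))) + Ex P (fun x => Ex P (fun y => s' (x, y)))).
  rewrite -ExD; [|exact: (bmeas_Ex1 P P bs)|exact: (bmeas_Ex1 P P bs')].
  apply: eq_Ex => x; rewrite -ExD; [|exact: (bmeas_section1 x bs)|exact: (bmeas_section1 x bs')].
  by apply: eq_Ex => y; rewrite /s /s'/=; case: (r x y) => /=; ring.
rewrite (Ex_swap P P bs'); congr (_ + _); apply: eq_Ex => x.
  rewrite /win1 -ExZ; last exact: (bmeas_section1 x br).
  rewrite -ExB; [|exact: (bmeas_section1 x (bmeasM br bq2))|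
    exact: (bmeas_section1 x (bmeasM bJ1 br))].
  by apply: eq_Ex => y; rewrite /s/=; ring.
rewrite /win2 -ExZ; last exact: (bmeas_section2 x bl).
rewrite -ExB; [|exact: (bmeas_section2 x (bmeasM bl bq1))|
  exact: (bmeas_section2 x (bmeasM bJ2 bl))].
by apply: eq_Ex => y; rewrite /s'/=; ring.
Qed.

Lemma welfare_split u1 u2 : quality_schedule u1 -> quality_schedule u2 ->
  welfare u1 u2 (fun p => (r p.1 p.2)%:R) =
  Ex P (fun x => u1 x * win1 x - g (u1 x) - a * J x * win1 x) +
  Ex P (fun y => u2 y * win2 y - g (u2 y) - a * J y * win2 y).
Proof.
move=> s1 s2.
have b1 := bmeas_net s1; have b2 := bmeas_net s2.
have c1 := bmeas_schedule_cost s1; have c2 := bmeas_schedule_cost s2.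
have bl := bmeas_lose.
pose s (p : T * T) := (u1 p.1 - a * J p.1) * (r p.1 p.2)%:R - g (u1 p.1).
pose s' (p : T * T) := (u2 p.2 - a * J p.2) * (~~ r p.1 p.2)%:R - g (u2 p.2).
have bs : bmeas s by apply: bmeasB; [exact: (bmeasM (bmeas_fst b1) br)|exact: (bmeas_fst c1)].
have bs' : bmeas s' by apply: bmeasB; [exact: (bmeasM (bmeas_snd b2) bl)|exact: (bmeas_snd c2)].
transitivity (Ex P (fun x => Ex P (fun y => s (x, y))) + Ex P (fun x => Ex P (fun y => s' (x, y)))).
  rewrite -ExD; [|exact: (bmeas_Ex1 P P bs)|exact: (bmeas_Ex1 P P bs')].
  apply: eq_Ex => x; rewrite -ExD; [|exact: (bmeas_section1 x bs)|exact: (bmeas_section1 x bs')].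
  by apply: eq_Ex => y; rewrite /s /s' /surplus/=; case: (r x y) => /=; ring.
rewrite (Ex_swap P P bs'); congr (_ + _); apply: eq_Ex => x.
  rewrite /s/= ExB; [|exact: (bmeasZ _ (bmeas_section1 x br))|exact: bmeas_cst].
  by rewrite Ex_cst ExZ; [rewrite /win1; ring|exact: (bmeas_section1 x br)].
rewrite /s'/= ExB; [|exact: (bmeasZ _ (bmeas_section2 x bl))|exact: bmeas_cst].
by rewrite Ex_cst ExZ; [rewrite /win2; ring|exact: (bmeas_section2 x bl)].
Qed.

Lemma bmeas_win1 : bmeas (win1 : T -> R).
Proof. exact: (bmeas_Ex1 P P br). Qed.

Lemma bmeas_win2 : bmeas (win2 : T -> R).
Proof. exact: (bmeas_Ex2 P P bmeas_lose). Qed.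

Lemma bmeas_conj1 : bmeas (fun x : T => Ex P (fun y => (r x y)%:R * sym_quality E y)).
Proof.
exact: (bmeas_Ex1 P P (bmeasM br (bmeas_snd (bmeas_sym_quality hE)))).
Qed.

Lemma bmeas_conj2 : bmeas (fun y : T => Ex P (fun x => (~~ r x y)%:R * sym_quality E x)).
Proof.
exact: (bmeas_Ex2 P P (bmeasM bmeas_lose (bmeas_fst (bmeas_sym_quality hE)))).
Qed.

Lemma bmeas_virtual_cost (w : T -> R) : bmeas w -> bmeas (fun x : T => a * J x * w x).
Proof.
by move=> bw; apply: bmeasM => //; apply: bmeasZ; exact: bmeas_virtual_type.
Qed.

Lemma bmeas_interim u (w : T -> R) : quality_schedule u -> bmeas w ->
  bmeas (fun x : T => u x * w x - g (u x) - a * J x * w x).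
Proof.
move=> su bw; apply: bmeasB; last exact: bmeas_virtual_cost.
by apply: bmeasB; [apply: bmeasM => //; case: su|exact: bmeas_schedule_cost].
Qed.

(** Once the region is fixed, the quality of a type interacts only with its own winning probability,
    so Fenchel-Young applies type by type. *)
Lemma welfare_le_region_value u1 u2 : quality_schedule u1 -> quality_schedule u2 ->
  welfare u1 u2 (fun p => (r p.1 p.2)%:R) <= region_value E r.
Proof.
move=> s1 s2; rewrite welfare_split// region_value_split.
apply: lerD; apply: le_Ex_types => //.
- exact: bmeas_interim bmeas_win1.
- by apply: bmeasB; [exact: bmeas_conj1|exact/bmeas_virtual_cost/bmeas_win1].
- move=> x tx; have [w01 <-] := win1P tx; rewrite lerD2r.
  by apply: conjugate_cost_ub => //; case: s1 => _ /(_ x) /andP[].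
- exact: bmeas_interim bmeas_win2.
- by apply: bmeasB; [exact: bmeas_conj2|exact/bmeas_virtual_cost/bmeas_win2].
- move=> x tx; have [w01 <-] := win2P tx; rewrite lerD2r.
  by apply: conjugate_cost_ub => //; case: s2 => _ /(_ x) /andP[].
Qed.

Lemma welfare_eq_region_value u1 u2 : quality_schedule u1 -> quality_schedule u2 ->
  (forall x, types x -> u1 x = Q (win1 x)) -> (forall x, types x -> u2 x = Q (win2 x)) ->
  welfare u1 u2 (fun p => (r p.1 p.2)%:R) = region_value E r.
Proof.
move=> s1 s2 e1 e2; rewrite welfare_split// region_value_split.
congr (_ + _); apply: eq_Ex_types => //.
- exact: bmeas_interim bmeas_win1.
- by apply: bmeasB; [exact: bmeas_conj1|exact/bmeas_virtual_cost/bmeas_win1].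
- by move=> x tx; have [w01 <-] := win1P tx; rewrite e1.
- exact: bmeas_interim bmeas_win2.
- by apply: bmeasB; [exact: bmeas_conj2|exact/bmeas_virtual_cost/bmeas_win2].
- by move=> x tx; have [w01 <-] := win2P tx; rewrite e2.
Qed.

End monotone_region_value.

Lemma choose_max_region u1 u2 : quality_schedule u1 -> quality_schedule u2 ->
  (forall x y, types x -> types y -> x <= y -> u1 y - a * J y <= u1 x - a * J x) ->
  (forall x y, types x -> types y -> x <= y -> u2 y - a * J y <= u2 x - a * J x) ->
  exists r, [/\ bmeas_region r, monotone_region r &
    choose_max u1 u2 = welfare u1 u2 (fun p => (r p.1 p.2)%:R)].
Proof.
move=> s1 s2 m1 m2; exists (fun x y => (u2 y - a * J y <= u1 x - a * J x)%R).
have b1 := bmeas_net s1; have b2 := bmeas_net s2.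
have c1 := bmeas_schedule_cost s1; have c2 := bmeas_schedule_cost s2.
have br : bmeas_region (fun x y => (u2 y - a * J y <= u1 x - a * J x)%R).
  by apply: (bmeas_le (bmeas_snd b2) (bmeas_fst b1)).
split => //.
  move=> x y x' y' tx ty tx' ty' xx yy h.
  exact: le_trans (m2 _ _ ty ty' yy) (le_trans h (m1 _ _ tx' tx xx)).
have bm := bmeas_pair_max b1 b2.
have bc : bmeas (fun p : T * T => g (u1 p.1) + g (u2 p.2)).
  by apply: bmeasD; [exact: (bmeas_fst c1)|exact: (bmeas_snd c2)].
rewrite /choose_max.
transitivity (Ex P (fun x => Ex P (fun y => Num.max (u1 x - a * J x) (u2 y - a * J y))
    - (g (u1 x) + Ex P (fun y => g (u2 y))))).
  rewrite ExB; [|exact: (bmeas_Ex1 P P bm)|by apply: bmeasD => //; exact: bmeas_cst].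
  by rewrite ExD//; [rewrite Ex_cst; ring|exact: bmeas_cst].
apply: eq_Ex => x.
transitivity (Ex P (fun y => Num.max (u1 x - a * J x) (u2 y - a * J y) - (g (u1 x) + g (u2 y)))).
  rewrite [in RHS]ExB.
  - by rewrite ExD ?Ex_cst//; exact: bmeas_cst.
  - exact: (bmeas_section1 x bm).
  - by apply: bmeasD => //; exact: bmeas_cst.
apply: eq_Ex => y; rewrite /surplus/=; congr (_ - _).
by case: leP => h; rewrite /=; ring.
Qed.

Lemma relaxed_upper_bound : sufficiently_convex E -> exists2 t, 0 <= t <= 1 &
  forall q z, relaxed_feasible q z ->
    (relaxed_objective E q z <= (region_value E (threshold_region t))%:E)%E.
Proof.
move=> hconv; have [t t01 ht] := threshold_region_optimal hE hconv.
exists t => // q z /relaxed_objective_truncate[u1 [u2 [w [[b1 b2] bw [h1 h2] w01 le]]]].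
have s1 : quality_schedule u1 by [].
have s2 : quality_schedule u2 by [].
(* [v1] stays fixed while the second firm replies to it, so after two replies both schedules are
   monotone. *)
have [v1 [sv1 m1 l1]] := monotone_best_response s1 s2.
have [v2 [sv2 m2 l2]] := monotone_best_response s2 sv1.
have [r [br mr e]] := choose_max_region sv1 sv2 m1 m2.
apply: (le_trans le); rewrite lee_fin.
apply: (le_trans (welfare_le_choose_max s1 s2 bw w01)).
apply: (le_trans l1); rewrite choose_maxC//; apply: (le_trans l2).
rewrite choose_maxC// e; apply: le_trans (ht r br mr).
exact: welfare_le_region_value.
Qed.

End relaxed_problem.

(** * Revenue equivalence *)

Section revenue_equivalence.
Context {R : realType} (E : environment R) (hE : separable_structure E).
Local Notation T := (measurableTypeR R).
Local Notation P := (type_law E).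
Local Notation g := (inv_cost E).
Local Notation J x := (virtual_type E (clamp x)).
Local Notation types := (@types R).
Local Notation profiles := (@type_profiles R).
Local Notation a := (alpha E).
Local Notation mu := (@lebesgue_measure R).

Lemma measurable_types_law : measurable types /\ P types = 1%E.
Proof. by split; [exact: measurable_types|exact: law_types]. Qed.

Lemma integrable_event d (S : measurableType d) (nu : {measure set S -> \bar R}) (D : set S)
    (f : S -> R) : measurable D -> nu (~` D) = 0%E -> measurable_fun setT f ->
  nu.-integrable D (EFin \o f) -> nu.-integrable setT (EFin \o f).
Proof.
move=> mD nD mf iD; have mf' : measurable_fun setT (EFin \o f) by exact/measurable_EFinP.
apply/(negligible_integrable (measurableC mD) measurableT mf' nD).
by rewrite setTD setCK.
Qed.

Lemma Rintegral_event d (S : measurableType d) (nu : {measure set S -> \bar R}) (D : set S)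
    (f : S -> R) : measurable D -> nu (~` D) = 0%E ->
  nu.-integrable setT (EFin \o f) ->
  (\int[nu]_(x in D) f x)%R = (\int[nu]_x f x)%R.
Proof.
move=> mD nD iT; rewrite /Rintegral; congr fine.
by rewrite [RHS](negligible_integral (measurableC mD))// setTD setCK.
Qed.

Lemma law_typesC : P (~` types) = 0%E.
Proof.
have [mt Pt] := measurable_types_law.
by have /= -> := @probability_setC _ _ _ P _ mt; rewrite Pt subee.
Qed.

Lemma clamped_integrable1 (h : T -> R) : P.-integrable types (EFin \o h) ->
  P.-integrable setT (EFin \o (fun x : T => h (clamp x))).
Proof.
have mt := measurable_types (R := R).
move=> ih; apply: (@integrable_event _ _ _ types) => //.
- exact: law_typesC.
- by apply: measurable_clamped1; apply/measurable_EFinP; exact: (measurable_int P).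
- by apply: eq_integrable ih => // x /set_mem tx; rewrite /= clamp_id.
Qed.

Lemma clamped_Rintegral1 (h : T -> R) : P.-integrable types (EFin \o h) ->
  (\int[P]_(x in types) h x)%R = Ex P (fun x => h (clamp x)).
Proof.
move=> ih; have mt := measurable_types (R := R).
rewrite -[RHS](@Rintegral_event _ _ _ types)//.
- by apply: eq_Rintegral => x /set_mem tx; rewrite clamp_id.
- exact: law_typesC.
- exact: clamped_integrable1.
Qed.

Lemma clamped_integrable2 (h : T * T -> R) : (P \x P)%E.-integrable profiles (EFin \o h) ->
  (P \x P)%E.-integrable setT (EFin \o clamped h).
Proof.
have mt := measurable_profiles (R := R).
move=> ih; apply: (@integrable_event _ _ _ profiles) => //.
- exact: law_profilesC.
- by apply: measurable_clamped; apply/measurable_EFinP; exact: (measurable_int (P \x P)%E).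
- apply: eq_integrable ih => // -[x y] /set_mem[/= tx ty].
  by rewrite /clamped/= !clamp_id.
Qed.

Definition place (i : 'I_2) (x y : R) : T * T := if i == favored then (x, y) else (y, x).

Lemma place_own i x y : (if i == favored then (place i x y).1 else (place i x y).2) = x.
Proof. by rewrite /place; case: (i == favored). Qed.

(** Transfers may be unbounded. Integrability of the sections is required at every type, not almost
    every one, so that the interim expectation is a genuine real number throughout. *)
Lemma integrable_interim i (h : T * T -> R) : (P \x P)%E.-integrable setT (EFin \o h) ->
  (forall x, P.-integrable setT (EFin \o (fun y : T => h (place i x y)))) ->
  P.-integrable setT (EFin \o (fun x : T => Ex P (fun y => h (place i x y)))) /\
  (\int[(P \x P)%E]_p h p)%R = Ex P (fun x => Ex P (fun y => h (place i x y))).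
Proof.
move=> ih isec; have EE x : (\int[P]_y (h (place i x y))%:E)%E = (Ex P (fun y => h (place i x y)))%:E.
  by rewrite /Ex /Rintegral fineK//; apply: integrable_fin_num => //; exact: isec.
move: isec EE; rewrite /place; case: (i == favored) => isec EE.
  have FE : fubini_F P (EFin \o h) = EFin \o (fun x : T => Ex P (fun y => h (x, y))).
    by apply/funext => x; rewrite /fubini_F/= EE.
  split; first by rewrite -FE; exact: integrable_fubini_F.
  by rewrite [RHS]/Ex /Rintegral -(integral12_prod_meas1 ih) FE.
have FE : fubini_G P (EFin \o h) = EFin \o (fun x : T => Ex P (fun y => h (y, x))).
  by apply/funext => x; rewrite /fubini_G/= EE.
split; last by rewrite [RHS]/Ex /Rintegral -(integral21_prod_meas1 ih) FE.
have mh : measurable_fun setT (EFin \o h) by exact: (measurable_int (P \x P)%E).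
rewrite -FE; apply/integrableP; split; first exact: (@measurable_fubini_G _ _ _ _ _ P P).
apply: le_lt_trans ((integrable21ltyP P P mh).1 ih).
apply: ge0_le_integral => //.
- by apply: measurableT_comp => //; exact: (@measurable_fubini_G _ _ _ _ _ P P).
- apply: (measurable_fun_fubini_tonelli_G (abse \o (EFin \o h))) => //=.
  by apply: measurableT_comp => //; exact: abse_measurable.
- move=> y _; apply: le_abse_integral => //.
  by apply: (measurableT_comp mh); exact: pair2_measurable.
Qed.

Lemma integrable_own_type i (h : T -> R) : P.-integrable setT (EFin \o h) ->
  (P \x P)%E.-integrable setT (EFin \o (fun p : T * T => h (if i == favored then p.1 else p.2))).
Proof.
move=> ih; have mh : measurable_fun setT h.
  by apply/measurable_EFinP; exact: (measurable_int P).
have P1 (c : \bar R) : (\int[P]_(_ in setT) c = c)%E.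
  by rewrite integral_cst//; have /= -> := @probability_setT _ _ _ P; rewrite mule1.
have /integrableP[_ hoo] := ih.
case: (i == favored).
  apply/integrable12ltyP => /=.
    by apply/measurable_EFinP; apply: (measurableT_comp mh); exact: measurable_fst.
  by under eq_integral do rewrite P1.
apply/integrable21ltyP => /=.
  by apply/measurable_EFinP; apply: (measurableT_comp mh); exact: measurable_snd.
by under eq_integral do rewrite P1.
Qed.

Lemma tail_integral_increment (Z : R -> R) (x y : R) : 0 <= x -> x <= y -> y <= 1 ->
  bmeas (Z : T -> R) -> {in `[x, y], forall u, Z y <= Z u <= Z x} ->
  (y - x) * Z y <= tail_integral Z x - tail_integral Z y <= (y - x) * Z x.
Proof.
move=> x0 xy y1 bZ Zle.
have iZ u v := bmeas_integrable_itv u v bZ.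
have -> : tail_integral Z x - tail_integral Z y = (\int[mu]_(u in `[x, y]) Z u)%R.
  rewrite /tail_integral -(@Rintegral_itv_obnd_cbnd _ y); last first.
    by apply: (integrableS _ _ _ (iZ y 1)) => //; apply: subset_itvr; rewrite bnd_simp.
  rewrite -(@Rintegral_itvB _ _ (BLeft x) (BRight 1) y)//; by ring.
have mxy : fine (mu `[x, y]%classic) = y - x.
  rewrite lebesgue_measure_itv/= lte_fin; move: xy; rewrite le_eqVlt => /predU1P[->|->//].
  by rewrite ltxx subrr.
have cst c : (\int[mu]_(u in `[x, y]) c)%R = (y - x) * c.
  by rewrite Rintegral_cst// mxy mulrC.
have ic c : mu.-integrable `[x, y] (EFin \o (fun=> c)).
  have bc : bmeas (fun _ : T => c) by exact: bmeas_cst.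
  exact: (bmeas_integrable_itv x y bc).
rewrite -!cst; apply/andP; split; apply: le_Rintegral => // u; rewrite /= => uxy;
  by have /andP[] := Zle u uxy.
Qed.

Lemma firm_cases (i : 'I_2) : i = favored \/ i = rival.
Proof.
by case: i => -[|[|//]] h; [left|right]; exact: val_inj.
Qed.

(** * Incentive constraints in an arbitrary feasible mechanism *)

Section mechanism.
Context (M : @mechanism R) (sigma : strategy M) (hs : feasible E sigma).

Definition shares i (p : T * T) : R := share i (played sigma p).
Definition transfers i (p : T * T) : R := transfer i (played sigma p).
Definition qualities i (x : R) : R := (sigma i x).2%:num.

(** Mimicking another type of the same firm is the only deviation used for revenue equivalence; it
    produces the play of a type profile. *)
Lemma deviation_played i (x y : R) : deviation sigma (sigma i x) y = played sigma (place i x y).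
Proof.
apply: functional_extensionality_dep => j; rewrite /deviation /played /place /type_of.
by case: (firm_cases i) => ->; case: (firm_cases j) => -> /=;
  rewrite ?dfwithin// dfwithout.
Qed.

Lemma place_clamp i x y : clamped (shares i) (place i x y) = shares i (place i (clamp x) (clamp y)).
Proof. by rewrite /clamped /place; case: ifP. Qed.

Definition interim_share i (x : R) : R := Ex P (fun y => clamped (shares i) (place i x y)).
Definition interim_transfer i (x : R) : R := Ex P (fun y => clamped (transfers i) (place i x y)).
Definition equilibrium_payoff i (x : R) : R := interim_payoff E sigma x (sigma i x).
Local Notation U := equilibrium_payoff.
Local Notation Z := interim_share.

Lemma relaxed_feasible_of_feasible : relaxed_feasible qualities shares.
Proof.
split.
- by move=> i; exact: (quality_measurable hs).
- move=> i; apply/measurable_EFinP; apply: (measurable_int (P \x P)%E).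
  exact: (share_integrable hs).
- by move=> i x _; rewrite /qualities.
- by move=> i p pp; exact: (share_ge0 hs).
- by move=> p pp; exact: (share_sum1 hs).
Qed.

Lemma clamped_shares01 i p : 0 <= clamped (shares i) p <= 1.
Proof.
have pp : profiles (clamp p.1, clamp p.2) by split; exact: clamp_types.
rewrite (share_ge0 hs)//=; have := share_sum1 hs pp; rewrite sum_firms => <-.
by case: (firm_cases i) => ->; rewrite ?lerDl ?lerDr (share_ge0 hs).
Qed.

Lemma bmeas_clamped_shares i : bmeas (clamped (shares i)).
Proof.
split; last by exists 1 => p; have /andP[w0 w1] := clamped_shares01 i p; rewrite ger0_norm.
apply: measurable_clamped; apply/measurable_EFinP; apply: (measurable_int (P \x P)%E).
exact: (share_integrable hs).
Qed.

Lemma bmeas_place_shares i x : bmeas (fun y : T => clamped (shares i) (place i x y)).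
Proof.
have b := bmeas_clamped_shares i; rewrite /place; case: (i == favored).
  exact: (bmeas_section1 x b).
exact: (bmeas_section2 x b).
Qed.

Lemma interim_shareE i x : types x ->
  Z i x = (\int[P]_(y in types) share i (deviation sigma (sigma i x) y))%R.
Proof.
move=> tx; rewrite (@clamped_Rintegral1 (fun y => share i (deviation sigma (sigma i x) y))); last first.
  by have [] := deviation_integrable hs (sigma i x).
by apply: eq_Ex => y; rewrite place_clamp deviation_played clamp_id.
Qed.

Lemma place_transfers_integrable i x :
  P.-integrable setT (EFin \o (fun y : T => clamped (transfers i) (place i x y))).
Proof.
have [_ it] := deviation_integrable hs (sigma i (clamp x)).
have := @clamped_integrable1 (fun y => transfer i (deviation sigma (sigma i (clamp x)) y)) it.
apply: eq_integrable => // y _ /=; congr EFin; rewrite deviation_played.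
by rewrite /clamped /transfers /place; case: ifP.
Qed.

Lemma interim_transferE i x : types x ->
  interim_transfer i x = (\int[P]_(y in types) transfer i (deviation sigma (sigma i x) y))%R.
Proof.
move=> tx; rewrite (@clamped_Rintegral1 (fun y => transfer i (deviation sigma (sigma i x) y))); last first.
  by have [] := deviation_integrable hs (sigma i x).
apply: eq_Ex => y; rewrite deviation_played /clamped /transfers /place.
by case: ifP; rewrite /= (clamp_id tx).
Qed.

Lemma deviation_payoffE i (t x : R) : types x ->
  interim_payoff E sigma t (sigma i x) =
  interim_transfer i x - a * t * Z i x - g (qualities i x).
Proof.
move=> tx; rewrite interim_shareE// interim_transferE//.
have [iis it] := deviation_integrable hs (sigma i x).
rewrite /interim_payoff; congr (_ - _); have mt := measurable_types (R := R).
rewrite RintegralB//.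
  by rewrite RintegralZl.
by have := integrableZl mt (a * t) iis; apply: eq_integrable => // y _.
Qed.

Lemma incentive i (t x : R) : types t -> types x ->
  U i x + a * (x - t) * Z i x <= U i t.
Proof.
move=> tt tx; have := equilibrium hs (sigma i x) tt.
rewrite -/(U i t) deviation_payoffE// => h; rewrite [U i x]deviation_payoffE//.
by move: h; lra.
Qed.

(** Adding the two constraints that keep [x] and [y] from mimicking each other cancels the
    payoffs. *)
Lemma interim_share_le i x y : types x -> types y -> x <= y -> Z i y <= Z i x.
Proof.
move=> tx ty; rewrite le_eqVlt => /predU1P[->//|xy].
have h1 := incentive i tx ty; have h2 := incentive i ty tx.
have : a * (y - x) * Z i y <= a * (y - x) * Z i x by lra.
by rewrite ler_pM2l// mulr_gt0 ?alpha_gt0// subr_gt0.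
Qed.

Lemma interim_share_clamp i x : Z i (clamp x) = Z i x.
Proof.
apply: eq_Ex => y; rewrite !place_clamp; congr (shares _ (place _ _ _)).
by rewrite clamp_id//; exact: clamp_types.
Qed.

Lemma bmeas_interim_share i : bmeas (Z i : T -> R).
Proof.
have := bmeas_nonincreasing_clamp (h := Z i) (@interim_share_le i).
by rewrite (_ : (fun x : T => _) = Z i)//; apply/funext => x; exact: interim_share_clamp.
Qed.

Lemma interim_share_ge0 i x : 0 <= Z i x.
Proof. by apply: Ex_ge0 => y; have /andP[] := clamped_shares01 i (place i x y). Qed.

(** From [y] to [z], both [U i] and [a] times the tail integral drop by an amount between
    [a * (z - y) * Z i z] and [a * (z - y) * Z i y]; [increments_bound_eq] applies with the identity
    as second factor, without continuity of [Z i]. *)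
Lemma envelope i x : types x -> U i x = U i 1 + a * tail_integral (Z i) x.
Proof.
move=> tx; have /andP[x0 x1] : 0 <= x <= 1 by rewrite -typesE.
have tail1 : tail_integral (Z i) 1 = 0.
  by rewrite /tail_integral set_itv1 Rintegral_set1.
suff : U i x - a * tail_integral (Z i) x = U i 1 - a * tail_integral (Z i) 1.
  by rewrite tail1 mulr0 subr0 => <-; rewrite subrK.
apply: (@increments_bound_eq R (fun x => U i x - a * tail_integral (Z i) x)
  (fun x => a * Z i x) id) => //.
  by apply: continuous_subspaceT => y; exact: cvg_id.
move=> y z xy yz z1.
have ty : types y by rewrite typesE; lra.
have tz : types z by rewrite typesE; lra.
have h1 := incentive i ty tz; have h2 := incentive i tz ty.
have Zle : {in `[y, z], forall u, Z i z <= Z i u <= Z i y}.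
  move=> u; rewrite in_itv/= => /andP[yu uz].
  have tu : types u by rewrite typesE; lra.
  by rewrite !interim_share_le.
have /andP[] := tail_integral_increment (le_trans x0 xy) yz z1 (bmeas_interim_share i) Zle.
have a0 := alpha_gt0 hE.
move=> /(ler_wpM2l (ltW a0)) h3 /(ler_wpM2l (ltW a0)) h4.
by rewrite ler_norml; apply/andP; split; lra.
Qed.

Lemma bmeas_payoff i : bmeas (fun x : T => U i (clamp x)).
Proof.
rewrite (_ : (fun x : T => _) = fun x : T => U i 1 + a * tail_integral (Z i) (clamp x)).
  apply: bmeasD; first exact: bmeas_cst.
  apply: bmeasZ; apply: bmeas_tail_integral; first exact: bmeas_interim_share.
  exact: interim_share_ge0.
by apply/funext => x; rewrite (envelope i (clamp_types x)).
Qed.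

Lemma transfers_integrable i :
  P.-integrable setT (EFin \o (interim_transfer i : T -> R)) /\
  (\int[(P \x P)%E]_p clamped (transfers i) p)%R = Ex P (interim_transfer i).
Proof.
apply: integrable_interim; last exact: place_transfers_integrable.
by apply: clamped_integrable2; exact: (transfer_integrable hs).
Qed.

Lemma interim_transfer_split i x : interim_transfer i x =
  g (qualities i (clamp x)) + (a * (clamp x * Z i x) + U i (clamp x)).
Proof.
have tx := clamp_types x; rewrite /U deviation_payoffE// interim_share_clamp.
have -> : interim_transfer i (clamp x) = interim_transfer i x; last by ring.
apply: eq_Ex => y; rewrite /clamped /place; case: ifP => _ /=;
  by rewrite (clamp_id tx).
Qed.

Lemma bmeas_rest i : bmeas (fun x : T => a * (clamp x * Z i x) + U i (clamp x)).
Proof.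
apply: bmeasD; last exact: bmeas_payoff.
by apply: bmeasZ; apply: bmeasM; [exact: bmeas_clamp|exact: bmeas_interim_share].
Qed.

(** Qualities may be unbounded, but the cost is the integrable interim transfer minus a bounded
    function. *)
Lemma cost_integrable i : P.-integrable setT (EFin \o (fun x : T => g (qualities i (clamp x)))).
Proof.
have [it _] := transfers_integrable i.
have ib := bmeas_integrableP P (bmeas_rest i).
have := integrableB measurableT it ib; apply: eq_integrable => // x _.
by rewrite /= interim_transfer_split -EFinB addrK.
Qed.

(** The transfer covers the investment cost, the production cost and the rent. The envelope formula
    and Fubini turn the expected rent into the gap between virtual type and type. *)
Lemma expected_transfer i : Ex P (interim_transfer i) =
  Ex P (fun x => g (qualities i (clamp x))) + a * Ex P (fun x => J x * Z i x) + U i 1.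
Proof.
have ib := bmeas_integrableP P (bmeas_rest i).
rewrite (_ : interim_transfer i = fun x => g (qualities i (clamp x)) +
    (a * (clamp x * Z i x) + U i (clamp x))); last first.
  by apply/funext => x; exact: interim_transfer_split.
rewrite {1}/Ex RintegralD//; last exact: cost_integrable.
rewrite -/(Ex P _) -/(Ex P _) -addrA; congr (_ + _).
have bc : bmeas (fun x : T => clamp x * Z i x).
  by apply: bmeasM; [exact: bmeas_clamp|exact: bmeas_interim_share].
have bt := bmeas_tail_integral (bmeas_interim_share i) (interim_share_ge0 i).
have bj : bmeas (fun x : T => (J x - clamp x) * Z i x).
  apply: bmeasM; last exact: bmeas_interim_share.
  by apply: bmeasB; [exact: bmeas_virtual_type|exact: bmeas_clamp].
rewrite ExD; [|exact: bmeasZ|exact: bmeas_payoff].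
have -> : Ex P (fun x => U i (clamp x)) =
    a * Ex P (fun x => (J x - clamp x) * Z i x) + U i 1.
  rewrite (Ex_information_rent hE (bmeas_interim_share i) (interim_share_ge0 i)).
  rewrite -ExZ// -[U i 1 in RHS](Ex_cst P) -ExD; [|exact: bmeasZ|exact: bmeas_cst].
  by apply: eq_Ex => x; rewrite (envelope i (clamp_types x)) addrC.
rewrite ExZ// addrA -mulrDr -ExD//; congr (_ * _ + _).
by apply: eq_Ex => x; ring.
Qed.

Lemma virtual_share_expectation i :
  (\int[(P \x P)%E]_p (J (if i == favored then p.1 else p.2) * clamped (shares i) p))%R =
  Ex P (fun x => J x * Z i x).
Proof.
have bJ : bmeas (fun x : T => J x) by exact: bmeas_virtual_type.
have bw := bmeas_clamped_shares i.
have bh : bmeas (fun p : T * T => J (if i == favored then p.1 else p.2) * clamped (shares i) p).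
  by apply: bmeasM => //; case: (i == favored); [exact: (bmeas_fst bJ)|exact: (bmeas_snd bJ)].
have [x|_ ->] := @integrable_interim i _ (bmeas_integrable_prod P P bh).
  apply: bmeas_integrableP; rewrite /place; case: (i == favored) bh => bh.
    exact: (bmeas_section1 x bh).
  exact: (bmeas_section2 x bh).
apply: eq_Ex => x; rewrite -ExZ; last exact: bmeas_place_shares.
by apply: eq_Ex => y; rewrite place_own.
Qed.

(** Inserts [expected_transfer] into the buyer's utility. The witness [r] also records that the
    relaxed objective of a feasible mechanism is finite. *)
Theorem revenue_equivalence : exists r : R, relaxed_objective E qualities shares = r%:E /\
  buyer_utility E sigma = (r - (U favored 1 + U rival 1))%:E.
Proof.
pose s i (p : T * T) := qualities i (type_of p i) * shares i p.
have iis i : (P \x P)%E.-integrable profiles (EFin \o s i) by exact: (value_integrable hs).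
have isc i := clamped_integrable2 (iis i).
have it i : (P \x P)%E.-integrable profiles (EFin \o transfers i) by exact: (transfer_integrable hs).
have itc i := clamped_integrable2 (it i).
have mp := measurable_profiles (R := R).
pose vs i (p : T * T) := a * (J (if i == favored then p.1 else p.2) * clamped (shares i) p).
have bvs i : bmeas (fun p : T * T => J (if i == favored then p.1 else p.2) * clamped (shares i) p).
  have bJ : bmeas (fun x : T => J x) by exact: bmeas_virtual_type.
  apply: bmeasM; last exact: bmeas_clamped_shares.
  by case: (i == favored); [exact: (bmeas_fst bJ)|exact: (bmeas_snd bJ)].
have ivs i : (P \x P)%E.-integrable setT (EFin \o vs i).
  by apply: bmeas_integrable_prod; apply: bmeasZ.
pose c i (p : T * T) := g (qualities i (clamp (if i == favored then p.1 else p.2))).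
have ic i : (P \x P)%E.-integrable setT (EFin \o c i).
  exact: (integrable_own_type i (cost_integrable i)).
have Ic i : (\int[(P \x P)%E]_p c i p)%R = Ex P (fun x => g (qualities i (clamp x))).
  have [x|_ ->] := @integrable_interim i _ (ic i).
    have bc : bmeas (fun _ : T => g (qualities i (clamp x))) by exact: bmeas_cst.
    have := bmeas_integrableP P bc.
    by apply: eq_integrable => // y _; rewrite /= /c place_own.
  apply: eq_Ex => x; rewrite -[RHS](Ex_cst P); apply: eq_Ex => y.
  by rewrite /c place_own.
have Ivs i : (\int[(P \x P)%E]_p vs i p)%R = a * Ex P (fun x => J x * Z i x).
  rewrite /vs RintegralZl//; first by rewrite virtual_share_expectation.
  exact: bmeas_integrable_prod.
have It i : (\int[(P \x P)%E]_p clamped (transfers i) p)%R = Ex P (interim_transfer i).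
  by have [] := transfers_integrable i.
have iD (f h : T * T -> R) : (P \x P)%E.-integrable setT (EFin \o f) ->
    (P \x P)%E.-integrable setT (EFin \o h) ->
    (P \x P)%E.-integrable setT (EFin \o (fun p => f p + h p)).
  by move=> h1 h2; exact: (integrableD measurableT h1 h2).
have iB (f h : T * T -> R) : (P \x P)%E.-integrable setT (EFin \o f) ->
    (P \x P)%E.-integrable setT (EFin \o h) ->
    (P \x P)%E.-integrable setT (EFin \o (fun p => f p - h p)).
  by move=> h1 h2; exact: (integrableB measurableT h1 h2).
have ID (f h : T * T -> R) : (P \x P)%E.-integrable setT (EFin \o f) ->
    (P \x P)%E.-integrable setT (EFin \o h) ->
    (\int[(P \x P)%E]_p (f p + h p) = \int[(P \x P)%E]_p f p + \int[(P \x P)%E]_p h p)%R.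
  by move=> h1 h2; exact: RintegralD.
have IB (f h : T * T -> R) : (P \x P)%E.-integrable setT (EFin \o f) ->
    (P \x P)%E.-integrable setT (EFin \o h) ->
    (\int[(P \x P)%E]_p (f p - h p) = \int[(P \x P)%E]_p f p - \int[(P \x P)%E]_p h p)%R.
  by move=> h1 h2; exact: RintegralB.
have from_clamped (h k : T * T -> R) (l : R) : (forall p, profiles p -> h p = k p) ->
    (P \x P)%E.-integrable setT (EFin \o k) -> (\int[(P \x P)%E]_p k p)%R = l ->
    (\int[P \x P]_(p in profiles) (h p)%:E)%E = l%:E.
  move=> hk ik <-; rewrite -(@Rintegral_event _ _ _ profiles)//; last exact: law_profilesC.
  rewrite /Rintegral fineK.
    by apply: eq_integral => p /set_mem pp; rewrite hk.
  by apply: integrable_fin_num => //; exact: (integrableS measurableT).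
have ids i := iB _ _ (iB _ _ (isc i) (ivs i)) (ic i).
pose S i := (\int[(P \x P)%E]_p clamped (s i) p)%R.
exists (S favored - a * Ex P (fun x => J x * Z favored x) - Ex P (fun x => g (qualities favored (clamp x))) +
  (S rival - a * Ex P (fun x => J x * Z rival x) - Ex P (fun x => g (qualities rival (clamp x))))).
split.
  apply: (from_clamped _ (fun p => clamped (s favored) p - vs favored p - c favored p +
    (clamped (s rival) p - vs rival p - c rival p))).
  - move=> [x y] [/= tx ty]; rewrite sum_firms /clamped /s /vs /c /type_of/= /clamped/= !clamp_id//.
    by ring.
  - exact: iD (ids _) (ids _).
  rewrite (ID _ _ (ids _) (ids _)) !(IB _ _ (iB _ _ (isc _) (ivs _)) (ic _)).
  by rewrite !(IB _ _ (isc _) (ivs _)) !Ic !Ivs.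
apply: (from_clamped _ (fun p => clamped (s favored) p - clamped (transfers favored) p +
    (clamped (s rival) p - clamped (transfers rival) p))).
- by move=> [x y] [/= tx ty]; rewrite sum_firms /clamped /s /type_of/= !clamp_id.
- exact: iD (iB _ _ (isc _) (itc _)) (iB _ _ (isc _) (itc _)).
rewrite (ID _ _ (iB _ _ (isc _) (itc _)) (iB _ _ (isc _) (itc _))).
rewrite !(IB _ _ (isc _) (itc _)) !It.
rewrite !expected_transfer.
have alg (s1 s2 j1 j2 c1 c2 u1 u2 : R) : s1 - (c1 + a * j1 + u1) + (s2 - (c2 + a * j2 + u2)) =
    s1 - a * j1 - c1 + (s2 - a * j2 - c2) - (u1 + u2) by ring.
exact: alg.
Qed.

End mechanism.

End revenue_equivalence.

(** * The score floor auction *)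

Section auction.
Context {R : realType} (E : environment R) (hE : separable_structure E).
Local Notation T := (measurableTypeR R).
Local Notation P := (type_law E).
Local Notation F := (type_cdf E).
Local Notation G x := (1 - type_cdf E x).
Local Notation g := (inv_cost E).
Local Notation Q := (inv_marginal_cost E).
Local Notation q := (sym_quality E).
Local Notation types := (@types R).
Local Notation profiles := (@type_profiles R).
Local Notation a := (alpha E).
Local Notation cc := (conjugate_cost E).

Lemma conjugate_cost_gt0 w : 0 < w <= 1 -> 0 < cc w.
Proof.
move=> w01; have /andP[w0 w1] := w01; have Qw := inv_marginal_cost_gt0 hE w01.
have [c [c0 cQ e]] := cost_MVT hE (lexx 0) Qw.
have := marginal_cost_lt hE (ltW c0) cQ.
rewrite inv_marginal_costV ?(ltW w0)// => cw.
move: e; rewrite cost0// !subr0 /conjugate_cost => ->.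
by rewrite subr_gt0 mulrC ltr_pM2l.
Qed.

Lemma conjugate_cost_lipschitz (v w : R) : 0 <= v -> v <= w -> w <= 1 -> cc w - cc v <= Q 1 * (w - v).
Proof.
move=> v0 vw w1; have v01 : 0 <= v <= 1 by lra.
have w01 : 0 <= w <= 1 by lra.
have := conjugate_cost_tangent hE w01 v01.
have := inv_marginal_cost_le hE (le_trans v0 vw) (lexx 1) w1.
nra.
Qed.

Lemma bmeas_survival : bmeas (fun x : T => G x : R).
Proof. by apply: bmeasB; [exact: bmeas_cst|exact: bmeas_type_cdf]. Qed.

Lemma survival_le x y : x <= y -> G y <= G x.
Proof. by move=> xy; rewrite lerB// type_cdf_nondecreasing. Qed.

Lemma survival_lt (x y : R) : 0 <= x -> y <= 1 -> x < y -> G y < G x.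
Proof.
move=> x0 y1 xy; rewrite ltrD2l ltrN2 (type_cdf_lt hE)// in_itv/=; lra.
Qed.

Lemma survival_gt0 x : 0 <= x -> x < 1 -> 0 < G x.
Proof. by move=> x0 x1; have := survival_lt x0 (lexx 1) x1; rewrite type_cdf1// subrr. Qed.

(** * Rents and scores up to the threshold *)

Section threshold.
Variable t : R.
Hypotheses (t0 : 0 <= t) (t1 : t <= 1).

(** The integral of [G] from [x] to [t]: rents are measured from the threshold type, which earns
    none. *)
Definition rent (x : R) : R :=
  tail_integral (fun u => G u) x - tail_integral (fun u => G u) t.

Lemma rent_threshold : rent t = 0.
Proof. by rewrite /rent subrr. Qed.

Lemma rent_increment (x y : R) : 0 <= x -> x <= y -> y <= 1 ->
  (y - x) * G y <= rent x - rent y <= (y - x) * G x.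
Proof.
move=> x0 xy y1; have -> : rent x - rent y =
    tail_integral (fun u => G u) x - tail_integral (fun u => G u) y by rewrite /rent; ring.
apply: tail_integral_increment => //; first exact: bmeas_survival.
by move=> u; rewrite in_itv/= => /andP[xu uy]; rewrite !survival_le.
Qed.

Lemma rent_ge0 x : 0 <= x -> x <= t -> 0 <= rent x.
Proof.
move=> x0 xt; have /andP[+ _] := rent_increment x0 xt t1.
rewrite rent_threshold subr0; apply: le_trans.
by rewrite mulr_ge0 ?subr_ge0//; have /andP[] := survival01 E t; rewrite subr_ge0.
Qed.

(** Solves [(p - a * x) * G x - g (q x) = a * rent x] for [p]. At [x = 1] the division by [G 1 = 0]
    returns 0, so the price is [a] and the score [- a]. *)
Definition bid_price (x : R) : R := a * x + (g (q x) + a * rent x) / G x.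
Definition bid_score (x : R) : R := q x - bid_price x.

Lemma bid_price_ge0 x : 0 <= x -> x <= t -> 0 <= bid_price x.
Proof.
move=> x0 xt; have a0 := ltW (alpha_gt0 hE); have /andP[G0 _] := survival01 E x.
apply: addr_ge0; first exact: mulr_ge0.
apply: mulr_ge0; last by rewrite invr_ge0.
apply: addr_ge0; first by apply: cost_ge0 => //; exact: sym_quality_ge0.
by rewrite mulr_ge0// rent_ge0.
Qed.

(** The multiplied form survives [G x = 0]: this happens only for [x = t = 1], where both sides are
    0. *)
Lemma bid_scoreM (x : R) : 0 <= x -> x <= t ->
  bid_score x * G x = cc (G x) - a * x * G x - a * rent x.
Proof.
move=> x0 xt; rewrite /bid_score /bid_price /conjugate_cost -/(q x).
have [G0|G0] := eqVneq (G x) 0; last by field.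
have x1 : x = 1.
  apply/eqP; rewrite eq_le (le_trans xt t1)/= leNgt; apply/negP => x1.
  by have := survival_gt0 x0 x1; rewrite G0 ltxx.
have tx : t = x by apply/eqP; rewrite eq_le xt x1 t1.
rewrite G0 /sym_quality G0 inv_marginal_cost0// cost0// -tx rent_threshold.
by ring.
Qed.

(** Type [x] could use the quality [q y], which bounds [cc (G x)] below. After cross-multiplication
    the gap contains [g (q y) * (G x - G y) > 0]: a lower type spreads the investment over a higher
    winning probability. *)
Lemma bid_score_lt (x y : R) : 0 <= x -> x < y -> y <= t -> bid_score y < bid_score x.
Proof.
move=> x0 xy yt; have y1 := le_trans yt t1; have xt := le_trans (ltW xy) yt.
have y0 := le_trans x0 (ltW xy).
have Gx0 : 0 < G x by apply: survival_gt0 => //; lra.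
have Gxy := survival_lt x0 y1 xy.
have Nx := bid_scoreM x0 xt.
have a0 := alpha_gt0 hE.
have /andP[_ hR] := rent_increment x0 (ltW xy) y1.
have hR' := ler_wpM2l (ltW a0) hR.
have hx := survival01 E x; have hy := survival01 E y.
rewrite -(ltr_pM2r Gx0) Nx.
(* At [y = 1] the score is [- a] by the division convention, and cross-multiplication by [G y = 0]
   would say nothing. *)
have [ylt|yge] := ltP y 1; last first.
  have ye : y = 1 by apply/eqP; rewrite eq_le y1.
  have te : t = y by apply/eqP; rewrite eq_le yt ye t1.
  have Gy0 : G y = 0 by rewrite ye type_cdf1// subrr.
  have -> : bid_score y = - a.
    rewrite /bid_score /bid_price /sym_quality Gy0 inv_marginal_cost0// cost0//.
    by rewrite invr0 mulr0 ye; ring.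
  have hh : 0 < cc (G x) by apply: conjugate_cost_gt0; rewrite Gx0; case/andP: hx.
  have Ry : rent y = 0 by rewrite -te rent_threshold.
  by move: hR'; rewrite Ry ye; nra.
have Gy0 : 0 < G y by exact: survival_gt0.
have Ny := bid_scoreM y0 yt.
have gq : 0 < g (q y).
  by apply: cost_gt0 => //; apply: inv_marginal_cost_gt0 => //; rewrite Gy0; case/andP: hy.
have Ry := rent_ge0 y0 yt.
have c1 := conjugate_cost_ub hE (sym_quality_ge0 hE y) hx.
rewrite -(ltr_pM2r Gy0) mulrAC Ny /conjugate_cost -/(q y).
apply: (@lt_le_trans _ _ ((q y * G x - g (q y) - a * x * G x - a * rent x) * G y)); last first.
  by rewrite ler_pM2r// !lerD2r.
rewrite -subr_gt0.
have -> : (q y * G x - g (q y) - a * x * G x - a * rent x) * G y -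
    (q y * G y - g (q y) - a * y * G y - a * rent y) * G x =
    (g (q y) + a * rent y) * (G x - G y) + (a * ((y - x) * G x) - a * (rent x - rent y)) * G y.
  by ring.
apply: ltr_wpDr.
  by rewrite mulr_ge0 ?(ltW Gy0)// subr_ge0.
by rewrite mulr_gt0 ?subr_gt0// ltr_wpDr// mulr_ge0// ltW.
Qed.

Lemma bid_score_le x y : 0 <= x -> x <= y -> y <= t -> bid_score y <= bid_score x.
Proof.
by move=> x0; rewrite le_eqVlt => /predU1P[->//|xy] yt; rewrite ltW// bid_score_lt.
Qed.

(* A deviation with score s wins against the types above some tau, whose scores
   are at most s; letting these types tend to tau bounds the price. *)
Lemma deviation_bound (s tau : R) : 0 <= tau -> tau <= t -> bid_score t <= s ->
  (forall y : R, tau < y -> y < t -> bid_score y <= s) ->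
  cc (G tau) - s * G tau <= a * tau * G tau + a * rent tau.
Proof.
move=> tau0 taut fs hs.
have a0 := alpha_gt0 hE.
move: taut; rewrite le_eqVlt => /predU1P[->|taut].
  have := bid_scoreM t0 (lexx t); have /andP[Gt0 _] := survival01 E t.
  have := ler_wpM2r Gt0 fs; lra.
apply/ler_addgt0Pr => e e0.
(* The summands are the moduli of the terms that vary: [Q 1] for the conjugate, the absolute value
   of [s] for the score, [a] for the production cost; 1 ensures positivity. *)
pose K := Q 1 + `|s| + a + 1.
have Q0 : 0 <= Q 1 by rewrite inv_marginal_cost_ge0// lexx ler01.
have K0 : 0 < K by rewrite /K; have := normr_ge0 s; lra.
pose d := e / K / 2.
have d0 : 0 < d by rewrite !divr_gt0.
(* The approximating type must be close to [tau] both in type and in probability: [y0] secures the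
   former, the intermediate value theorem for [F] the latter. *)
have [y0 [y0tau y0t y0d]] : exists y0, [/\ tau < y0, y0 < t & y0 <= tau + d].
  exists (Num.min ((tau + t) / 2) (tau + d)); split.
  - by rewrite lt_min ltrDl d0 andbT; lra.
  - by rewrite gt_min; apply/orP; left; lra.
  - by rewrite ge_min lexx orbT.
have Fy0 : F tau < F y0.
  apply: (type_cdf_lt hE) => //; rewrite in_itv/=.
    by rewrite tau0 (le_trans (ltW taut)).
  by rewrite (le_trans tau0 (ltW y0tau)) (le_trans (ltW y0t)).
pose v := Num.min (F tau + d) (F y0).
have vlo : F tau < v by rewrite /v lt_min ltrDl d0.
have [||y] := @IVT R F tau y0 v (ltW y0tau).
- apply: continuous_subspaceW (type_cdf_continuous hE).
  move=> x /=; rewrite !in_itv/= => /andP[x1 x2].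
  by rewrite (le_trans tau0 x1) (le_trans x2 (le_trans (ltW y0t) t1)).
- have vhi : v <= F y0 by rewrite ge_min lexx orbT.
  by rewrite ge_min (ltW vlo) le_max vhi orbT.
rewrite in_itv/= => /andP[ty yy0] Fy.
have tauy : tau < y.
  by rewrite lt_neqAle ty andbT; apply/eqP => e'; move: vlo; rewrite -Fy e' ltxx.
have yt : y < t by exact: le_lt_trans yy0 y0t.
have Gd : G tau - G y <= d.
  have : v <= F tau + d by rewrite /v ge_min lexx.
  by rewrite -Fy; lra.
have y00 : 0 <= y := le_trans tau0 ty.
have Ny := bid_scoreM y00 (ltW yt).
have hx := survival01 E tau; have hy := survival01 E y.
have /andP[Gy0 Gy1] := hy; have /andP[Gt0 Gt1] := hx.
have Gle := survival_le ty.
have c1 := conjugate_cost_lipschitz Gy0 Gle Gt1.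
have sy := ler_wpM2r Gy0 (hs y tauy yt).
have /andP[Rle _] := rent_increment tau0 ty (le_trans (ltW yt) t1).
have R' : rent y <= rent tau.
  have : 0 <= (y - tau) * G y by rewrite mulr_ge0// subr_ge0.
  lra.
have R'' := ler_wpM2l (ltW a0) R'.
have s1 : - s * (G tau - G y) <= `|s| * (G tau - G y).
  by rewrite ler_wpM2r ?subr_ge0//; have := ler_norm (- s); rewrite normrN.
have s2 : (Q 1 + `|s|) * (G tau - G y) <= (Q 1 + `|s|) * d.
  by rewrite ler_wpM2l// addr_ge0.
have s3 : a * y * G y <= a * tau * G tau + a * d.
  have e1 : a * y * G y <= a * y * G tau by rewrite ler_wpM2l// mulr_ge0// ltW.
  have e2 : a * ((y - tau) * G tau) <= a * d.
    rewrite ler_wpM2l ?(ltW a0)//.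
    apply: (@le_trans _ _ (y - tau)); last lra.
    by rewrite ler_piMr// subr_ge0.
  have e3 : a * y * G tau = a * tau * G tau + a * ((y - tau) * G tau) by ring.
  lra.
have Kd : (Q 1 + `|s| + a) * d <= e.
  have : K * d = e / 2 by rewrite /d; field; rewrite gt_eqF.
  by rewrite /K; lra.
lra.
Qed.

(** [rent] is convex with slope [- G], so its tangent at [tau] lies below it. The right side
    continues [rent] beyond [t] by its tangent at [t], which is flatter than the one at [tau]. *)
Lemma rent_incentive (tau x : R) : 0 <= tau -> tau <= t -> 0 <= x -> x <= 1 ->
  G tau * (tau - x) + rent tau <= G t * (t - Num.max x t) + rent (Num.min x t).
Proof.
move=> tau0 taut x0 x1; have tau1 := le_trans taut t1.
have [xt|tx] := leP x t.
  rewrite subrr mulr0 add0r; have [xtau|taux] := leP x tau.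
    by have /andP[] := rent_increment x0 xtau tau1; lra.
  by have /andP[] := rent_increment tau0 (ltW taux) x1; lra.
rewrite rent_threshold; have /andP[_] := rent_increment tau0 taut t1.
rewrite rent_threshold; have := survival_le taut.
nra.
Qed.

(** The type whose bid is placed: favored types above [t] bid as [t] does. *)
Definition own (i : 'I_2) (x : R) : R := if i == favored then Num.min (clamp x) t else clamp x.

Definition active (i : 'I_2) (x : R) : bool := (i == favored) || (clamp x < t).

(* Inactive rivals ask a price that makes them lose: their score is at most the
   floor bid_score t. *)
Definition sprice (i : 'I_2) (x : R) : R :=
  if active i x then bid_price (own i x) else `|bid_score t|.

Definition squality (i : 'I_2) (x : R) : R :=
  if active i x then q (own i x) else 0.

Definition sscore (i : 'I_2) (x : R) : R :=
  if active i x then bid_score (own i x) else - `|bid_score t|.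

Lemma own_itv i x : active i x -> 0 <= own i x /\ own i x <= t.
Proof.
rewrite /active /own; case: (i == favored) => /= [_|/ltW xt].
  by rewrite le_min clamp_ge0 t0 ge_min lexx orbT.
by rewrite clamp_ge0.
Qed.

Lemma sprice_ge0 i x : 0 <= sprice i x.
Proof. by rewrite /sprice; case: ifP => // /own_itv[]; exact: bid_price_ge0. Qed.

Lemma squality01 i x : 0 <= squality i x <= Q 1.
Proof.
have Q0 : 0 <= Q 1 by rewrite inv_marginal_cost_ge0// lexx ler01.
rewrite /squality; case: ifP => _; last by rewrite lexx.
rewrite sym_quality_ge0//; have /andP[G0 G1] := survival01 E (own i x).
exact: inv_marginal_cost_le.
Qed.

Lemma sscoreE i x : squality i x - sprice i x = sscore i x.
Proof. by rewrite /squality /sprice /sscore; case: ifP => // _; rewrite sub0r. Qed.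

Lemma clamp_clamp (x : R) : clamp (clamp x) = clamp x.
Proof. by rewrite clamp_id//; exact: clamp_types. Qed.

Lemma sscore_le i x y : types x -> types y -> x <= y -> sscore i y <= sscore i x.
Proof.
move=> tx ty xy; rewrite /sscore /active /own !clamp_id//.
have x0 : 0 <= x by move: tx; rewrite typesE => /andP[].
case: (i == favored) => /=.
  apply: bid_score_le; first by rewrite le_min x0 t0.
    by rewrite le_min !ge_min xy lexx orbT.
  by rewrite ge_min lexx orbT.
case: (ltP y t) => yt.
  by rewrite (le_lt_trans xy yt) bid_score_le// ltW.
case: ifP => // xt; apply: (@le_trans _ _ (bid_score t)).
  by rewrite lerNl -normrN ler_norm.
exact: bid_score_le (ltW xt) (lexx t).
Qed.

Lemma bmeas_sscore i : bmeas (sscore i : T -> R).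
Proof.
have := bmeas_nonincreasing_clamp (@sscore_le i).
rewrite (_ : (fun x : T => _) = sscore i)//; apply/funext => x.
by rewrite /sscore /active /own clamp_clamp.
Qed.

Lemma squality_le i x y : types x -> types y -> x <= y -> squality i y <= squality i x.
Proof.
move=> tx ty xy; rewrite /squality /active /own !clamp_id//.
case: (i == favored) => /=.
  by apply: sym_quality_le => //; rewrite le_min !ge_min xy lexx orbT.
case: (ltP y t) => yt; last by case: ifP => // _; exact: sym_quality_ge0.
by rewrite (le_lt_trans xy yt); exact: sym_quality_le.
Qed.

Lemma bmeas_squality i : bmeas (squality i : T -> R).
Proof.
have := bmeas_nonincreasing_clamp (@squality_le i).
rewrite (_ : (fun x : T => _) = squality i)//; apply/funext => x.
by rewrite /squality /active /own clamp_clamp.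
Qed.

Lemma bmeas_sprice i : bmeas (sprice i : T -> R).
Proof.
rewrite (_ : sprice i = fun x => squality i x - sscore i x).
  by apply: bmeasB; [exact: bmeas_squality|exact: bmeas_sscore].
by apply/funext => x; rewrite -sscoreE; ring.
Qed.

Lemma floor_le_sscore x : bid_score t <= sscore favored x.
Proof.
rewrite /sscore/= /own/=; apply: bid_score_le => //.
  by rewrite le_min clamp_ge0 t0.
by rewrite ge_min lexx orbT.
Qed.

Lemma sscore_rival_ge x : types x -> t <= x -> sscore rival x <= bid_score t.
Proof.
move=> tx xt; rewrite /sscore /active/= clamp_id// ltNge xt/=.
by rewrite lerNl -normrN ler_norm.
Qed.

Lemma outcome x y : types x -> types y ->
  (Num.max (sscore rival y) (bid_score t) <= sscore favored x) = threshold_region t x y.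
Proof.
move=> tx ty; rewrite ge_max floor_le_sscore andbT /threshold_region.
have /andP[x0 x1] : 0 <= x <= 1 by rewrite -typesE.
have /andP[y0 y1] : 0 <= y <= 1 by rewrite -typesE.
have [yt|ty'] := ltP y t; last first.
  by rewrite (le_trans (sscore_rival_ge ty ty') (floor_le_sscore x)) ge_min ty' orbT.
rewrite /sscore /active /own/= !clamp_id// yt.
have m0 : 0 <= Num.min x t by rewrite le_min x0 t0.
have mt : Num.min x t <= t by rewrite ge_min lexx orbT.
case: (leP (Num.min x t) y) => my; first by rewrite bid_score_le// ltW.
by apply/negbTE; rewrite -ltNge bid_score_lt.
Qed.

(** A favored type [x] above [t], bidding as [t] does, would earn [a * G t * (t - x)] from the
    contract alone; the bonus makes type 1 break even. *)
Definition bonus : R := a * G t * (1 - t).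

(* Prices and qualities are nonnegative (sprice_ge0, squality01): the absolute
   values only serve to typecheck. *)
Definition auction_strategy : forall i : 'I_2, R -> {nonneg R} * {nonneg R} :=
  fun i x => ((`|sprice i x|)%:nng, (`|squality i x|)%:nng).

Lemma strategy_price i x : (auction_strategy i x).1%:num = sprice i x.
Proof. by rewrite /= ger0_norm// sprice_ge0. Qed.

Lemma strategy_quality i x : (auction_strategy i x).2%:num = squality i x.
Proof. by rewrite /= ger0_norm//; have /andP[] := squality01 i x. Qed.

(** [deviation] without the mechanism, so that the computations serve both auctions. *)
Definition dev (i : 'I_2) (b : {nonneg R} * {nonneg R}) (x : R) :
    'I_2 -> {nonneg R} * {nonneg R} :=
  dfwith (fun j => auction_strategy j x) i b.

Lemma score_dev_own i b x : score (dev i b x) i = b.2%:num - b.1%:num.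
Proof. by rewrite /score /dev dfwithin. Qed.

Lemma score_dev_other i j b x : i != j -> score (dev i b x) j = sscore j x.
Proof. by move=> ij; rewrite /score /dev dfwithout// strategy_price strategy_quality sscoreE. Qed.

Definition win (i : 'I_2) (s x : R) : bool :=
  if i == favored then (bid_score t <= s) && (sscore rival x <= s)
  else sscore favored x < s.

Definition entry (i : 'I_2) (s : R) : R :=
  if i == favored then bonus * (bid_score t <= s)%R%:R else 0.

Lemma floor_share_dev i b x :
  floor_share (bid_score t) i (dev i b x) = (win i (b.2%:num - b.1%:num) x)%:R.
Proof.
rewrite /floor_share /win; case: (firm_cases i) => -> /=.
  by rewrite score_dev_own score_dev_other// ge_max andbC.
rewrite score_dev_own score_dev_other// gt_max; congr (nat_of_bool _)%:R.
apply/idP/idP => [/andP[]//|lt_s]; rewrite lt_s/=.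
exact: le_lt_trans (floor_le_sscore x) lt_s.
Qed.

Lemma floor_transfer_dev i b x :
  floor_transfer (bid_score t) bonus i (dev i b x) =
  b.1%:num * (win i (b.2%:num - b.1%:num) x)%:R + entry i (b.2%:num - b.1%:num).
Proof.
rewrite /floor_transfer floor_share_dev /entry; congr (_ * _ + _).
  by rewrite /dev dfwithin.
by case: (firm_cases i) => -> //=; rewrite score_dev_own.
Qed.

Lemma bmeas_win i s : bmeas (fun x : T => (win i s x)%:R : R).
Proof.
have [m1 _] := bmeas_sscore favored; have [m2 _] := bmeas_sscore rival.
rewrite /win; case: (i == favored).
  case: (bid_score t <= s) => /=; last exact: bmeas_cst.
  by apply: bmeas_bool; exact: measurable_fun_ler.
by apply: bmeas_bool; exact: measurable_fun_ltr.
Qed.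

(** * Payoffs from arbitrary bids *)

Definition win_prob i s : R := Ex P (fun x => (win i s x)%:R).

Lemma win_upper i s x y : types x -> types y -> win i s x -> x <= y -> win i s y.
Proof.
move=> tx ty + xy; rewrite /win; case: (i == favored) => [/andP[-> /=]|].
  exact: le_trans (sscore_le rival tx ty xy).
exact: le_lt_trans (sscore_le favored tx ty xy).
Qed.

Definition equilibrium_rent (i : 'I_2) (x : R) : R :=
  a * rent (Num.min x t) + (if i == favored then a * G t * (1 - Num.max x t) else 0).

Lemma equilibrium_rent_ge0 i x : types x -> 0 <= equilibrium_rent i x.
Proof.
rewrite typesE => /andP[x0 x1]; have a0 := ltW (alpha_gt0 hE).
have /andP[G0 _] := survival01 E t.
rewrite addr_ge0 ?mulr_ge0 ?rent_ge0 ?le_min ?x0 ?t0 ?ge_min ?lexx ?orbT//.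
by case: ifP => // _; rewrite !mulr_ge0// subr_ge0 ge_max x1 t1.
Qed.

Lemma equilibrium_rent1 i : equilibrium_rent i 1 = 0.
Proof.
rewrite /equilibrium_rent (min_r t1) (max_l t1) rent_threshold mulr0 add0r subrr mulr0.
by case: ifP.
Qed.

Definition bid_payoff (i : 'I_2) (x m k : R) : R :=
  (m - a * x) * win_prob i (k - m) + entry i (k - m) - g k.

(** At a given score the opponents beaten are, up to one type, those above some [tau], whatever the
    quality. With the price written as [k - s], the quality contributes at most [cc (G tau)];
    [deviation_bound] handles the score and [rent_incentive] the gap between [tau] and [x]. *)
Lemma bid_payoff_le i (x m k : R) : types x -> 0 <= m -> 0 <= k ->
  bid_payoff i x m k <= equilibrium_rent i x.
Proof.
move=> tx m0 k0; have /andP[x0 x1] : 0 <= x <= 1 by rewrite -typesE.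
have a0 := alpha_gt0 hE.
rewrite /bid_payoff; set s := k - m.
have loses : (forall y, win i s y = false) -> entry i s = 0 ->
    (m - a * x) * win_prob i s + entry i s - g k <= equilibrium_rent i x.
  move=> nw ->; apply: (@le_trans _ _ 0); last exact: equilibrium_rent_ge0.
  rewrite /win_prob (_ : (fun y : T => _) = fun=> 0); last by apply/funext => y; rewrite nw.
  by rewrite Ex_cst mulr0 !add0r oppr_le0 cost_ge0.
have [slt|fs] := ltP s (bid_score t).
  apply: loses; last by rewrite /entry leNgt slt mulr0; case: ifP.
  move=> y; rewrite /win leNgt slt/=; case: ifP => // _; apply/negbTE.
  by rewrite -leNgt (le_trans (ltW slt))// floor_le_sscore.
have [tau' ttau winE] := upper_set_threshold (win_upper (i := i) (s := s)).
pose tau : R := tau'; rewrite -/tau in ttau winE; clearbody tau; clear tau'.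
have /andP[tau0 tau1] : 0 <= tau <= 1 by rewrite -typesE.
have wE : win_prob i s = G tau.
  rewrite -Ex_gt//; apply: (@eq_Ex_types_but _ _ hE tau).
  - exact: bmeas_win.
  - exact: bmeas_gt.
  by move=> y ty ytau; rewrite winE.
(* A rival scoring exactly the floor beats nobody, as the favored firm always reaches the floor and
   wins ties; [tau <= t] may then fail. *)
have [nobody|somebody] := pselect (i = rival /\ s = bid_score t).
  case: nobody => ie se; apply: loses => [y|]; last by rewrite /entry ie.
  by rewrite /win ie/= se; apply/negbTE; rewrite -leNgt floor_le_sscore.
have wins_above (y : R) : types y -> t <= y -> win i s y.
  move=> ty ty'; rewrite /win; case: (firm_cases i) => [->|ie]/=.
    by rewrite fs (le_trans _ fs)// sscore_rival_ge.
  rewrite ie/= /sscore/= /own/= clamp_id// (min_r ty').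
  by rewrite lt_neqAle fs andbT; apply/eqP => se; apply: somebody.
have taut : tau <= t.
  rewrite leNgt; apply/negP => ttau'.
  have [m1 m2] := midf_lt ttau'.
  have tm : types ((t + tau) / 2).
    by rewrite typesE (le_trans t0 (ltW m1)) (le_trans (ltW m2) tau1).
  have := wins_above _ tm (ltW m1).
  by rewrite winE ?lt_eqF// ltNge (ltW m2).
have below (y : R) : tau < y -> y < t -> bid_score y <= s.
  move=> tauy yt; have ty : types y.
    by rewrite typesE (le_trans tau0 (ltW tauy)) (le_trans (ltW yt) t1).
  have : win i s y by rewrite winE// gt_eqF.
  rewrite /win; case: (i == favored).
    by rewrite /sscore /active /own/= clamp_id// yt => /andP[].
  by rewrite /sscore/= /own/= clamp_id// (min_l (ltW yt)) => /ltW.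
have db := deviation_bound tau0 taut fs below.
have c1 := conjugate_cost_ub hE k0 (survival01 E tau).
have ic := ler_wpM2l (ltW a0) (rent_incentive tau0 taut x0 x1).
have en : entry i s = if i == favored then a * G t * (1 - t) else 0.
  by rewrite /entry /bonus fs mulr1.
have me : m = k - s by rewrite /s; ring.
rewrite wE en /equilibrium_rent {}me; case: ifP => _.
  by nra.
(* The rival gets no bonus, and a type beyond [t] would earn a nonpositive amount as [t]; staying
   out is at least as good. *)
have : a * (G t * (t - Num.max x t)) <= 0.
  rewrite mulr_ge0_le0 ?(ltW a0)// mulr_ge0_le0 ?subr_le0 ?le_max ?lexx ?orbT//.
  by have /andP[] := survival01 E t.
by nra.
Qed.

(** Up to one type, an active bid beats exactly the opponents above [own i x], and [bid_scoreM] is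
    its price equation; an inactive rival never wins and invests nothing. *)
Lemma bid_payoff_eq i (x : R) : types x ->
  bid_payoff i x (sprice i x) (squality i x) = equilibrium_rent i x.
Proof.
move=> tx; have /andP[x0 x1] : 0 <= x <= 1 by rewrite -typesE.
rewrite /bid_payoff sscoreE; case: (boolP (active i x)) => act; last first.
  move: (act); rewrite /active negb_or -leNgt clamp_id// => /andP[iF tx'].
  have ir : i = rival by case: (firm_cases i) => // ie; move: iF; rewrite ie.
  have nw y : win i (sscore i x) y = false.
    rewrite /win (negbTE iF); apply/negbTE; rewrite -leNgt.
    apply: le_trans (floor_le_sscore y); rewrite ir.
    exact: sscore_rival_ge.
  rewrite /win_prob (_ : (fun y : T => _) = fun=> 0); last by apply/funext => y; rewrite nw.
  rewrite Ex_cst mulr0 add0r /entry (negbTE iF) add0r /squality (negbTE act) cost0// oppr0.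
  by rewrite /equilibrium_rent (negbTE iF) (min_r tx') rent_threshold mulr0 addr0.
have [m0 mt] := own_itv act.
have wE : win_prob i (sscore i x) = G (own i x).
  rewrite -Ex_gt//; apply: (@eq_Ex_types_but _ _ hE (own i x)).
  - exact: bmeas_win.
  - exact: bmeas_gt.
  move=> y ty ym; congr (_%:R); have [ie|ie] := firm_cases i.
    rewrite /win ie/= floor_le_sscore/=.
    have := outcome tx ty; rewrite ge_max floor_le_sscore andbT => ->.
    rewrite /threshold_region /own/= clamp_id//.
    by rewrite le_eqVlt; move: ym; rewrite ie /own/= clamp_id// eq_sym => /negbTE ->.
  rewrite /win ie/=; have := outcome ty tx; rewrite ge_max floor_le_sscore andbT => o.
  rewrite ltNge o /threshold_region -ltNge /own/= clamp_id//.
  move: act; rewrite /active ie/= clamp_id// => xt.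
  by rewrite lt_min xt andbT.
rewrite wE; have /= NE := bid_scoreM m0 mt.
have eE : entry i (sscore i x) = if i == favored then a * G t * (1 - t) else 0.
  rewrite /entry; case: (firm_cases i) => -> //=.
  by rewrite floor_le_sscore mulr1.
rewrite eE /squality act.
have pE : sprice i x = q (own i x) - bid_score (own i x).
  by rewrite /sprice act /bid_score; ring.
rewrite pE /equilibrium_rent; move: NE; rewrite /conjugate_cost -/(q _).
case: (firm_cases i) act => -> /=.
  rewrite /own/= clamp_id//; have [xt _ NE|tx' _ NE] := leP x t.
    by lra.
  by lra.
rewrite /active /own/= clamp_id// => xt NE.
by rewrite (min_l (ltW xt)); lra.
Qed.

(** * Feasibility and optimality of the auction *)

Section mechanism.
(** The rules are prescribed only after unilateral deviations, where the first-score auction meets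
    them at [t = 1]. *)
Variables (sh tr : 'I_2 -> ('I_2 -> {nonneg R} * {nonneg R}) -> R).
Hypothesis shE : forall i b x, sh i (dev i b x) = floor_share (bid_score t) i (dev i b x).
Hypothesis trE : forall i b x, tr i (dev i b x) = floor_transfer (bid_score t) bonus i (dev i b x).

Let A : @mechanism R := @Mechanism R (fun=> {nonneg R}) sh tr.
Let sigma : strategy A := auction_strategy.

Lemma share_dev i b x : share i (@deviation R A sigma i b x) = (win i (b.2%:num - b.1%:num) x)%:R.
Proof. by rewrite -floor_share_dev -shE. Qed.

Lemma transfer_dev i b x : transfer i (@deviation R A sigma i b x) =
  b.1%:num * (win i (b.2%:num - b.1%:num) x)%:R + entry i (b.2%:num - b.1%:num).
Proof. by rewrite -floor_transfer_dev -trE. Qed.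

Lemma played_dev i p : played sigma p =
  deviation sigma (sigma i (type_of p i)) (if i == favored then p.2 else p.1).
Proof. by rewrite deviation_played; congr played; rewrite /place /type_of; case: p; case: (i == favored). Qed.

Lemma share_played i p : share i (played sigma p) =
  (win i (sscore i (type_of p i)) (if i == favored then p.2 else p.1))%:R.
Proof. by rewrite (played_dev i) share_dev strategy_price strategy_quality sscoreE. Qed.

Lemma transfer_played i p : transfer i (played sigma p) =
  sprice i (type_of p i) * share i (played sigma p) + entry i (sscore i (type_of p i)).
Proof.
by rewrite share_played (played_dev i) transfer_dev strategy_price strategy_quality sscoreE.
Qed.

Lemma share_region p : profiles p ->
  share favored (played sigma p) = (threshold_region t p.1 p.2)%:R /\
  share rival (played sigma p) = (~~ threshold_region t p.1 p.2)%:R.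
Proof.
move=> [tx ty]; rewrite !share_played /type_of/= /win/= -outcome//.
rewrite ge_max floor_le_sscore/= andbT; split => //.
by rewrite ltNge.
Qed.

Lemma bmeas_type_of i (u : T -> R) : bmeas u -> bmeas (fun p : T * T => u (type_of p i)).
Proof.
by move=> bu; rewrite /type_of; case: (i == favored); [exact: bmeas_fst|exact: bmeas_snd].
Qed.

Lemma bmeas_share_played i : bmeas (fun p : T * T => share i (played sigma p)).
Proof.
rewrite (_ : (fun p : T * T => _) = fun p =>
    (win i (sscore i (type_of p i)) (if i == favored then p.2 else p.1))%:R); last first.
  by apply/funext => p; exact: share_played.
have b1 := bmeas_fst (bmeas_sscore favored); have b2 := bmeas_snd (bmeas_sscore rival).
have bc : bmeas (fun _ : T * T => bid_score t) by exact: bmeas_cst.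
rewrite /win /type_of; case: (firm_cases i) => -> /=; last exact: (bmeas_lt b1 b2).
rewrite (_ : (fun p : T * T => _) = fun p : T * T =>
    (bid_score t <= sscore favored p.1)%R%:R * (sscore rival p.2 <= sscore favored p.1)%R%:R).
  exact: (bmeasM (bmeas_le bc b1) (bmeas_le b2 b1)).
by apply/funext => p; rewrite -natrM mulnb.
Qed.

Lemma bmeas_entry i (u : T * T -> R) : bmeas u -> bmeas (fun p => entry i (u p)).
Proof.
move=> bu; rewrite /entry; case: (i == favored); last exact: bmeas_cst.
by apply: bmeasZ; apply: bmeas_le => //; exact: bmeas_cst.
Qed.

Lemma interim_payoff_auction i x b : @interim_payoff R E A sigma i x b = bid_payoff i x b.1%:num b.2%:num.
Proof.
set s := b.2%:num - b.1%:num.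
have bw := bmeas_win i s.
have e (y : T) : transfer i (@deviation R A sigma i b y) - a * x * share i (@deviation R A sigma i b y) =
    (b.1%:num - a * x) * (win i s y)%:R + entry i s.
  by rewrite share_dev transfer_dev; ring.
have bi : bmeas (fun y : T => (b.1%:num - a * x) * (win i s y)%:R + entry i s).
  by apply: bmeasD; [exact: bmeasZ|exact: bmeas_cst].
rewrite /interim_payoff (@eq_Rintegral _ _ _ _ _ (fun y : T => (b.1%:num - a * x) * (win i s y)%:R + entry i s)); last first.
  by move=> y _; exact: e.
have -> : (\int[P]_(y in types) ((b.1%:num - a * x) * (win i s y)%:R + entry i s))%R =
    Ex P (fun y => (b.1%:num - a * x) * (win i s y)%:R + entry i s).
  rewrite /Rintegral (EFin_Ex_event (@measurable_types R) (law_types hE))//.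
by rewrite ExD ?ExZ ?Ex_cst//; [exact: bmeasZ|exact: bmeas_cst].
Qed.

Lemma bmeas_integrable_types (u : T -> R) : bmeas u -> P.-integrable types (EFin \o u).
Proof.
move=> bu; apply: (integrableS measurableT) => //; first exact: measurable_types.
exact: bmeas_integrableP.
Qed.

Lemma bmeas_integrable_profiles (u : T * T -> R) : bmeas u ->
  (P \x P)%E.-integrable profiles (EFin \o u).
Proof.
move=> bu; apply: (integrableS measurableT) => //; first exact: measurable_profiles.
exact: bmeas_integrable_prod.
Qed.

Lemma auction_feasible : feasible E sigma.
Proof.
split.
- move=> i; rewrite (_ : (fun x => _) = squality i); last first.
    by apply/funext => x; exact: strategy_quality.
  by apply: measurable_funTS; case: (bmeas_squality i).
- by move=> i; apply: bmeas_integrable_profiles; exact: bmeas_share_played.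
- move=> i; apply: bmeas_integrable_profiles.
  rewrite (_ : (fun p => _) = fun p : T * T =>
    sprice i (type_of p i) * share i (played sigma p) + entry i (sscore i (type_of p i))).
    apply: bmeasD; last by apply: bmeas_entry; apply: bmeas_type_of; exact: bmeas_sscore.
    apply: bmeasM; last exact: bmeas_share_played.
    by apply: bmeas_type_of; exact: bmeas_sprice.
  by apply/funext => p; exact: transfer_played.
- move=> i; apply: bmeas_integrable_profiles; apply: bmeasM; last exact: bmeas_share_played.
  rewrite (_ : (fun p => _) = fun p : T * T => squality i (type_of p i)).
    by apply: bmeas_type_of; exact: bmeas_squality.
  by apply/funext => p; exact: strategy_quality.
- move=> i b; have bw := bmeas_win i (b.2%:num - b.1%:num); split.
    have := bmeas_integrable_types bw; apply: eq_integrable; first exact: measurable_types.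
    by move=> x _; rewrite share_dev.
  have bt : bmeas (fun x : T => b.1%:num * (win i (b.2%:num - b.1%:num) x)%:R + entry i (b.2%:num - b.1%:num)).
    by apply: bmeasD; [exact: bmeasZ|exact: bmeas_cst].
  have := bmeas_integrable_types bt; apply: eq_integrable; first exact: measurable_types.
  by move=> x _; rewrite transfer_dev.
- move=> i x b x01; rewrite !interim_payoff_auction strategy_price strategy_quality.
  by rewrite bid_payoff_eq// bid_payoff_le.
- move=> i x x01; rewrite interim_payoff_auction strategy_price strategy_quality.
  by rewrite bid_payoff_eq// equilibrium_rent_ge0.
- by move=> i p pp; rewrite share_played.
- move=> p pp; rewrite sum_firms; have [-> ->] := share_region pp.
  by case: (threshold_region _ _ _); rewrite /= ?addr0 ?add0r.
Qed.

Lemma bmeas_region_integrand r : bmeas_region r -> bmeas (fun p : T * T =>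
  (q p.2 - a * virtual_type E (clamp p.1)) * (r p.1 p.2)%:R +
  (q p.1 - a * virtual_type E (clamp p.2)) * (1 - (r p.1 p.2)%:R)).
Proof.
move=> br; have bq := bmeas_sym_quality hE.
have bJ : bmeas (fun x : T => a * virtual_type E (clamp x)) by apply: bmeasZ; exact: bmeas_virtual_type.
apply: bmeasD; apply: bmeasM => //; do ?apply: bmeasB => //;
  by [exact: bmeas_cst|exact: (bmeas_fst bq)|exact: (bmeas_snd bq)|exact: (bmeas_fst bJ)|exact: (bmeas_snd bJ)].
Qed.

Lemma eq_region_value r r' : bmeas_region r -> bmeas_region r' ->
  (forall x y, types x -> types y -> r x y = r' x y) -> region_value E r = region_value E r'.
Proof.
move=> br br' rr'; have b := bmeas_region_integrand br; have b' := bmeas_region_integrand br'.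
apply: (eq_Ex_types hE (bmeas_Ex1 P P b) (bmeas_Ex1 P P b')) => x tx.
apply: (eq_Ex_types hE (bmeas_section1 x b) (bmeas_section1 x b')) => y ty /=.
by rewrite rr'.
Qed.

(** Every bid has the quality [Q] of its winning probability, the equality case of Fenchel-Young;
    for inactive rivals this is [Q 0 = 0]. *)
Lemma auction_relaxed : relaxed_objective E (qualities sigma) (shares sigma) =
  (region_value E (threshold_region t))%:E.
Proof.
have rf := relaxed_feasible_of_feasible auction_feasible.
have qE i x : qualities sigma i x = squality i x by exact: strategy_quality.
rewrite (relaxed_objective_bounded hE rf); last first.
  by move=> i x _; rewrite qE; have /andP[] := squality01 i x.
(* The clamped shares are this region on the whole plane; [region_value] does not distinguish it
   from [threshold_region t], with which it agrees on types. *)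
congr EFin; pose rr (x y : R) := threshold_region t (clamp x) (clamp y).
have brr : bmeas_region rr.
  have bm : bmeas (fun x : T => Num.min (clamp x) t).
    rewrite (_ : (fun x : T => _) = fun x : T => - Num.max (- clamp x) (- t)).
      by apply/bmeasN/bmeas_max; [exact/bmeasN/bmeas_clamp|exact: bmeas_cst].
    by apply/funext => x; rewrite oppr_max !opprK.
  by apply: (bmeas_le (bmeas_fst bm) (bmeas_snd (@bmeas_clamp R))).
have mrr : monotone_region rr.
  move=> x y x' y' tx ty tx' ty' xx yy; rewrite /rr /threshold_region !clamp_id// => xy.
  apply: le_trans yy; apply: le_trans xy.
  by rewrite le_min !ge_min xx lexx orbT.
have -> : clamped (shares sigma favored) = fun p => (rr p.1 p.2)%:R.
  apply/funext => p; rewrite /clamped /shares.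
  have pp : profiles (clamp p.1, clamp p.2) by split; exact: clamp_types.
  by have [-> _] := share_region pp.
have sq i : quality_schedule E (fun x => qualities sigma i (clamp x)).
  split; last by move=> x; rewrite qE; exact: squality01.
  rewrite (_ : (fun x => _) = fun x : T => squality i (clamp x)).
    by apply: (bmeas_comp (@measurable_clamp R)); exact: bmeas_squality.
  by apply/funext => x; rewrite qE.
rewrite (welfare_eq_region_value hE brr mrr (sq favored) (sq rival)).
- apply: eq_region_value => //; first exact: bmeas_threshold_region.
  by move=> x y tx ty; rewrite /rr !clamp_id.
- move=> x tx; rewrite qE clamp_id// /squality/= /own/= clamp_id//; congr Q.
  rewrite /win1 -Ex_gt//; apply: (@eq_Ex_types_but _ _ hE (Num.min x t)).
  + exact: bmeas_gt.
  + exact: (bmeas_section1 x brr).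
  move=> y ty ym; congr (nat_of_bool _)%:R.
  by rewrite /rr /threshold_region !clamp_id// le_eqVlt eq_sym (negbTE ym).
- move=> y ty; rewrite qE clamp_id// /squality /active /own/= clamp_id//.
  have bl : bmeas (fun x : T => (~~ rr x y)%:R : R) by exact: (bmeas_section2 y (bmeas_lose brr)).
  case: (ltP y t) => yt.
    congr Q; rewrite /win2 -Ex_gt//; apply: (eq_Ex_types hE) => //; first exact: bmeas_gt.
    move=> x tx; congr (nat_of_bool _)%:R.
    by rewrite /rr /threshold_region !clamp_id// -ltNge lt_min yt andbT.
  rewrite -[LHS](inv_marginal_cost0 hE); congr Q; rewrite -[LHS](Ex_cst P) /win2.
  apply: (eq_Ex_types hE) => //; first exact: bmeas_cst.
  by move=> x tx; rewrite /rr /threshold_region !clamp_id// ge_min yt orbT.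
Qed.

Lemma auction_utility : buyer_utility E sigma = (region_value E (threshold_region t))%:E.
Proof.
have fs := auction_feasible.
have [r [rE ->]] := revenue_equivalence hE fs.
have U0 i : equilibrium_payoff E sigma i 1 = 0.
  rewrite /equilibrium_payoff interim_payoff_auction strategy_price strategy_quality.
  by rewrite bid_payoff_eq ?equilibrium_rent1//; exact: types1.
by rewrite !U0 addr0 subr0 -rE auction_relaxed.
Qed.

Lemma auction_optimal :
  (forall q z, relaxed_feasible q z ->
    (relaxed_objective E q z <= (region_value E (threshold_region t))%:E)%E) ->
  buyer_utility E sigma = U_asy E /\ solves_buyer_problem E sigma.
Proof.
move=> ub; split; last split; [|exact: auction_feasible|].
- rewrite auction_utility; apply/eqP; rewrite eq_le; apply/andP; split.
    apply: ereal_sup_ubound; exists (qualities sigma), (shares sigma); split.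
      exact: relaxed_feasible_of_feasible auction_feasible.
    by rewrite auction_relaxed.
  by apply: ge_ereal_sup => _ [q' [z' [qz ->]]]; exact: ub.
- move=> M' sigma' fs'; rewrite auction_utility.
  have [r [rE ->]] := revenue_equivalence hE fs'.
  apply: le_trans (ub _ _ (relaxed_feasible_of_feasible fs')).
  rewrite rE lee_fin gerBl addr_ge0//; apply: (participation fs');
    by rewrite in_itv/= lexx ler01.
Qed.

End mechanism.

(** The added quotient cancels the rent in [score_sym], leaving the score of a threshold type
    without rent. *)
Lemma bid_score_floor : score_floor E t = bid_score t.
Proof.
rewrite /score_floor /score_sym /bid_score /bid_price rent_threshold /quality_sym -/(q t).
by rewrite mulr0 addr0 mulrDl; ring.
Qed.

(* At t = 1 the bonus vanishes, and no firm that plays the suggested strategy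
   scores below the floor, which is therefore immaterial. *)
Lemma first_score_dev i b x : t = 1 ->
  first_score_share i (dev i b x) = floor_share (bid_score t) i (dev i b x) /\
  first_score_transfer i (dev i b x) = floor_transfer (bid_score t) bonus i (dev i b x).
Proof.
move=> te.
have s1 : bid_score t = - a.
  have G0 : G t = 0 by rewrite te type_cdf1// subrr.
  rewrite /bid_score /bid_price /sym_quality G0 inv_marginal_cost0// cost0//.
  by rewrite invr0 mulr0 te; ring.
have low : bid_score t <= sscore rival x.
  rewrite /sscore /active /own/=; case: ifP => [xt|_].
    by apply: bid_score_le; rewrite ?clamp_ge0 ?lexx// ltW.
  by rewrite s1 normrN gtr0_norm ?alpha_gt0.
have sE : first_score_share i (dev i b x) = floor_share (bid_score t) i (dev i b x).
  rewrite floor_share_dev /first_score_share /win; case: (firm_cases i) => -> /=.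
    rewrite score_dev_own score_dev_other//; congr (nat_of_bool _)%:R.
    apply/idP/andP => [le_s|[]//]; split => //; exact: le_trans le_s.
  by rewrite score_dev_own score_dev_other.
split=> //; rewrite /first_score_transfer sE /floor_transfer /bonus te subrr mulr0.
by case: ifP => _; rewrite ?mul0r addr0.
Qed.

End threshold.

End auction.

Theorem theorem2 (R : realType) (E : environment R)
    (hE : separable_structure E) (hconv : sufficiently_convex E) :
  exists theta0 : R, 0 <= theta0 <= 1 /\
    exists sigma : strategy (score_floor_auction E theta0),
      buyer_utility E sigma = U_asy E /\ solves_buyer_problem E sigma.
Proof.
have [t t01 ub] := relaxed_upper_bound hE hconv.
exists t; split => //; have /andP[t0 t1] := t01; rewrite /score_floor_auction; case: ltP => t1'.
  rewrite bid_score_floor//.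
  by exists (auction_strategy E t); apply: auction_optimal ub.
have te : t = 1 by apply/eqP; rewrite eq_le t1 t1'.
exists (auction_strategy E t); apply: auction_optimal ub => // i b x.
  by have [] := first_score_dev hE t0 t1 i b x te.
by have [] := first_score_dev hE t0 t1 i b x te.
Qed.
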